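(* Let $X,X_1,X_2,\dots$ be i.i.d. real random variables with distribution function $F$ and $E(X^2)<\infty$, let $X_{1n}\le\dots\le X_{nn}$ be the order statistics of $X_1,\dots,X_n$, let $J$ be a fixed score function and $$L_n=\sum_{i=1}^nX_{in}\int_{(i-1)/n}^{i/n}J(u)\,du=\int_0^1F_n^{-1}(s)J(s)\,ds,$$ where $F_n$ is the empirical distribution function of $X_1,\dots,X_n$. Let $$m(J,F)=\int_{-\infty}^{\infty}xJ(F(x))\,dF(x),\qquad \sigma^2(J,F)=\int_{\mathbb R^2}J(F(x))J(F(y))\bigl(F(x\wedge y)-F(x)F(y)\bigr)\,dx\,dy,$$ and assume $\sigma^2(J,F)>0$. Assume that $$\Lambda_{2,1}(X)=\int_0^\infty\sqrt{P(|X|>t)}\,dt<\infty,$$ that $a(n)\nearrow\infty$ and $a(n)/\sqrt n\searrow0$, and that $$\limsup_{n\to\infty}\frac1{a^2(n)}\log\bigl(nP(|X|\ge\sqrt n\,a(n))\bigr)=-\infty.$$ If $J$ is Lipschitz continuous on $[0,1]$, then $\left\{\frac{\sqrt n}{a(n)}(L_n-m(J,F)),n\ge1\right\}$ satisfies the large deviation principle in $\mathbb R$ with speed $a^2(n)$ and rate function $$I^L(x)=\frac{x^2}{2\sigma^2(J,F)}.$$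
   Context: $a(n)$ is a sequence of positive reals. For a distribution function $H$, $H^{-1}(s)=\inf\{x;H(x)\ge s\}$, and $x\wedge y=\min\{x,y\}$. Large deviation principle (LDP). For random variables $W_n$ with values in a metric space $\mathcal X$, positive $\lambda(n)\to\infty$, and $I:\mathcal X\to[0,\infty]$ with $\{I\le L\}$ compact for all $L\in\mathbb R$ (rate function), $\{W_n\}$ satisfies the LDP with speed $\lambda(n)$ and rate function $I$ if $\liminf_n\frac1{\lambda(n)}\log P(W_n\in U)\ge-\inf_UI$ for every open $U$ and $\limsup_n\frac1{\lambda(n)}\log P(W_n\in K)\le-\inf_KI$ for every closed $K$ ($\inf\emptyset=+\infty$, $\log 0=-\infty$).
   Formalization: The claim centred at m(J,F) is proved for continuous F only, since it fails with atoms (X Bernoulli(1/2), J(u)=u: L_n tends to 3/8 but m(J,F)=1/2); for every F it is proved with m(J,F) replaced by the integral of F^{-1}(s)J(s) over [0,1]. *)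

(* Defs.v *)
From HB Require Import structures.
From mathcomp Require Import all_boot all_order all_algebra.
From mathcomp Require Import all_classical all_reals all_analysis.

Set Implicit Arguments.
Unset Strict Implicit.
Unset Printing Implicit Defensive.

Import Order.TTheory GRing.Theory Num.Theory.
Import numFieldNormedType.Exports.

Local Open Scope classical_set_scope.
Local Open Scope ring_scope.

Section large_deviations.
Context d (T : measurableType d) (R : realType) (P : probability T R).

Definition rate_function (Y : metricType R) (I : Y -> \bar R) :=
  (forall y, (0 <= I y)%E) /\ (forall L : R, compact [set y | (I y <= L%:E)%E]).

(* Only the indices n >= 1 matter. The first conjunct on W says that every W_n
   is Borel measurable, so that P is only applied to events below. *)
Definition LDP (Y : metricType R) (W : nat -> T -> Y) (speed : nat -> R)
    (I : Y -> \bar R) :=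
  [/\ forall n U, (0 < n)%N -> open U -> measurable (W n @^-1` U),
      (forall n, (0 < n)%N -> 0 < speed n) /\ speed n @[n --> \oo] --> +oo,
      rate_function I,
      forall U : set Y, open U ->
        (- ereal_inf (I @` U) <=
         limn_einf (fun n => ((speed n)^-1)%:E * lne (P (W n @^-1` U))))%E
    & forall K : set Y, closed K ->
        (limn_esup (fun n => ((speed n)^-1)%:E * lne (P (W n @^-1` K))) <=
         - ereal_inf (I @` K))%E].

End large_deviations.

Section random_variables.
Context d (T : measurableType d) (R : realType) (P : probability T R).

Definition mutually_independent (X : nat -> {RV P >-> R}) :=
  forall (s : seq nat) (A : nat -> set R), uniq s ->
    (forall i, measurable (A i)) ->
    P (\big[setI/setT]_(i <- s) (X i @^-1` A i)) =
    (\prod_(i <- s) P (X i @^-1` A i))%E.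

Definition identically_distributed (X Y : {RV P >-> R}) :=
  forall A : set R, measurable A -> P (X @^-1` A) = P (Y @^-1` A).

Definition distribution_function (X : {RV P >-> R}) (x : R) : R :=
  fine (cdf X x).

Definition Lambda21 (X : {RV P >-> R}) : \bar R :=
  (\int[@lebesgue_measure R]_(t in `[0%R, +oo[)
     (Num.sqrt (fine (P [set w | t < `|X w|])))%:E)%E.

End random_variables.

Section L_statistics.
Context {R : realType}.
Local Notation leb := (@lebesgue_measure R).

(* X i stands for X_{i+1}, so the sample X_1, ..., X_n is X 0, ..., X n.-1, and
   order_stat X n i is the (i+1)-st smallest of its values. *)
Definition order_stat (T : Type) (X : nat -> T -> R) (n i : nat) (w : T) : R :=
  nth 0 (sort <=%R [seq X j w | j <- iota 0 n]) i.

Definition L_stat (T : Type) (J : R -> R) (X : nat -> T -> R) (n : nat)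
    (w : T) : R :=
  \sum_(i < n) order_stat X n i w *
    \int[leb]_(u in `[i%:R / n%:R, i.+1%:R / n%:R]) J u.

Definition quantile (H : R -> R) (s : R) : R := inf [set x | s <= H x].

Definition mJF d (T : measurableType d) (P : probability T R) (J : R -> R)
    (X : {RV P >-> R}) : R :=
  \int[distribution P X]_x (x * J (distribution_function X x)).

(* The limit of L_n. It coincides with mJF when the distribution function is
   continuous, but in general not when it has jumps: for X Bernoulli(1/2) and
   J u = u, it is 3/8 whereas mJF is 1/2. *)
Definition quantile_mean (J F : R -> R) : R :=
  \int[leb]_(s in `[0, 1]) (quantile F s * J s).

Definition sigma2 (J F : R -> R) : R :=
  \int[(leb \x leb)%E]_z
    (J (F z.1) * J (F z.2) * (F (Num.min z.1 z.2) - F z.1 * F z.2)).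

End L_statistics.

(* Main.v *)
Require Import Defs.
From HB Require Import structures.
From mathcomp Require Import all_boot all_order all_algebra.
From mathcomp Require Import all_classical all_reals all_analysis.
From mathcomp Require Import measurable_realfun.
From mathcomp Require Import ring lra.

Import Order.TTheory GRing.Theory Num.Theory.
Import numFieldNormedType.Exports.

Local Open Scope classical_set_scope.
Local Open Scope ring_scope.

(** The centring constant is [mu], the integral of [J s * quantile F s] over
    ]0, 1[, and the centred L-statistic [L_n - mu] is the integral of [J] against
    the difference of the empirical and the true quantile functions. Exchanging
    integrals turns it into the integral over [x] of the integral of [J] from
    [F_n x] to [F x] ([quantile_exchange]). As [J] is Lipschitz, the inner integral
    is [J (F x) * (F x - F_n x)] up to a multiple of [(F_n x - F x)^2]. Therefore
    [L_n - mu] is the empirical mean of the centred influence function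
    [Z u = - lin nu (J o F) u], up to a multiple of the integral of [(F_n - F)^2]
    ([linearization]). Moreover [Z u] grows at most linearly in [u], and its variance
    is [sigma2 J F] ([integral_lin2]).

    The linear part. Put [level n = sqrt n * a n] and [slope n = a n / sqrt n].
    Truncating [Z] where [`|u|] exceeds [level n] goes unnoticed at speed [a n ^ 2],
    by the assumption on the tail. That assumption bounds the tail at the levels
    only, but the monotonicity of [slope] propagates it to all smaller arguments
    ([tail_exponential]), so that the part of the truncated variable where
    [slope n * `|u|] is large contributes little to its exponential moments at
    [slope n] ([tail_laplace]). Hence the exponential moment of [slope n * th * Z],
    truncated, is [1 + slope n ^ 2 * (th ^ 2 * sigma2 J F / 2 + o(1))]
    ([truncated_mgf]). Taking [n]-th powers, with [n * slope n ^ 2 = a n ^ 2], gives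
    the logarithmic moments of a Gaussian variable, and these yield the large
    deviation principle with a quadratic rate, by Chernoff's bound from above and
    exponential tilting from below ([gaussian_LDP]).

    The remainder. The integral of [(F_n - F)^2] is [n ^ -2] times the squared norm
    of a sum of [n] independent centred vectors of L2, namely the functions
    [1_(u <= x) - F x] of [x], whose norms are [O(1 + `|u|)]. Because [cosh (sqrt u)]
    is convex in [u], the mean of [cosh] of a multiple of that norm grows by at most
    a fixed factor with each term ([pinelis]). Restricted to observations below
    [level n] and at the exponent [slope n], that factor is [1 + O(slope n ^ 2)], so
    that the mean is at most [exp (O(a n ^ 2))]. For the remainder to be of the
    order of [a n / sqrt n], the exponent [slope n] times the norm has to be of the
    order of [a n ^ 2 / sqrt (slope n)], and since [slope n] vanishes this has
    probability smaller than any [exp (- K * a n ^ 2)] ([gram_tail]). So the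
    remainder is exponentially negligible.

    If [F] is continuous, substituting [x = quantile F s] identifies [mu] with
    [mJF J X] ([mJF_quantile_mean]), and the same principle holds with that
    centring. *)

(** * Exponential inequalities *)

Section exponential_inequalities.
Context {R : realType}.
Implicit Types x y r c : R.

Lemma expR_taylor1_ge0 x : 0 <= expR x - 1 - x.
Proof. by have := expR_ge1Dx x; lra. Qed.

Lemma expR_taylor1_le x : expR x - 1 - x <= x ^+ 2 * expR `|x|.
Proof.
have h1 := expR_ge1Dx (- x); have e0 := expR_gt0 x; have e1 := expR_gt0 (- x).
have e2 := expR_ge1Dx x.
have eN : expR x * expR (- x) = 1 by rewrite -expRD subrr expR0.
have [x0|x0] := leP 0 x.
- rewrite ger0_norm//.
  have : expR x - 1 <= x * expR x by nra.
  nra.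
- rewrite ltr0_norm//.
  have : 1 <= expR (- x) by lra.
  nra.
Qed.

Lemma expR_taylor2_le x :
  `|expR x - 1 - x - x ^+ 2 / 2| <= `|x| ^+ 3 * expR `|x|.
Proof.
pose f := fun y : R => expR y - 1 - y - y ^+ 2 / 2.
have df (y : R) : is_derive y (1 : R) f (expR y - 1 - y).
  rewrite /f; apply: is_derive_eq.
  rewrite /GRing.scale/= ?mulr0 ?oppr0; lra.
have cf : continuous f.
  by move=> y; apply: differentiable_continuous; apply/derivable1_diffP; case: (df y).
have bnd (y : R) : `|y| <= `|x| -> `|expR y - 1 - y| <= `|x| ^+ 2 * expR `|x|.
  move=> yx; rewrite ger0_norm ?expR_taylor1_ge0//.
  apply: le_trans (expR_taylor1_le y) _.
  rewrite -[y ^+ 2]real_normK ?num_real//.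
  by apply: ler_pM; rewrite ?expR_ge0 ?sqr_ge0 ?lerXn2r ?nnegrE// ler_expR.
have f0 : f 0 = 0 by rewrite /f expR0; lra.
rewrite -/(f x) exprSr -mulrA [`|x| * _]mulrC mulrA.
have [x0|x0] := leP 0 x.
- have [] := @MVT_segment _ f _ 0 x x0 (fun y _ => df y).
    exact: continuous_subspaceT.
  move=> c; rewrite in_itv/= => /andP[c0 cx]; rewrite f0 !subr0 => ->.
  by rewrite normrM ler_wpM2r// bnd// !ger0_norm.
- have [] := @MVT_segment _ f _ x 0 (ltW x0) (fun y _ => df y).
    exact: continuous_subspaceT.
  move=> c; rewrite in_itv/= => /andP[xc c0]; rewrite f0 !sub0r.
  move=> h; rewrite -normrN h normrM normrN ler_wpM2r// bnd//.
  by rewrite (ler0_norm c0) (ltr0_norm x0) lerN2.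
Qed.

Lemma expR_abs_sub1_le x : `|expR x - 1| <= expR `|x|.
Proof.
have e0 := expR_gt0 x; have [x0|x0] := leP 0 x.
  have e1 := expR_ge1Dx x; rewrite (ger0_norm x0) ger0_norm; lra.
have e1 := expR_ge1Dx (- x).
have : expR x <= 1 by rewrite -expR0 ler_expR ltW.
by rewrite (ltr0_norm x0) => ?; rewrite ler0_norm; lra.
Qed.

Definition cosh x : R := (expR x + expR (- x)) / 2.
Definition sinh x : R := (expR x - expR (- x)) / 2.

Lemma is_derive_cosh x : is_derive x (1 : R) cosh (sinh x).
Proof.
rewrite /cosh /sinh; apply: is_derive_eq; rewrite /GRing.scale/= ?mulr0 ?oppr0; lra.
Qed.

Lemma is_derive_sinh x : is_derive x (1 : R) sinh (cosh x).
Proof.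
rewrite /cosh /sinh; apply: is_derive_eq; rewrite /GRing.scale/= ?mulr0 ?oppr0; lra.
Qed.

Lemma sinh0 : sinh 0 = 0. Proof. by rewrite /sinh oppr0 subrr mul0r. Qed.

Lemma cosh0 : cosh 0 = 1. Proof. by rewrite /cosh oppr0 expR0; lra. Qed.

Lemma cosh_gt0 x : 0 < cosh x.
Proof. by rewrite /cosh divr_gt0// addr_gt0// expR_gt0. Qed.

Lemma sinh_ge0 x : 0 <= x -> 0 <= sinh x.
Proof. by move=> x0; rewrite /sinh divr_ge0// subr_ge0 ler_expR; lra. Qed.

Lemma sinh_le_cosh x : sinh x <= cosh x.
Proof. by rewrite /sinh /cosh; have := expR_gt0 (- x); lra. Qed.

Lemma expR_le_cosh x : expR x <= 2 * cosh x.
Proof. by rewrite /cosh; have := expR_gt0 (- x); lra. Qed.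

Lemma coshD_sinh x y : cosh (x + y) = cosh x * cosh y + sinh x * sinh y.
Proof. by rewrite /cosh /sinh opprD !expRD; lra. Qed.

Lemma coshB_sinh x y : cosh (x - y) = cosh x * cosh y - sinh x * sinh y.
Proof. by rewrite /cosh /sinh opprB !expRD; lra. Qed.

Lemma cosh_norm x : cosh `|x| = cosh x.
Proof.
have [x0|x0] := leP 0 x; first by rewrite ger0_norm.
by rewrite ltr0_norm// /cosh opprK addrC.
Qed.

Lemma MVT_le (f df : R -> R) x y : x <= y ->
  (forall z, is_derive z (1 : R) f (df z)) ->
  (forall z, x <= z <= y -> 0 <= df z) -> f x <= f y.
Proof.
move=> xy dfE df0; rewrite -subr_ge0.
have cf : continuous f.
  by move=> z; apply: differentiable_continuous; apply/derivable1_diffP; case: (dfE z).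
have [] := @MVT_segment _ f _ x y xy (fun z _ => dfE z).
  exact: continuous_subspaceT.
by move=> c; rewrite in_itv/= => xcy ->; rewrite mulr_ge0 ?df0// subr_ge0.
Qed.

Lemma le_cosh x y : 0 <= x -> x <= y -> cosh x <= cosh y.
Proof.
move=> x0 xy; apply: (@MVT_le cosh sinh) => // [z|z /andP[xz _]].
  exact: is_derive_cosh.
by rewrite sinh_ge0// (le_trans x0).
Qed.

Lemma le_sinh x : 0 <= x -> x <= sinh x.
Proof.
move=> x0; have := @MVT_le (fun z => sinh z - z) (fun z => cosh z - 1) 0 x x0.
rewrite sinh0 subrr subr_ge0; apply.
  by move=> z; have := is_derive_sinh z => ?; apply: is_derive_eq.
by move=> z /andP[z0 _]; rewrite subr_ge0 -cosh0 le_cosh.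
Qed.

Lemma sinh_le_mul_cosh x : 0 <= x -> sinh x <= x * cosh x.
Proof.
move=> x0; have := @MVT_le (fun z => cosh x * z - sinh z) (fun z => cosh x - cosh z) 0 x x0.
rewrite sinh0 mulr0 subrr subr_ge0 [x * _]mulrC; apply.
  move=> z; have := is_derive_sinh z => ?.
  apply: is_derive_eq; rewrite /GRing.scale/= ?mulr0 ?oppr0; lra.
by move=> z /andP[z0 zx]; rewrite subr_ge0 le_cosh.
Qed.

(** [sinh x / x] increases on the half-line; this is the convexity of
    [u |-> cosh (sqrt u)]. *)
Lemma sinh_ratio_le x y : 0 <= x -> x <= y -> y * sinh x <= x * sinh y.
Proof.
move=> x0 xy.
have := @MVT_le (fun z => x * sinh z - sinh x * z) (fun z => x * cosh z - sinh x) x y xy.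
rewrite [X in X <= _](_ : _ = 0); last by ring.
rewrite subr_ge0 [y * _]mulrC; apply.
  move=> z; have := is_derive_sinh z => ?.
  apply: is_derive_eq; rewrite /GRing.scale/= ?mulr0 ?oppr0; lra.
move=> z /andP[xz _]; rewrite subr_ge0 (le_trans (sinh_le_mul_cosh x x0))//.
by rewrite ler_wpM2l// le_cosh.
Qed.

(** By [sinh_ratio_le], [cosh (sqrt u)] is convex in [u], hence lies above its
    tangent at [u = r ^ 2]; multiplying by [2 r] keeps the case [r = 0]. *)
Lemma cosh_sqrt_tangent r x : 0 <= r -> 0 <= x ->
  sinh r * (x ^+ 2 - r ^+ 2) <= 2 * r * (cosh x - cosh r).
Proof.
move=> r0 x0.
pose f z := 2 * r * cosh z - sinh r * z ^+ 2.
pose df z := 2 * (r * sinh z - z * sinh r).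
have fD z : is_derive z (1 : R) f (df z).
  have := is_derive_cosh z => ?; rewrite /f /df.
  apply: is_derive_eq; rewrite /GRing.scale/= ?mulr0 ?oppr0; lra.
suff : f r <= f x by rewrite /f; lra.
have [rx|/ltW xr] := leP r x.
- apply: (MVT_le f df r x rx fD) => z /andP[rz _].
  by rewrite /df mulr_ge0// subr_ge0; exact: sinh_ratio_le.
- rewrite -lerN2; apply: (MVT_le (fun z => - f z) (fun z => - df z) x r xr) => z.
  move=> /andP[xz zr].
  rewrite /df /= -mulrN mulr_ge0// opprB subr_ge0 sinh_ratio_le//.
  exact: le_trans xz.
Qed.

(** Because [cosh (sqrt u)] is convex in [u], its value at
    [u = al^2 + 2 c + be^2] lies below the chord over
    [(al - be)^2, (al + be)^2]. In a Hilbert space, with [c] the inner product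
    of two vectors of norms [al] and [be], this bounds [cosh] of the norm of
    their sum by an expression that is affine in [c]. *)
Lemma cosh_sqrt_chord al be c : 0 <= al -> 0 <= be -> `|c| <= al * be ->
  al * be * cosh (Num.sqrt (al ^+ 2 + 2 * c + be ^+ 2)) <=
  al * be * (cosh al * cosh be) + c * (sinh al * sinh be).
Proof.
move=> al0 be0; rewrite ler_norml => /andP[c1 c2].
set u := al ^+ 2 + 2 * c + be ^+ 2.
have u0 : 0 <= u.
  by have := sqr_ge0 (al - be); rewrite /u; nra.
set r := Num.sqrt u; have r0 : 0 <= r by rewrite sqrtr_ge0.
have ru : r ^+ 2 = u by rewrite sqr_sqrtr.
have Hp : sinh r * ((al + be) ^+ 2 - r ^+ 2) <= 2 * r * (cosh (al + be) - cosh r).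
  by apply: cosh_sqrt_tangent => //; lra.
have Hm : sinh r * ((al - be) ^+ 2 - r ^+ 2) <= 2 * r * (cosh (al - be) - cosh r).
  have := cosh_sqrt_tangent r `|al - be| r0 (normr_ge0 _).
  by rewrite cosh_norm real_normK ?num_real.
move: Hp Hm; rewrite ru /u coshD_sinh coshB_sinh.
have [rE|rN] := eqVneq r 0.
  (* here [al = be] and [c = - al * be] *)
  have : u = 0 by rewrite -ru rE expr0n.
  rewrite /u => uE _ _; rewrite rE cosh0.
  have ab : al = be by have := sqr_ge0 (al - be); nra.
  have cE : c = - (al * be) by nra.
  rewrite cE ab; have : cosh be ^+ 2 - sinh be ^+ 2 = 1.
    by have := coshB_sinh be be; rewrite subrr cosh0; lra.
  by nra.
have {}r0 : 0 < r by rewrite lt0r rN.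
set Cr := cosh r; set A := cosh al * cosh be; set B := sinh al * sinh be.
move=> Hp Hm; rewrite -(ler_pM2l r0).
by nra.
Qed.

(** The chord bound in the form used along a random walk. The term in [c] stays
    linear, because centring will cancel it; the excess of [sinh be] over [be]
    pays for replacing [cosh be] by [expR be - be]. *)
Lemma cosh_sqrt_step al be c : 0 <= al -> 0 <= be -> `|c| <= al * be ->
  cosh (Num.sqrt (al ^+ 2 + 2 * c + be ^+ 2)) <=
  cosh al * (expR be - be) + sinh al / al * c.
Proof.
move=> al0 be0 cab.
have [abE|abN] := eqVneq (al * be) 0.
  have c0 : c = 0 by apply/eqP; rewrite -normr_le0 -abE.
  have ebe : expR be - be >= cosh be.
    have := sinh_le_mul_cosh be be0; have := expR_taylor1_ge0 (- be).
    by have := le_sinh be be0; rewrite /sinh /cosh; lra.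
  have /orP[/eqP->|/eqP->] : (al == 0) || (be == 0) by rewrite -mulf_eq0 abE.
    rewrite c0 invr0 !mulr0 expr0n !add0r addr0 cosh0 mul1r.
    by rewrite sqrtr_sqr ger0_norm.
  rewrite c0 !mulr0 !addr0 expr0n addr0 expR0 subr0 mulr1.
  by rewrite sqrtr_sqr ger0_norm.
have ab0 : 0 < al * be by rewrite lt0r abN mulr_ge0.
have al1 : 0 < al by rewrite lt0r al0 andbT; apply: contra_neq abN => ->; rewrite mul0r.
have be1 : 0 < be by rewrite lt0r be0 andbT; apply: contra_neq abN => ->; rewrite mulr0.
rewrite -(ler_pM2l ab0); apply: le_trans (cosh_sqrt_chord _ _ _ al0 be0 cab) _.
have -> : al * be * (cosh al * (expR be - be) + sinh al / al * c) =
  al * be * cosh al * (expR be - be) + be * c * sinh al.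
  by field; exact: lt0r_neq0.
have eE : expR be = cosh be + sinh be by rewrite /cosh /sinh; lra.
rewrite eE.
have sb := le_sinh be be0.
have sa := sinh_ge0 _ al0.
have h1 : c * sinh al <= al * be * cosh al.
  apply: (le_trans (ler_wpM2r sa (le_trans (ler_norm c) cab))).
  by rewrite ler_wpM2l ?sinh_le_cosh// ltW.
have : 0 <= (sinh be - be) * (al * be * cosh al - c * sinh al).
  by rewrite mulr_ge0 ?subr_ge0.
by nra.
Qed.

(** Companion to [expR_ge1Dx], from which it follows at [- x / (1 + x)]. *)
Lemma expR_le1D x : - 2^-1 <= x -> expR (x - 2 * x ^+ 2) <= 1 + x.
Proof.
move=> x2; have x1 : 0 < 1 + x by lra.
have H : 1 - x / (1 + x) <= expR (- (x / (1 + x))) := expR_ge1Dx _.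
have E : 1 - x / (1 + x) = (1 + x)^-1 by field; rewrite lt0r_neq0.
rewrite E in H.
have {}H : expR (x / (1 + x)) <= 1 + x.
  by rewrite -[leRHS]invrK -[leLHS]invrK lef_pV2 ?posrE ?invr_gt0 ?expR_gt0// -expRN.
apply: le_trans H; rewrite ler_expR ler_pdivlMr//.
have := mulr_ge0 (sqr_ge0 x) (ler_wpDr (lexx 0) (ltW x1)).
by have := mulr_ge0 (sqr_ge0 x) (_ : 0 <= 1 + 2 * x); move=> /(_ ltac:(lra)); lra.
Qed.

End exponential_inequalities.

(** * Independence *)

Section independence.
Context {d} {T : measurableType d} {R : realType} {P : probability T R}.
Variable Xs : nat -> {RV P >-> R}.

Definition sample (n : nat) (w : T) : n.-tuple R := [tuple Xs i w | i < n].

Lemma measurable_sample n : measurable_fun setT (sample n).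
Proof.
apply/measurable_fun_tnthP => i.
rewrite (_ : _ \o _ = Xs i)//; apply/funext => w /=.
by rewrite tnth_mktuple.
Qed.

HB.instance Definition _ n :=
  isMeasurableFun.Build _ _ _ _ (sample n) (measurable_sample n).

Definition cylinder n (B : nat -> set R) : set (n.-tuple R) :=
  [set t | forall i : 'I_n, B i (tnth t i)].

Lemma cylinderE n B : cylinder n B =
  \bigcap_(i in [set: 'I_n]) ((@tnth n R ^~ i) @^-1` B i).
Proof. by apply/seteqP; split => [t tB i _|t tB i]; exact: tB. Qed.

(** A family stable under intersection that generates the measurable sets of
    tuples, and on which independence can be read off. *)
Definition cylinders n : set (set (n.-tuple R)) :=
  [set A | exists2 B, (forall i, measurable (B i)) & A = cylinder n B].

Lemma measurable_cylinder n B : (forall i, measurable (B i)) ->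
  measurable (cylinder n B).
Proof.
move=> mB; rewrite cylinderE; apply: fin_bigcap_measurable => // i _.
rewrite -[X in measurable X]setTI; exact: measurable_tnth.
Qed.

Lemma cylinders_generate n : measurable = <<s cylinders n >>.
Proof.
apply/seteqP; split.
- apply: smallest_sub => //.
  move=> A; rewrite -bigcup_seq => -[i _ [B mB]]; rewrite setTI => <-.
  apply: sub_sigma_algebra.
  exists (fun j => if j == i :> nat then B else setT).
    by move=> j; case: ifP.
  apply/seteqP; split => [t tB j|t tB].
    by case: eqP => // /ord_inj ->.
  by have := tB i; rewrite eqxx.
- apply: smallest_sub; first exact: sigma_algebra_measurable.
  by move=> _ [B mB ->]; exact: measurable_cylinder.
Qed.

Lemma cylinders_setI n : setI_closed (cylinders n).
Proof.
move=> _ _ [A mA ->] [B mB ->].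
exists (fun i => A i `&` B i); first by move=> i; exact: measurableI.
apply/seteqP; split => [t [tA tB] i|t tAB]; first by split.
by split => i; have [] := tAB i.
Qed.

Hypothesis indep : mutually_independent Xs.

Lemma preimage_sample_cylinder n B : sample n @^-1` cylinder n B =
  \big[setI/setT]_(i <- iota 0 n) (Xs i @^-1` B i).
Proof.
have -> : iota 0 n = index_iota 0 n by rewrite /index_iota subn0.
rewrite big_mkord -(bigcap_mkord n (fun i => Xs i @^-1` B i)).
apply/seteqP; split => [w wB i ni|w wB i].
  by have := wB (Ordinal ni); rewrite tnth_mktuple.
by rewrite tnth_mktuple; exact: (wB i (ltn_ord i)).
Qed.

Lemma probability_sample_cylinder n A : (forall i, measurable (A i)) ->
  P (sample n @^-1` cylinder n A) =
  (\prod_(i <- iota 0 n) P (Xs i @^-1` A i))%E.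
Proof.
by move=> mA; rewrite preimage_sample_cylinder indep ?iota_uniq.
Qed.

(** Both sides are finite measures in [A], and they agree on cylinders by the
    product rule. *)
Lemma sample_indep n (A : set (n.-tuple R)) (B : set R) :
  measurable A -> measurable B ->
  P (sample n @^-1` A `&` Xs n @^-1` B) =
  (P (sample n @^-1` A) * P (Xs n @^-1` B))%E.
Proof.
move=> mA mB.
have mXB : measurable (Xs n @^-1` B) by exact: measurable_funPTI.
have PBfin : P (Xs n @^-1` B) \is a fin_num by exact: fin_num_measure.
have PB0 : 0 <= fine (P (Xs n @^-1` B)) by exact: fine_ge0.
pose m0 : {measure set _ -> \bar R} := pushforward (mrestr P mXB) (sample n).
pose m1 := m0 (measurable_sample n).
pose m2 : {measure set _ -> \bar R} :=
  mscale (NngNum PB0) (distribution P (sample n)).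
suff : m1 A = m2 A.
  rewrite /m1 /m0 /m2 /= /mscale/= /mrestr /pushforward /distribution /pushforward/=.
  by move=> ->; rewrite fineK// muleC.
apply: (measure_unique (cylinders n) (fun=> setT)) => //.
- exact: cylinders_generate.
- exact: cylinders_setI.
- by move=> _; exists (fun=> setT) => //; apply/seteqP; split.
- exact: bigcup_const.
- move=> _ [C mC ->].
  rewrite /m1 /m0 /m2 /= /mscale/= /mrestr /pushforward /distribution /pushforward/=.
  rewrite fineK// probability_sample_cylinder//.
  have := probability_sample_cylinder n.+1 (fun i => if (i < n)%N then C i else B).
  rewrite !preimage_sample_cylinder -addn1 iotaD add0n !big_cat /= !big_seq1 ltnn.
  have E i : i \in iota 0 n -> (if (i < n)%N then C i else B) = C i.
    by rewrite mem_iota add0n => /andP[_ ->].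
  rewrite !(eq_big_seq _ (fun i si => congr1 (fun A => Xs i @^-1` A) (E i si))).
  rewrite !(eq_big_seq _ (fun i si => congr1 (fun A => P (Xs i @^-1` A)) (E i si))).
  by move=> ->; [rewrite muleC|move=> i; case: ifP].
- move=> _; rewrite /m1 /m0 /= /pushforward /mrestr; apply: (le_lt_trans (probability_le1 _ _)) => //.
    by apply: measurableI => //; rewrite preimage_setT.
  exact: ltry.
Qed.

(** Freezing lemma: conditionally on the first [n] variables, the next one
    keeps its law, so it can be integrated out separately. *)
Lemma freezing n (nu : probability R R)
    (f : n.-tuple R * R -> \bar R) :
  (forall A, measurable A -> P (Xs n @^-1` A) = nu A) ->
  measurable_fun setT f -> (forall z, 0 <= f z)%E ->
  (\int[P]_w f (sample n w, Xs n w) =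
   \int[P]_w \int[nu]_x f (sample n w, x))%E.
Proof.
move=> nuE mf f0.
pose VX w := (sample n w, Xs n w).
have mVX : measurable_fun setT VX by exact: measurable_fun_pair.
pose m0 : {measure set (n.-tuple R * R) -> \bar R} := pushforward P VX.
pose m := m0 mVX.
have mE X : measurable X -> (distribution P (sample n) \x nu)%E X = m X.
  apply: product_measure_unique => A B mA mB.
  rewrite /m /m0 /= /pushforward (_ : _ @^-1` _ = sample n @^-1` A `&` Xs n @^-1` B)//.
  by rewrite sample_indep// nuE.
have -> : (\int[P]_w f (sample n w, Xs n w) = \int[m]_z f z)%E.
  by rewrite /m /m0 ge0_integral_pushforward.
rewrite (eq_measure_integral (distribution P (sample n) \x nu)%E); last first.
  by move=> A mA _; rewrite -mE.
rewrite fubini_tonelli1//.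
rewrite /fubini_F ge0_integral_distribution//.
- exact: measurable_fun_fubini_tonelli_F.
- by move=> y; exact: integral_ge0.
Qed.

End independence.
Arguments sample : simpl never.

(** * Sums of independent variables *)

Lemma measurable_cosh {R : realType} : measurable_fun setT (@cosh R).
Proof.
apply: measurable_funM => //; apply: measurable_funD => //.
by apply: measurableT_comp => //; exact: measurable_funN.
Qed.

Lemma measurable_sqrtr {R : realType} : measurable_fun setT (@Num.sqrt R).
Proof. by apply: continuous_measurable_fun; exact: sqrt_continuous. Qed.

Lemma measurableT_comp2 {d} {T : measurableType d} {R : realType}
    (k : R -> R -> R) (f g : T -> R) :
  measurable_fun setT (fun z : R * R => k z.1 z.2) ->
  measurable_fun setT f -> measurable_fun setT g ->
  measurable_fun setT (fun w => k (f w) (g w)).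
Proof. by move=> mk mf mg; exact: (measurableT_comp mk (measurable_fun_pair mf mg)). Qed.

Section sums_of_iid.
Context {d} {T : measurableType d} {R : realType} {P : probability T R}.
Variables (Xs : nat -> {RV P >-> R}) (nu : probability R R).
Hypothesis indep : mutually_independent Xs.
Hypothesis law : forall i A, measurable A -> P (Xs i @^-1` A) = nu A.

Local Notation sample := (sample Xs).

Lemma sampleE n w : sample n w = [seq Xs i w | i <- iota 0 n] :> seq R.
Proof. by rewrite -val_enum_ord -map_comp. Qed.

Lemma sampleSr n w : sample n.+1 w = rcons (sample n w) (Xs n w) :> seq R.
Proof. by rewrite !sampleE -addn1 iotaD map_cat cats1. Qed.

Lemma measurable_sum_tuple n (g : R -> R) : measurable_fun setT g ->
  measurable_fun setT (fun t : n.-tuple R => \sum_(x <- t) g x).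
Proof.
move=> mg; under eq_fun do rewrite big_tuple.
apply: measurable_sum => i; apply: measurableT_comp => //.
exact: measurable_tnth.
Qed.

Lemma mgf_sum n (g : R -> R) (M : R) : measurable_fun setT g ->
  (\int[nu]_x (expR (g x))%:E = M%:E)%E ->
  (\int[P]_w (expR (\sum_(x <- sample n w) g x))%:E = (M ^+ n)%:E)%E.
Proof.
move=> mg gM; elim: n => [|n IHn].
  under eq_integral do rewrite sampleE/= big_nil expR0.
  by rewrite integral_cst//= probability_setT mule1 expr0.
have mS m := @measurable_sum_tuple m g mg.
pose f (z : n.-tuple R * R) : \bar R :=
  ((expR (g z.2))%:E * (expR (\sum_(x <- z.1) g x))%:E)%E.
transitivity (\int[P]_w f (sample n w, Xs n w))%E.
  apply: eq_integral => w _.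
  by rewrite /f /= -EFinM -expRD sampleSr big_rcons/= addrC.
rewrite (freezing _ indep n nu f (law n)) /f /=.
- have mE : measurable_fun setT (fun w => (expR (\sum_(x <- sample n w) g x))%:E).
    apply/measurable_EFinP; apply: measurableT_comp => //.
    apply: (measurableT_comp (mS n)); exact: measurable_sample.
  under eq_integral => w _.
    rewrite ge0_integralZr//=; last first.
      by apply/measurable_EFinP; apply: measurableT_comp.
    rewrite gM; over.
  have M0 : (0 <= M%:E)%E.
    by rewrite -gM integral_ge0// => x _; rewrite lee_fin expR_ge0.
  by rewrite ge0_integralZl//= IHn -EFinM exprS.
- apply: emeasurable_funM; apply/measurable_EFinP; apply: measurableT_comp => //.
    exact: (measurableT_comp mg).
  exact: (measurableT_comp (mS n)).
- by move=> z; rewrite mule_ge0.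
Qed.

(** [k] plays the role of an inner product [k x y = <phi x, phi y>], in which
    case [gram k s] is the squared norm of the sum of the [phi x]. *)
Definition gram (k : R -> R -> R) (s : seq R) : R :=
  \sum_(x <- s) \sum_(y <- s) k x y.

Lemma gram_rcons k s u : (forall x y, k x y = k y x) ->
  gram k (rcons s u) = gram k s + 2 * \sum_(x <- s) k x u + k u u.
Proof.
move=> ksym; rewrite /gram big_rcons/=.
under eq_bigr do rewrite big_rcons/=.
rewrite big_split/= big_rcons/=.
have -> : \sum_(y <- s) k u y = \sum_(x <- s) k x u.
  by apply: eq_bigr => x _; exact: ksym.
ring.
Qed.

Lemma measurable_gram n (k : R -> R -> R) :
  measurable_fun setT (fun z : R * R => k z.1 z.2) ->
  measurable_fun setT (fun t : n.-tuple R => gram k t).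
Proof.
move=> mk; rewrite /gram.
under eq_fun do rewrite big_tuple.
apply: measurable_sum => i.
under eq_fun do rewrite big_tuple.
apply: measurable_sum => j.
by apply: measurableT_comp2 => //; exact: measurable_tnth.
Qed.

Section pinelis.
Variables (k : R -> R -> R) (lam del M : R).
Hypotheses (mk : measurable_fun setT (fun z : R * R => k z.1 z.2))
  (ksym : forall x y, k x y = k y x)
  (gram_ge0 : forall s, 0 <= gram k s)
  (cauchy_schwarz : forall s u,
    (\sum_(x <- s) k x u) ^+ 2 <= gram k s * k u u)
  (lam0 : 0 <= lam) (del0 : 0 <= del)
  (int_exp : nu.-integrable setT (fun u => (expR (lam * Num.sqrt (k u u)))%:E))
  (int_k : forall s, nu.-integrable setT (fun u => (\sum_(x <- s) k x u)%:E))
  (drift : forall s,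
    `|\int[nu]_u (\sum_(x <- s) k x u)| <= del * Num.sqrt (gram k s))
  (mean_exp : \int[nu]_u
    (expR (lam * Num.sqrt (k u u)) - lam * Num.sqrt (k u u)) <= M).

Let be u := lam * Num.sqrt (k u u).

Let mkd : measurable_fun setT (fun u => k u u).
Proof. exact: measurableT_comp2. Qed.

Let be0 u : 0 <= be u. Proof. by rewrite mulr_ge0// sqrtr_ge0. Qed.

Let mbe : measurable_fun setT be.
Proof.
by apply: measurable_funM => //; apply: measurableT_comp mkd; exact: measurable_sqrtr.
Qed.

Let int_be : nu.-integrable setT (EFin \o be).
Proof.
apply: le_integrable int_exp => //; first exact/measurable_EFinP.
move=> u _ /=; rewrite lee_fin !ger0_norm ?expR_ge0//.
by have := expR_ge1Dx (be u); rewrite /be; lra.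
Qed.

(** Given the sum so far, the new term enters the exponent through its inner
    product with that sum, whose mean is controlled by [drift], and through its
    own norm, controlled by [mean_exp]. *)
Lemma pinelis_step (s : seq R) :
  (\int[nu]_u (cosh (lam * Num.sqrt (gram k (rcons s u))))%:E <=
   (cosh (lam * Num.sqrt (gram k s)) * (M + lam * del))%:E)%E.
Proof.
pose al := lam * Num.sqrt (gram k s); pose c u := \sum_(x <- s) k x u.
have al0 : 0 <= al by rewrite mulr_ge0// sqrtr_ge0.
have kuu u : 0 <= k u u by have := gram_ge0 [:: u]; rewrite /gram !big_seq1.
have cle u : `|lam ^+ 2 * c u| <= al * be u.
  rewrite normrM ger0_norm ?sqr_ge0// /al /be mulrACA -expr2.
  rewrite ler_wpM2l ?sqr_ge0// -sqrtrM// -sqrtr_sqr ler_wsqrtr//.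
  exact: cauchy_schwarz.
have le_cosh u : cosh (lam * Num.sqrt (gram k (rcons s u))) <=
    cosh al * (expR (be u) - be u) + sinh al / al * lam ^+ 2 * c u.
  have -> : lam * Num.sqrt (gram k (rcons s u)) =
      Num.sqrt (al ^+ 2 + 2 * (lam ^+ 2 * c u) + be u ^+ 2).
    rewrite -[LHS]ger0_norm ?mulr_ge0 ?sqrtr_ge0// -sqrtr_sqr.
    congr Num.sqrt; rewrite /al /be !exprMn !sqr_sqrtr ?gram_ge0 ?kuu//.
    by rewrite gram_rcons// /c; ring.
  rewrite -(mulrA _ (lam ^+ 2)).
  exact: cosh_sqrt_step.
have int_eb : nu.-integrable setT (fun u => (expR (be u) - be u)%:E).
  exact: (integrableB measurableT int_exp int_be).
have int1 : nu.-integrable setT (fun u => (cosh al * (expR (be u) - be u))%:E).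
  exact: (integrableZl measurableT (cosh al) int_eb).
have int2 : nu.-integrable setT (fun u => (sinh al / al * lam ^+ 2 * c u)%:E).
  exact: (integrableZl measurableT (sinh al / al * lam ^+ 2) (int_k s)).
apply: (@le_trans _ _ (\int[nu]_u (cosh al * (expR (be u) - be u) +
    sinh al / al * lam ^+ 2 * c u)%:E)%E).
  apply: ge0_le_integral => //.
  - by move=> u _; rewrite lee_fin ltW// cosh_gt0.
  - apply/measurable_EFinP; apply: (measurableT_comp measurable_cosh).
    apply: measurable_funM => //.
    apply: (measurableT_comp (@measurable_sqrtr R)).
    under eq_fun do rewrite gram_rcons//.
    apply: measurable_funD => //; apply: measurable_funD => //.
    apply: measurable_funM => //.
    by apply/measurable_EFinP; case/integrableP : (int_k s).
  - by apply/measurable_EFinP; apply: measurable_funD;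
      apply/measurable_EFinP; [case/integrableP : int1|case/integrableP : int2].
  - by move=> u _; rewrite lee_fin.
have int12 : nu.-integrable setT (fun u => (cosh al * (expR (be u) - be u) +
    sinh al / al * lam ^+ 2 * c u)%:E).
  exact: (integrableD measurableT int1 int2).
rewrite -[leLHS]fineK ?integrable_fin_num// lee_fin.
rewrite -/(Rintegral _ _ _) RintegralD// RintegralZl// RintegralZl//; last exact: int_k.
rewrite mulrDr lerD//; first by rewrite ler_pM2l// cosh_gt0.
have [alE|alN] := eqVneq al 0.
  by rewrite alE invr0 mulr0 !mul0r !mulr_ge0// ltW// cosh_gt0.
have al1 : 0 < al by rewrite lt0r alN.
apply: (@le_trans _ _ (sinh al / al * lam ^+ 2 * (del * Num.sqrt (gram k s)))).
  rewrite ler_wpM2l//.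
    by rewrite mulr_ge0 ?sqr_ge0// divr_ge0// sinh_ge0.
  exact: le_trans (ler_norm _) (drift s).
have -> : sinh al / al * lam ^+ 2 * (del * Num.sqrt (gram k s)) =
    sinh al * (lam * del) * (lam * Num.sqrt (gram k s) / al) by field.
rewrite -/al divff// mulr1 ler_wpM2r ?sinh_le_cosh// mulr_ge0//.
Qed.

(** Pinelis's inequality for the norm of a sum of independent vectors of a
    Hilbert space, here known only through their inner products [k]; [del] bounds
    the norm of their mean. *)
Theorem pinelis n :
  (\int[P]_w (cosh (lam * Num.sqrt (gram k (sample n w))))%:E <=
   ((M + lam * del) ^+ n)%:E)%E.
Proof.
have M0 : 0 <= M + lam * del.
  rewrite addr_ge0 ?mulr_ge0//; apply: le_trans mean_exp.
  apply: Rintegral_ge0 => u _.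
  by have := expR_ge1Dx (be u); rewrite /be; lra.
have mQ m : measurable_fun setT
    (fun t : m.-tuple R => cosh (lam * Num.sqrt (gram k t))).
  apply: (measurableT_comp measurable_cosh); apply: measurable_funM => //.
  apply: (measurableT_comp (@measurable_sqrtr R)); exact: measurable_gram.
elim: n => [|n IHn].
  under eq_integral do rewrite sampleE/= /gram big_nil sqrtr0 mulr0 cosh0.
  by rewrite integral_cst//= probability_setT mule1 expr0.
pose f (z : n.-tuple R * R) : \bar R :=
  (cosh (lam * Num.sqrt (gram k (rcons z.1 z.2))))%:E.
have -> : (\int[P]_w (cosh (lam * Num.sqrt (gram k (sample n.+1 w))))%:E =
    \int[P]_w f (sample n w, Xs n w))%E.
  by apply: eq_integral => w _; rewrite sampleSr.
have mf : measurable_fun setT f.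
  apply/measurable_EFinP; apply: (measurableT_comp measurable_cosh).
  apply: measurable_funM => //; apply: (measurableT_comp (@measurable_sqrtr R)).
  under eq_fun do rewrite gram_rcons//.
  apply: measurable_funD.
    apply: measurable_funD; first exact: (measurableT_comp (measurable_gram n k mk)).
    apply: measurable_funM => //; under eq_fun do rewrite big_tuple.
    apply: measurable_sum => i.
    apply: measurableT_comp2 => //.
    exact: (measurableT_comp (measurable_tnth i)).
  exact: (measurableT_comp mkd).
have f0 z : (0 <= f z)%E by rewrite lee_fin ltW// cosh_gt0.
rewrite (freezing _ indep n nu f (law n))//.
have mS : measurable_fun setT
    (fun w => cosh (lam * Num.sqrt (gram k (sample n w)))).
  by apply: (measurableT_comp (mQ n)); exact: measurable_sample.
apply: (@le_trans _ _ (\int[P]_w (cosh (lam * Num.sqrt (gram k (sample n w))) *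
    (M + lam * del))%:E)%E).
  apply: ge0_le_integral => //.
  - by move=> w _; exact: integral_ge0.
  - apply: (measurableT_comp (measurable_fun_fubini_tonelli_F f mf f0)).
    exact: measurable_sample.
  - by apply/measurable_EFinP; exact: measurable_funM.
  - by move=> w _; exact: pinelis_step.
under eq_integral do rewrite EFinM.
rewrite ge0_integralZr//.
- by rewrite exprSr EFinM lee_wpmul2r.
- exact/measurable_EFinP.
- by move=> w _; rewrite lee_fin ltW// cosh_gt0.
Qed.

End pinelis.
End sums_of_iid.

(** * Moderate tails *)

Lemma integrable_bounded {d} {T : measurableType d} {R : realType}
    (mu : probability T R) (f : T -> R) (c : R) :
  measurable_fun setT f -> (forall x, `|f x| <= c) ->
  mu.-integrable setT (EFin \o f).
Proof.
move=> mf fc; apply: (@le_integrable _ _ _ _ _ _ _ (cst c%:E)) => //.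
- exact/measurable_EFinP.
- by move=> x _ /=; rewrite lee_fin (le_trans (fc x))// ler_norm.
- exact: finite_measure_integrable_cst.
Qed.

Lemma fine_le_real {d} {T : measurableType d} {R : realType}
    (mu : {measure set T -> \bar R}) (f : T -> R) (c : R) : 0 <= c ->
  (\int[mu]_x (f x)%:E <= c%:E)%E -> \int[mu]_x f x <= c.
Proof.
rewrite /Rintegral; case: (\int[mu]_x (f x)%:E)%E => //=.
Qed.

Section moderate_tails.
Context {R : realType} (nu : probability R R) (a : nat -> R).

(** [level] is the scale on which sums of [n] variables deviate, and [slope] is
    the exponent that detects a deviation of this size: their product is the
    speed [a n ^+ 2]. *)
Definition level n : R := Num.sqrt n%:R * a n.
Definition slope n : R := a n / Num.sqrt n%:R.
Definition tail (t : R) : R := fine (nu [set x | t <= `|x|]).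

Hypotheses (a_gt0 : forall n, (0 < n)%N -> 0 < a n)
  (a_oo : a n @[n --> \oo] --> +oo)
  (slope_ni : forall m n, (0 < m)%N -> (m <= n)%N -> slope n <= slope m)
  (slope0 : slope n @[n --> \oo] --> (0 : R))
  (light_tail : forall K, \forall n \near \oo,
     n%:R * tail (level n) <= expR (- (K * a n ^+ 2))).

Definition window th n (U : R) : set R :=
  [set x | U <= th * slope n * `|x| /\ `|x| <= level n].

Lemma measurable_tail_set (t : R) : measurable [set x : R | t <= `|x|].
Proof.
rewrite -[X in measurable X]setTI; apply: measurable_fun_le => //.
Qed.

Lemma measurable_window th n U : measurable (window th n U).
Proof.
apply: measurableI; rewrite -[X in measurable X]setTI;
  apply: measurable_fun_le => //; exact: measurable_funM.
Qed.

Lemma tail_ni s t : s <= t -> tail t <= tail s.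
Proof.
move=> st; rewrite fine_le ?fin_num_measure//; try exact: measurable_tail_set.
rewrite le_measure ?inE//; try exact: measurable_tail_set.
by move=> x /=; exact: le_trans.
Qed.

Lemma tail_ge0 t : 0 <= tail t.
Proof. exact: fine_ge0. Qed.

Lemma sqrtn_gt0 n : (0 < n)%N -> 0 < Num.sqrt n%:R :> R.
Proof. by move=> n0; rewrite sqrtr_gt0 ltr0n. Qed.

Lemma slope_gt0 n : (0 < n)%N -> 0 < slope n.
Proof. by move=> n0; rewrite divr_gt0 ?a_gt0 ?sqrtn_gt0. Qed.

Lemma level_gt0 n : (0 < n)%N -> 0 < level n.
Proof. by move=> n0; rewrite mulr_gt0 ?a_gt0 ?sqrtn_gt0. Qed.

Lemma slope_level n : (0 < n)%N -> slope n * level n = a n ^+ 2.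
Proof.
move=> n0; rewrite /slope /level; have /lt0r_neq0 := sqrtn_gt0 _ n0 => sn.
by field.
Qed.

Lemma slope_sqr n : (0 < n)%N -> n%:R * slope n ^+ 2 = a n ^+ 2.
Proof.
move=> n0; rewrite /slope expr_div_n sqr_sqrtr//.
by rewrite mulrCA divff ?mulr1// pnatr_eq0 -lt0n.
Qed.

(** As [slope] decreases, [level] grows from [m] to [m + 1] by a factor at most
    [(m + 1) / m]. *)
Lemma level_doubling m t : (0 < m)%N -> t <= level m.+1 -> t <= 2 * level m.
Proof.
move=> m0 /le_trans; apply.
rewrite /level; have := slope_ni _ _ m0 (leqnSn m); rewrite /slope.
have sm := sqrtn_gt0 _ m0; have sm1 := sqrtn_gt0 _ (ltn0Sn m).
rewrite ler_pdivrMr// mulrAC ler_pdivlMr// => h.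
have e1 : Num.sqrt m.+1%:R ^+ 2 = m.+1%:R :> R by rewrite sqr_sqrtr.
have e0 : Num.sqrt m%:R ^+ 2 = m%:R :> R by rewrite sqr_sqrtr.
have m1 : 1 <= m%:R :> R by rewrite ler1n.
have am := a_gt0 _ m0.
rewrite -(ler_pM2r sm) (_ : 2 * _ * _ = 2 * m%:R * a m); last by rewrite -[X in 2 * X * a m]e0; ring.
apply: (@le_trans _ _ (Num.sqrt m.+1%:R * (a m * Num.sqrt m.+1%:R))).
  by rewrite -mulrA ler_wpM2l// ltW.
have -> : Num.sqrt m.+1%:R * (a m * Num.sqrt m.+1%:R) = (m%:R + 1) * a m.
  by rewrite mulrCA -expr2 e1 -natr1 mulrC.
by rewrite ler_pM2r//; lra.
Qed.

(** The levels at most double from one index to the next, so that every [t]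
    between two of them is comparable to a level. *)
Lemma level_sandwich m0 n t : (0 < m0)%N -> (m0 <= n)%N ->
  level m0 <= t -> t <= level n ->
  exists m, [/\ (m0 <= m)%N, (m <= n)%N, level m <= t & t <= 2 * level m].
Proof.
move=> m00 m0n lt tl.
pose Q m := [&& (m0 <= m)%N, (m <= n)%N & level m <= t].
have exQ : exists m, Q m by exists m0; rewrite /Q leqnn m0n.
have ubQ m : Q m -> (m <= n)%N by case/and3P.
case: (ex_maxnP exQ ubQ) => m /and3P[mm mn lm] mmax.
exists m; split => //; have m_gt0 := leq_trans m00 mm.
move: mn; rewrite leq_eqVlt => /predU1P[mE|mn].
  by rewrite (le_trans tl)// -mE; have := level_gt0 _ m_gt0; lra.
apply: level_doubling => //; rewrite leNgt; apply/negP => lm1.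
have /mmax : Q m.+1 by rewrite /Q (leq_trans mm)//= mn ltW.
by rewrite ltnn.
Qed.

(** The largest level [level m] below [t] is exceeded with probability at most
    [expR (- K * a m ^+ 2) / m], for any prescribed [K]. Since [slope] decreases,
    [slope n * level m] is at most [a m ^+ 2], so a large [K] beats the
    exponential of [2 * th * slope n * t]; the passage from [1 / m] to [1 / n]
    costs [n / m], at most a multiple of [a n ^+ 2 * a m ^+ 2]. *)
Lemma tail_exponential th : 0 < th -> \forall n \near \oo, forall t,
  1 <= th * slope n * t -> t <= level n ->
  n%:R * tail t <= 4 * th ^+ 2 * a n ^+ 2 * expR (- (2 * (th * slope n * t))).
Proof.
move=> th0; pose K := 1 + 4 * th.
have [m1 _ tailK] := light_tail K.
pose m0 := maxn m1 1.
have m00 : (0 < m0)%N by rewrite leq_max orbT.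
have l0 := level_gt0 _ m00.
have tl0 : 0 < th * level m0 by exact: mulr_gt0.
near=> n => t ht tn.
have n0 : (m0 <= n)%N by near: n; exact: nbhs_infty_ge.
have n_gt0 := leq_trans m00 n0.
have sn := slope_gt0 _ n_gt0.
have small : th * slope n * level m0 <= 1.
  have : slope n <= (th * level m0)^-1.
    by near: n; apply: (cvgr_le 0 slope0); rewrite invr_gt0.
  by rewrite -[_^-1]mul1r ler_pdivlMr// => h; lra.
have lt : level m0 <= t.
  have ts0 : 0 < th * slope n by rewrite mulr_gt0.
  by rewrite -(ler_pM2l ts0); lra.
have [m [m0m mn lm tm]] := level_sandwich _ _ _ m00 n0 lt tn.
have m_gt0 := leq_trans m00 m0m.
have {}tailK : m%:R * tail (level m) <= expR (- (K * a m ^+ 2)).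
  by apply: tailK => /=; rewrite (leq_trans _ m0m)// leq_max leqnn.
have snm := slope_ni _ _ m_gt0 mn.
have sl := slope_level _ m_gt0; have lm0 := level_gt0 _ m_gt0.
have key1 : th * slope n * t <= 2 * th * a m ^+ 2.
  rewrite -sl; apply: (@le_trans _ _ (th * slope m * (2 * level m))); last by lra.
  have t0 : 0 <= t by rewrite (le_trans (ltW lm0)).
  by apply: ler_pM => //; [exact: mulr_ge0 (ltW th0) (ltW sn)|rewrite ler_pM2l].
have lmE : level m ^+ 2 = m%:R * a m ^+ 2 by rewrite /level exprMn sqr_sqrtr.
have key2 : n%:R <= 4 * th ^+ 2 * a n ^+ 2 * (m%:R * a m ^+ 2).
  have h1 : 1 <= (th * slope n * t) ^+ 2 by exact: exprn_ege1.
  have h2 : t ^+ 2 <= 4 * (m%:R * a m ^+ 2).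
    rewrite -lmE (_ : 4 * _ = (2 * level m) ^+ 2); last by ring.
    by rewrite lerXn2r// nnegrE; lra.
  have n0R : 0 <= n%:R :> R by [].
  apply: (@le_trans _ _ (n%:R * (th * slope n * t) ^+ 2)); first by rewrite ler_peMr.
  rewrite (_ : n%:R * _ = th ^+ 2 * (n%:R * slope n ^+ 2) * t ^+ 2); last by ring.
  rewrite slope_sqr// (_ : 4 * _ * _ * _ = th ^+ 2 * a n ^+ 2 * (4 * (m%:R * a m ^+ 2))); last by ring.
  by rewrite ler_wpM2l// mulr_ge0// sqr_ge0.
have ta : tail t <= tail (level m) by exact: tail_ni.
have C0 : 0 <= 4 * th ^+ 2 * a n ^+ 2 by do 2![apply: mulr_ge0 (sqr_ge0 _) => //].
apply: (@le_trans _ _ (4 * th ^+ 2 * a n ^+ 2 * (m%:R * a m ^+ 2) * tail (level m))).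
  by apply: ler_pM => //; exact: tail_ge0.
rewrite -mulrA ler_wpM2l//.
apply: (@le_trans _ _ (a m ^+ 2 * expR (- (K * a m ^+ 2)))).
  by rewrite mulrAC mulrC ler_wpM2l// sqr_ge0.
apply: (@le_trans _ _ (expR (a m ^+ 2) * expR (- (K * a m ^+ 2)))).
  rewrite ler_wpM2r ?expR_ge0//.
  by have := expR_ge1Dx (a m ^+ 2); lra.
by rewrite -expRD ler_expR /K; lra.
Unshelve. all: by end_near. Qed.

(** On the slice where [th * slope n * `|x|] lies between [T + k] and
    [T + k + 1], the integrand is at most [expR (T + k + 1)] while
    [tail_exponential] bounds the mass by a multiple of [expR (- 2 (T + k))], so
    that the slices sum like a geometric series. *)
Lemma tail_laplace th : 0 < th -> \forall n \near \oo, forall T, 1 <= T ->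
  (\int[nu]_(x in window th n T) (expR (th * slope n * `|x|))%:E <=
   (8 * expR 1 * th ^+ 2 * slope n ^+ 2 * expR (- T))%:E)%E.
Proof.
move=> th0; near=> n => U U1.
have n0 : (0 < n)%N by near: n; exact: nbhs_infty_gt.
have sn := slope_gt0 _ n0.
have ts : 0 < th * slope n by rewrite mulr_gt0.
have tailn : forall t, 1 <= th * slope n * t -> t <= level n ->
  n%:R * tail t <= 4 * th ^+ 2 * a n ^+ 2 * expR (- (2 * (th * slope n * t))).
  by near: n; exact: tail_exponential.
pose D := window th n U.
pose S k := window th n (U + k%:R).
have mS k : measurable (S k) by exact: measurable_window.
have mD : measurable D by exact: measurable_window.
have mI (k : nat) : measurable_fun D (fun x => (expR (U + k%:R + 1) * \1_(S k) x)%:E).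
  apply/measurable_EFinP; apply: measurable_funTS.
  by apply: measurable_funM => //; exact: measurable_indic.
pose N := (Num.truncn (th * slope n * level n)).+1.
(* [x] lies in the slice of index [k], and the other terms are nonnegative *)
have bnd x : D x -> expR (th * slope n * `|x|) <=
    \sum_(k < N) expR (U + k%:R + 1) * \1_(S k) x.
  move=> [Ux xl]; set y := th * slope n * `|x|.
  pose k := Num.truncn (y - U).
  have yU : 0 <= y - U by rewrite subr_ge0.
  have /andP[k1 k2] := truncn_itv yU.
  have kN : (k < N)%N.
    rewrite /N ltnS; apply: le_truncn.
    have : y <= th * slope n * level n by rewrite /y ler_pM2l.
    by lra.
  rewrite (bigD1 (Ordinal kN))//= ler_wpDr//.
    by apply: sumr_ge0 => i _; rewrite mulr_ge0 ?expR_ge0.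
  rewrite indicE mem_set ?mulr1; last by split => //; rewrite -/y; lra.
  by rewrite ler_expR; move: k2; rewrite -natr1; lra.
have nuS k : (nu (S k) <= (4 * th ^+ 2 * slope n ^+ 2 * expR (- (2 * (U + k%:R))))%:E)%E.
  have [Skl|Skl] := leP (U + k%:R) (th * slope n * level n); last first.
    have -> : S k = set0.
      apply/seteqP; split => // x [h1 h2].
      have : th * slope n * `|x| <= th * slope n * level n by rewrite ler_pM2l.
      by move=> h3; have := le_lt_trans h3 (lt_le_trans Skl h1); rewrite ltxx.
    rewrite measure0 lee_fin; apply: mulr_ge0 (expR_ge0 _).
    by do 2![apply: mulr_ge0 (sqr_ge0 _) => //].
  pose t := (U + k%:R) / (th * slope n).
  have tE : th * slope n * t = U + k%:R by rewrite /t mulrCA divff ?mulr1// gt_eqF.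
  have tl : t <= level n by rewrite /t ler_pdivrMr// mulrC.
  have kp : 0 <= k%:R :> R by [].
  have := tailn t; rewrite tE => /(_ _ tl).
  have -> : 1 <= U + k%:R by lra.
  move=> /(_ isT); rewrite -(slope_sqr _ n0).
  rewrite (_ : 4 * _ * _ * _ = n%:R * (4 * th ^+ 2 * slope n ^+ 2 * expR (- (2 * (U + k%:R))))); last by ring.
  rewrite ler_pM2l ?ltr0n// => tle.
  apply: (@le_trans _ _ (tail t)%:E); last by rewrite lee_fin.
  rewrite /tail fineK ?fin_num_measure//; last exact: measurable_tail_set.
  rewrite le_measure ?inE//; first exact: measurable_tail_set.
  by move=> x [h1 _] /=; rewrite /t ler_pdivrMr// mulrC.
apply: (@le_trans _ _ (\int[nu]_(x in D)
    \sum_(k < N) (expR (U + k%:R + 1) * \1_(S k) x)%:E)%E).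
  apply: ge0_le_integral => //.
  - apply/measurable_EFinP; apply: measurable_funTS; apply: measurableT_comp => //.
    exact: measurable_funM.
  - exact: emeasurable_sum.
  - by move=> x Dx; rewrite sumEFin lee_fin bnd.
rewrite ge0_integral_sum//.
apply: (@le_trans _ _ (\sum_(k < N) (expR (U + k%:R + 1) *
    (4 * th ^+ 2 * slope n ^+ 2 * expR (- (2 * (U + k%:R)))))%:E)%E).
  apply: lee_sum => k _; under eq_integral do rewrite EFinM.
  rewrite ge0_integralZl_EFin ?expR_ge0//; last first.
    by apply/measurable_EFinP; apply: measurable_funTS; exact: measurable_indic.
  rewrite integral_indic// EFinM lee_wpmul2l ?lee_fin ?expR_ge0//.
  by apply: le_trans (nuS k); rewrite le_measure ?inE//; exact: measurableI.
rewrite sumEFin lee_fin.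
have half : expR (- 1) <= 2^-1 :> R.
  rewrite expRN lef_pV2 ?posrE ?expR_gt0//.
  by have := expR_ge1Dx (1 : R); lra.
apply: (@le_trans _ _ (\sum_(k < N) 4 * expR 1 * th ^+ 2 * slope n ^+ 2 * expR (- U) * 2^-1 ^+ k)).
  apply: ler_sum => k _.
  rewrite (_ : expR _ * _ = 4 * th ^+ 2 * slope n ^+ 2 * (expR (U + k%:R + 1) * expR (- (2 * (U + k%:R))))); last by ring.
  rewrite (_ : _ * 2^-1 ^+ k = 4 * th ^+ 2 * slope n ^+ 2 * (expR 1 * expR (- U) * 2^-1 ^+ k)); last by ring.
  rewrite ler_wpM2l -?expRD//; first by do 2![apply: mulr_ge0 (sqr_ge0 _) => //].
  rewrite (_ : U + _ + 1 + _ = 1 + - U + k%:R * - 1); last by ring.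
  rewrite (expRD (1 - U)) ler_wpM2l ?expR_ge0// expRM_natl.
  by rewrite lerXn2r// nnegrE ?expR_ge0.
rewrite -mulr_sumr.
have geo : \sum_(k < N) 2^-1 ^+ k <= 2 :> R.
  have -> : \sum_(k < N) 2^-1 ^+ k = 2 * (1 - 2^-1 ^+ N) :> R.
    elim: (N) => [|m IHm]; first by rewrite big_ord0 expr0 subrr mulr0.
    by rewrite big_ord_recr/= IHm exprS; lra.
  have : 0 <= 2^-1 ^+ N :> R by rewrite exprn_ge0.
  by lra.
rewrite (_ : 8 * _ * _ * _ * _ = 4 * expR 1 * th ^+ 2 * slope n ^+ 2 * expR (- U) * 2); last by ring.
rewrite ler_wpM2l//; apply: mulr_ge0 (expR_ge0 _).
by do 2![apply: mulr_ge0 (sqr_ge0 _) => //]; rewrite mulr_ge0 ?expR_ge0.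
Unshelve. all: by end_near. Qed.

(** * Exponential moments of truncated variables *)

Hypothesis square_integrable : nu.-integrable setT (fun x : R => (x ^+ 2)%:E).

Definition weight (x : R) : R := 1 + `|x|.

Lemma weight_ge1 x : 1 <= weight x.
Proof. by rewrite /weight lerDl. Qed.

Lemma measurable_weight : measurable_fun setT weight.
Proof. exact: measurable_funD. Qed.

Lemma integrable_weight2 : nu.-integrable setT (fun x => (weight x ^+ 2)%:E).
Proof.
have i2 : nu.-integrable setT (fun x : R => (2 + 2 * x ^+ 2)%:E).
  apply: (@integrableD _ _ _ nu setT measurableT (fun=> 2%:E) (fun x : R => (2 * x ^+ 2)%:E)).
    exact: finite_measure_integrable_cst.
  exact: (integrableZl measurableT 2 square_integrable).
apply: le_integrable i2 => //.
- apply/measurable_EFinP; apply: measurable_funX; exact: measurable_weight.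
- move=> x _; have x2 := sqr_ge0 x; rewrite /= lee_fin ger0_norm ?sqr_ge0//.
  rewrite ger0_norm; last by lra.
  rewrite /weight -[x ^+ 2]real_normK ?num_real//.
  by have := sqr_ge0 (1 - `|x|); lra.
Qed.

Lemma integrable_weight : nu.-integrable setT (EFin \o weight).
Proof.
apply: le_integrable integrable_weight2 => //.
  by apply/measurable_EFinP; exact: measurable_weight.
move=> x _; rewrite /= lee_fin !ger0_norm ?sqr_ge0//; have := weight_ge1 x; last by lra.
by move=> w1; rewrite expr2 ler_peMr//; lra.
Qed.

Definition far C n (U : R) : set R :=
  [set x | U <= C * slope n * weight x /\ `|x| <= level n].

Lemma measurable_far C n U : measurable (far C n U).
Proof.
apply: measurableI; rewrite -[X in measurable X]setTI; apply: measurable_fun_le => //.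
by apply: measurable_funM => //; exact: measurable_weight.
Qed.

(** [tail_laplace] for an affine growth: the additive constant only changes
    [K]. *)
Lemma laplace_affine C : 0 < C -> exists K, \forall n \near \oo,
  forall U, 2 <= U ->
  (\int[nu]_(x in far C n U)
    (expR (C * slope n * weight x))%:E <= (K * slope n ^+ 2 * expR (- U))%:E)%E.
Proof.
move=> C0; exists (8 * expR 1 * C ^+ 2 * expR 2).
near=> n => U U2.
have n0 : (0 < n)%N by near: n; exact: nbhs_infty_gt.
have Cs1 : C * slope n <= 1.
  rewrite -ler_pdivlMl// mulr1; near: n; apply: (cvgr_le 0 slope0).
  by rewrite invr_gt0.
have Cs0 : 0 < C * slope n by rewrite mulr_gt0// slope_gt0.
have H : forall U : R, 1 <= U ->
  (\int[nu]_(x in window C n U) (expR (C * slope n * `|x|))%:E <=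
   (8 * expR 1 * C ^+ 2 * slope n ^+ 2 * expR (- U))%:E)%E.
  by near: n; exact: tail_laplace.
have U1 : 1 <= U - 1 by lra.
set D := far C n U.
have mw : measurable_fun setT (fun x => C * slope n * weight x).
  by apply: measurable_funM => //; exact: measurable_weight.
have mD : measurable D by exact: measurable_far.
have mE : measurable_fun setT (fun x : R => (expR (C * slope n * `|x|))%:E).
  apply/measurable_EFinP; apply: measurableT_comp => //; exact: measurable_funM.
have DW : D `<=` window C n (U - 1).
  by move=> x [h1 h2]; split => //; move: h1; rewrite /weight mulrDr mulr1; lra.
apply: (@le_trans _ _ (\int[nu]_(x in D) ((expR 1)%:E * (expR (C * slope n * `|x|))%:E))%E).
  apply: ge0_le_integral => //.
  - by apply/measurable_EFinP; apply: measurable_funTS; exact: measurableT_comp.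
  - by apply: measurable_funTS; exact: emeasurable_funM.
  - move=> x _; rewrite -EFinM lee_fin -expRD ler_expR /weight mulrDr mulr1.
    by lra.
rewrite ge0_integralZl_EFin ?expR_ge0//; last exact: measurable_funTS.
apply: (@le_trans _ _ ((expR 1)%:E *
   (8 * expR 1 * C ^+ 2 * slope n ^+ 2 * expR (- (U - 1)))%:E)%E).
  rewrite lee_wpmul2l ?lee_fin ?expR_ge0//; apply: le_trans (H _ U1).
  apply: ge0_subset_integral => //; first exact: measurable_window.
  exact: measurable_funTS.
rewrite -EFinM lee_fin opprB expRD.
rewrite (_ : 2 = 1 + 1)// expRD.
by rewrite le_eqVlt; apply/orP; left; apply/eqP; ring.
Unshelve. all: by end_near. Qed.

(** The common shape of the error estimates below: an exponential moment where
    the exponent is large and a second moment everywhere. *)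
Lemma far_weight_integral_le C n U K (phi : R -> R) (c1 c2 : R) :
  (\int[nu]_(x in far C n U) (expR (C * slope n * weight x))%:E <= K%:E)%E ->
  measurable_fun setT phi -> 0 <= c1 -> 0 <= c2 ->
  (forall x, 0 <= phi x <= c1 * (expR (C * slope n * weight x) * \1_(far C n U) x)
    + c2 * weight x ^+ 2) ->
  \int[nu]_x phi x <= c1 * K + c2 * \int[nu]_x (weight x ^+ 2).
Proof.
move=> HK mphi c10 c20 phile.
have mw := measurable_weight.
have mE : measurable_fun setT (fun x => expR (C * slope n * weight x)).
  by apply: measurableT_comp => //; exact: measurable_funM.
have mI : measurable_fun setT (\1_(far C n U) : R -> R).
  by apply: measurable_indic; exact: measurable_far.
have K0 : 0 <= K.
  by rewrite -lee_fin; apply: le_trans HK; apply: integral_ge0 => x _; rewrite lee_fin expR_ge0.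
have w20 : 0 <= \int[nu]_x (weight x ^+ 2) by apply: Rintegral_ge0 => x _; exact: sqr_ge0.
apply: fine_le_real; first by rewrite addr_ge0// mulr_ge0.
apply: (@le_trans _ _ (\int[nu]_x (c1%:E * (expR (C * slope n * weight x) *
    \1_(far C n U) x)%:E + c2%:E * (weight x ^+ 2)%:E))%E).
  apply: ge0_le_integral => //.
  - by move=> x _; rewrite lee_fin; case/andP: (phile x).
  - exact/measurable_EFinP.
  - by apply: emeasurable_funD; apply: emeasurable_funM => //; apply/measurable_EFinP;
      [exact: measurable_funM|exact: measurable_funX].
  - by move=> x _; rewrite -!EFinM -EFinD lee_fin; case/andP: (phile x).
rewrite ge0_integralD//; last 4 first.
- by move=> x _; rewrite -EFinM lee_fin mulr_ge0// mulr_ge0 ?expR_ge0.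
- by apply: emeasurable_funM => //; apply/measurable_EFinP; exact: measurable_funM.
- by move=> x _; rewrite -EFinM lee_fin mulr_ge0// sqr_ge0.
- by apply: emeasurable_funM => //; apply/measurable_EFinP; exact: measurable_funX.
rewrite EFinD leeD//.
  rewrite ge0_integralZl_EFin//; last first.
    by apply/measurable_EFinP; exact: measurable_funM.
  rewrite EFinM lee_wpmul2l ?lee_fin//; apply: le_trans HK.
  by rewrite [leRHS]integral_mkcond epatch_indic.
rewrite ge0_integralZl_EFin//; last 2 first.
- by move=> x _; rewrite lee_fin sqr_ge0.
- by apply/measurable_EFinP; exact: measurable_funX.
rewrite EFinM lee_wpmul2l ?lee_fin// /Rintegral fineK//.
exact: integrable_fin_num integrable_weight2.
Qed.

Section growth.
Variables (g : R -> R) (C : R).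
Hypotheses (mg : measurable_fun setT g) (C0 : 0 < C)
  (gC : forall x, `|g x| <= C * weight x).

Definition bulk n : set R := [set x | `|x| <= level n].

Definition truncate n (x : R) : R := g x * \1_(bulk n) x.

Lemma measurable_bulk n : measurable (bulk n).
Proof. by rewrite -[X in measurable X]setTI; exact: measurable_fun_le. Qed.

Lemma measurable_truncate n : measurable_fun setT (truncate n).
Proof.
apply: measurable_funM => //; apply: measurable_indic; exact: measurable_bulk.
Qed.

Lemma truncate_in n x : `|x| <= level n -> truncate n x = g x.
Proof. by move=> xn; rewrite /truncate indicE mem_set// mulr1. Qed.

Lemma truncate_out n x : level n < `|x| -> truncate n x = 0.
Proof.
by move=> xn; rewrite /truncate indicE memNset ?mulr0//= /bulk/=; apply/negP; rewrite -ltNge.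
Qed.

Lemma integrable_growth : nu.-integrable setT (EFin \o g).
Proof.
have iC : nu.-integrable setT (fun x => (C * weight x)%:E).
  exact: (integrableZl measurableT C integrable_weight).
apply: le_integrable iC => //; first exact/measurable_EFinP.
by move=> x _ /=; rewrite lee_fin (le_trans (gC x))// ler_norm.
Qed.

Lemma integrable_growth2 : nu.-integrable setT (fun x => (g x ^+ 2)%:E).
Proof.
have iC : nu.-integrable setT (fun x => (C ^+ 2 * weight x ^+ 2)%:E).
  exact: (integrableZl measurableT (C ^+ 2) integrable_weight2).
apply: le_integrable iC => //; first by apply/measurable_EFinP; exact: measurable_funX.
move=> x _; rewrite /= lee_fin ger0_norm ?sqr_ge0// ger0_norm; last first.
  by rewrite mulr_ge0 ?sqr_ge0.
rewrite -exprMn -[g x ^+ 2]real_normK ?num_real// lerXn2r// nnegrE//.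
by rewrite (le_trans _ (gC x)).
Qed.

Lemma integrable_expR_truncate n : (0 < n)%N ->
  nu.-integrable setT (fun x => (expR (slope n * truncate n x))%:E).
Proof.
move=> n0.
have mt := measurable_truncate n.
apply: (@integrable_bounded _ _ _ _ (fun x => expR (slope n * truncate n x))
  (expR (slope n * (C * (1 + level n))))).
  by apply: measurableT_comp => //; exact: measurable_funM.
move=> x; rewrite ger0_norm ?expR_ge0// ler_expR ler_pM2l ?slope_gt0//.
have [xl|xl] := leP `|x| (level n); last first.
  rewrite truncate_out// mulr_ge0 ?(ltW C0)// addr_ge0// ltW// level_gt0//.
rewrite truncate_in//; rewrite (le_trans (ler_norm _))// (le_trans (gC x))// ler_pM2l//.
by rewrite /weight lerD2l.
Qed.

(** Where [C * slope n * weight x] is at most [U], the second-order Taylor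
    quotient converges boundedly to [g x ^+ 2 / 2]. Elsewhere [laplace_affine]
    bounds the exponential part by [O(expR (- U))], and the second moment bounds
    the linear part by [O(1 / U)]. *)
Lemma truncated_mgf s : \int[nu]_x g x = 0 -> \int[nu]_x (g x ^+ 2) = s ->
  forall eta, 0 < eta -> \forall n \near \oo,
  `|(\int[nu]_x expR (slope n * truncate n x) - 1) / slope n ^+ 2 - s / 2| <= eta.
Proof.
move=> g0 gs eta eta0.
have [K Klap] := laplace_affine C C0.
pose m2 := \int[nu]_x (weight x ^+ 2).
have m20 : 0 <= m2 by apply: Rintegral_ge0 => x _; exact: sqr_ge0.
(* [U] makes the error terms at most [eta / 3] each *)
pose U := Num.max 2 (Num.max (3 * C ^+ 2 * m2 / eta) (3 * K / eta)).
have U2 : 2 <= U by rewrite le_max lexx.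
have U0 : 0 < U by lra.
have Um : C ^+ 2 * m2 / U <= eta / 3.
  rewrite ler_pdivrMr// -ler_pdivrMl ?divr_gt0//.
  rewrite !le_max; apply/orP; right; apply/orP; left.
  by rewrite le_eqVlt; apply/orP; left; apply/eqP; field; rewrite gt_eqF.
have UK : K * expR (- U) <= eta / 3.
  rewrite expRN ler_pdivrMr ?expR_gt0// -ler_pdivrMl ?divr_gt0//.
  apply: (@le_trans _ _ U); last by have := expR_ge1Dx U; lra.
  rewrite !le_max; apply/orP; right; apply/orP; right.
  by rewrite le_eqVlt; apply/orP; left; apply/eqP; field; rewrite gt_eqF.
pose l n := slope n.
pose A n := [set x : R | C * l n * weight x <= U].
have mA n : measurable (A n).
  rewrite -[X in measurable X]setTI; apply: measurable_fun_le => //.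
  by apply: measurable_funM => //; exact: measurable_weight.
(* the Taylor quotient where the exponent is moderate *)
pose h n x := (expR (l n * g x) - 1 - l n * g x) / l n ^+ 2 * \1_(A n) x.
have mh n : measurable_fun setT (h n).
  apply: measurable_funM; last exact: measurable_indic.
  apply: measurable_funM => //; apply: measurable_funB; last exact: measurable_funM.
  apply: measurable_funB => //; apply: measurableT_comp => //; exact: measurable_funM.
have l_gt0 n : (0 < n)%N -> 0 < l n by exact: slope_gt0.
have lgx n x : (0 < n)%N -> `|l n * g x| <= C * l n * weight x.
  move=> /l_gt0 ln0; rewrite normrM gtr0_norm//.
  rewrite (_ : C * l n * weight x = l n * (C * weight x)); last by ring.
  by apply: ler_wpM2l => //; exact: ltW.
have hbnd n x : `|h n x| <= expR U * g x ^+ 2.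
  have bnd0 : 0 <= expR U * g x ^+ 2 by rewrite mulr_ge0 ?expR_ge0 ?sqr_ge0.
  have [->|n0] := posnP n.
    by rewrite /h /l /slope sqrtr0 invr0 mulr0 !mul0r expR0 subrr subrr !mul0r normr0.
  rewrite /h indicE.
  have [xA|xA] := boolP (x \in A n); last by rewrite mulr0 normr0.
  move: xA; rewrite inE /A/= => xA; rewrite mulr1 ger0_norm; last first.
    by rewrite divr_ge0 ?sqr_ge0// expR_taylor1_ge0.
  rewrite ler_pdivrMr ?exprn_gt0 ?l_gt0//.
  apply: le_trans (expR_taylor1_le _) _.
  rewrite [X in X <= _](_ : _ = l n ^+ 2 * (g x ^+ 2 * expR `|l n * g x|)); last by ring.
  rewrite [X in _ <= X](_ : _ = l n ^+ 2 * (g x ^+ 2 * expR U)); last by ring.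
  rewrite ler_wpM2l ?sqr_ge0// ler_wpM2l ?sqr_ge0// ler_expR.
  exact: le_trans (lgx n x n0) xA.
have hcvg x : h n x @[n --> \oo] --> g x ^+ 2 / 2.
  have w0 : 0 < C * weight x by rewrite mulr_gt0// (lt_le_trans _ (weight_ge1 x)).
  have q0 : 0 < 1 + `|g x| ^+ 3 * expR U.
    by rewrite ltr_wpDr// mulr_ge0 ?exprn_ge0 ?expR_ge0.
  apply/cvgrPdist_le => e e0; near=> n.
  have n0 : (0 < n)%N by near: n; exact: nbhs_infty_gt.
  have ln0 : 0 < l n by exact: l_gt0.
  have xA : C * l n * weight x <= U.
    rewrite mulrAC -ler_pdivlMl//; near: n; apply: (cvgr_le 0 slope0).
    by rewrite mulr_gt0// invr_gt0.
  rewrite /h indicE mem_set ?mulr1//.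
  have -> : g x ^+ 2 / 2 - (expR (l n * g x) - 1 - l n * g x) / l n ^+ 2 =
      - (expR (l n * g x) - 1 - l n * g x - (l n * g x) ^+ 2 / 2) / l n ^+ 2.
    by field; rewrite gt_eqF.
  rewrite normrM normrN normfV [`|l n ^+ 2|]ger0_norm ?sqr_ge0//.
  rewrite ler_pdivrMr ?exprn_gt0//; apply: le_trans (expR_taylor2_le _) _.
  have yU : `|l n * g x| <= U by exact: le_trans (lgx n x n0) xA.
  apply: (@le_trans _ _ (`|l n * g x| ^+ 3 * expR U)).
    by rewrite ler_wpM2l ?exprn_ge0// ler_expR.
  rewrite normrM gtr0_norm// [X in X <= _](_ : _ = l n * (`|g x| ^+ 3 * expR U) * l n ^+ 2); last by ring.
  rewrite ler_wpM2r ?sqr_ge0//.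
  apply: (@le_trans _ _ (l n * (1 + `|g x| ^+ 3 * expR U))).
    by rewrite ler_pM2l// lerDr.
  rewrite -ler_pdivlMr//; near: n; apply: (cvgr_le 0 slope0).
  by rewrite divr_gt0.
have int_g2 := integrable_growth2.
have int_bnd : nu.-integrable setT (fun x => (expR U * g x ^+ 2)%:E).
  exact: (integrableZl measurableT (expR U) int_g2).
have int_h n : nu.-integrable setT (EFin \o h n).
  apply: le_integrable int_bnd => //; first exact/measurable_EFinP.
  by move=> x _ /=; rewrite lee_fin (le_trans (hbnd n x))// ler_norm.
have hlim : \int[nu]_x h n x @[n --> \oo] --> s / 2.
  have mg2 : measurable_fun setT (fun x => (g x ^+ 2 / 2)%:E).
    by apply/measurable_EFinP; apply: measurable_funM => //; exact: measurable_funX.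
  have mhE n : measurable_fun setT (EFin \o h n) by exact/measurable_EFinP.
  have cvE : {ae nu, forall x, setT x ->
      (EFin \o h n) x @[n --> \oo] --> (g x ^+ 2 / 2)%:E}.
    apply: aeW => x _; apply: cvg_EFin; first exact: nearW.
    exact: hcvg.
  have bE : {ae nu, forall x n, setT x ->
      (`|(EFin \o h n) x| <= (expR U * g x ^+ 2)%:E)%E}.
    by apply: aeW => x n _; rewrite lee_fin.
  have [_ _] := dominated_convergence measurableT mhE mg2 cvE int_bnd bE.
  have int_g2h : nu.-integrable setT (fun x => (g x ^+ 2 / 2)%:E).
    exact: (integrableZr measurableT 2^-1 int_g2).
  have -> : (\int[nu]_x (g x ^+ 2 / 2)%:E = (s / 2)%:E)%E.
    rewrite -[LHS]fineK ?integrable_fin_num// -/(Rintegral _ _ _).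
    by rewrite (RintegralZr _ measurableT int_g2) gs.
  exact: fine_cvg.
have /cvgryPge aN := a_oo.
near=> n.
have n0 : (0 < n)%N by near: n; exact: nbhs_infty_gt.
have ln0 : 0 < l n by exact: l_gt0.
have hn : `|s / 2 - \int[nu]_x h n x| <= eta / 3.
  by near: n; move/cvgrPdist_le : hlim; apply; rewrite divr_gt0.
have ll : l n * level n = a n ^+ 2 by exact: slope_level.
have UC : U / C <= a n ^+ 2.
  have a1 : Num.max 1 (U / C) <= a n by near: n; exact: aN.
  move: a1; rewrite ge_max => /andP[a1 aU].
  by rewrite (le_trans aU)// expr2 ler_peMr// (le_trans _ a1).
have Abulk x : A n x -> `|x| <= level n.
  rewrite /A/= => xA; rewrite -(ler_pM2l ln0) ll.
  apply: le_trans UC; rewrite ler_pdivlMr//; apply: le_trans xA.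
  rewrite (_ : C * l n * weight x = l n * `|x| * C + C * l n); last first.
    by rewrite /weight; ring.
  by rewrite lerDl mulr_ge0 ?(ltW C0) ?(ltW ln0).
(* the linear term may be subtracted because [g] has mean zero *)
pose e x := (expR (l n * truncate n x) - 1) / l n ^+ 2 - g x / l n.
have int_tr := integrable_expR_truncate n n0.
have int_g := integrable_growth.
have int_e1 : nu.-integrable setT (fun x => (expR (l n * truncate n x) - 1)%:E).
  apply: (@integrableB _ _ _ nu setT measurableT
    (fun x => (expR (l n * truncate n x))%:E) (fun=> 1%:E)) => //.
  exact: finite_measure_integrable_cst.
have int_e2 : nu.-integrable setT
    (fun x => ((expR (l n * truncate n x) - 1) / l n ^+ 2)%:E).
  exact: (integrableZr measurableT (l n ^+ 2)^-1 int_e1).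
have int_e3 : nu.-integrable setT (fun x => (g x / l n)%:E).
  exact: (integrableZr measurableT (l n)^-1 int_g).
have int_e : nu.-integrable setT (EFin \o e).
  exact: (@integrableB _ _ _ nu setT measurableT _ _ int_e2 int_e3).
have intE : \int[nu]_x e x = (\int[nu]_x expR (l n * truncate n x) - 1) / l n ^+ 2.
  rewrite RintegralB// RintegralZr// RintegralZr// g0 mul0r subr0 RintegralB//.
    by rewrite Rintegral_cst//= probability_setT mulr1.
  exact: finite_measure_integrable_cst.
pose r x := e x - h n x.
have int_r : nu.-integrable setT (EFin \o r).
  exact: (@integrableB _ _ _ nu setT measurableT _ _ int_e (int_h n)).
have rE : \int[nu]_x r x = \int[nu]_x e x - \int[nu]_x h n x by rewrite RintegralB.
pose D := far C n U.
have r_le x : `|r x| <= (l n ^+ 2)^-1 * (expR (C * l n * weight x) * \1_D x)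
    + C ^+ 2 / U * weight x ^+ 2.
  have w1 := weight_ge1 x.
  have p2 : 0 <= C ^+ 2 / U * weight x ^+ 2.
    by rewrite mulr_ge0 ?sqr_ge0// divr_ge0 ?sqr_ge0// ltW.
  have p1 : 0 <= (l n ^+ 2)^-1 * (expR (C * l n * weight x) * \1_D x).
    by rewrite mulr_ge0 ?invr_ge0 ?sqr_ge0// mulr_ge0 ?expR_ge0.
  rewrite /r /e /h indicE; have [xA|xA] := boolP (x \in A n).
    move: (xA); rewrite inE => /Abulk xb; rewrite truncate_in// mulr1.
    rewrite (_ : _ - _ = 0) ?normr0 ?addr_ge0//.
    by field; rewrite gt_eqF.
  rewrite mulr0 subr0.
  have {}xA : U < C * l n * weight x.
    by move/negP: xA; rewrite inE /A/= => /negP; rewrite -ltNge.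
  apply: le_trans (ler_normB _ _) _; apply: lerD.
    rewrite normrM normfV [`|l n ^+ 2|]ger0_norm ?sqr_ge0// mulrC.
    rewrite ler_pM2l ?invr_gt0 ?exprn_gt0// indicE.
    have [xl|xl] := leP `|x| (level n); last first.
      by rewrite truncate_out// mulr0 expR0 subrr normr0 mulr_ge0 ?expR_ge0.
    rewrite mem_set ?mulr1; last by split => //; exact: ltW.
    rewrite truncate_in//.
    apply: le_trans (expR_abs_sub1_le _) _; rewrite ler_expR.
    exact: lgx.
  rewrite normrM normfV (gtr0_norm ln0) ler_pdivrMr//.
  apply: le_trans (gC x) _.
  rewrite (_ : _ * l n = C * weight x * (C * l n * weight x / U)); last by ring.
  rewrite ler_peMr ?mulr_ge0 ?(ltW C0)//; first by lra.
  by rewrite ler_pdivlMr// mul1r ltW.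
have rsmall : `|\int[nu]_x r x| <= eta / 3 + eta / 3.
  apply: le_trans (le_normr_Rintegral measurableT int_r) _.
  apply: le_trans (far_weight_integral_le C n U (K * l n ^+ 2 * expR (- U)) _
    (l n ^+ 2)^-1 (C ^+ 2 / U) _ _ _ _ _) _ => //.
  - by near: n; move: Klap; apply: filterS => n; apply.
  - by apply: measurableT_comp => //; case/integrableP: int_r => /measurable_EFinP.
  - by rewrite invr_ge0 sqr_ge0.
  - by rewrite divr_ge0 ?sqr_ge0// ltW.
  - by move=> x; rewrite normr_ge0 r_le.
  apply: lerD; last by rewrite mulrAC.
  rewrite (_ : _ * _ = K * expR (- U))//.
  by field; rewrite gt_eqF.
rewrite -intE -[\int[nu]_x e x](subrK (\int[nu]_x h n x)) -rE.
move: hn rsmall; rewrite !ler_norml => /andP[? ?] /andP[? ?].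
by apply/andP; split; lra.
Unshelve. all: by end_near. Qed.

Hypothesis g0 : forall x, 0 <= g x.

(** As [expR y - y] has no linear term, the slope enters squared: through the
    second moment of [g] where the exponent is at most 2, and through
    [laplace_affine] elsewhere. *)
Lemma truncated_exp_moment : exists rho, \forall n \near \oo,
  \int[nu]_x (expR (slope n * truncate n x) - slope n * truncate n x) <=
  1 + rho * slope n ^+ 2.
Proof.
have [K Klap] := laplace_affine C C0.
pose m2 := \int[nu]_x (weight x ^+ 2).
exists (K * expR (- 2) + C ^+ 2 * expR 2 * m2).
near=> n.
have Klapn : (\int[nu]_(x in far C n 2) (expR (C * slope n * weight x))%:E <=
    (K * slope n ^+ 2 * expR (- 2))%:E)%E.
  by near: n; move: Klap; apply: filterS => n; apply.
have n0 : (0 < n)%N by near: n; exact: nbhs_infty_gt.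
set l := slope n; have l0 : 0 < l by exact: slope_gt0.
pose t := truncate n.
have t0 x : 0 <= t x by rewrite /t /truncate mulr_ge0.
have tC x : t x <= C * weight x.
  rewrite /t; have [xl|xl] := leP `|x| (level n).
    by rewrite truncate_in// (le_trans _ (gC x))// ler_norm.
  by rewrite truncate_out// mulr_ge0 ?(ltW C0)// (le_trans _ (weight_ge1 x)).
have mt : measurable_fun setT t by exact: measurable_truncate.
have lt0 x : 0 <= l * t x by apply: mulr_ge0 => //; exact: ltW.
have int_e : nu.-integrable setT (fun x => (expR (l * t x))%:E).
  exact: integrable_expR_truncate.
have int_t : nu.-integrable setT (fun x => (l * t x)%:E).
  apply: le_integrable int_e => //.
    by apply/measurable_EFinP; exact: measurable_funM.
  move=> x _ /=; rewrite lee_fin ger0_norm// ger0_norm ?expR_ge0//.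
  by have := expR_ge1Dx (l * t x); lra.
have int_et : nu.-integrable setT (fun x => (expR (l * t x) - l * t x)%:E).
  exact: (@integrableB _ _ _ nu setT measurableT _ _ int_e int_t).
rewrite -lerBlDl.
have -> : \int[nu]_x (expR (l * t x) - l * t x) - 1 =
    \int[nu]_x (expR (l * t x) - l * t x - 1).
  rewrite [RHS]RintegralB//; first by rewrite Rintegral_cst//= probability_setT mul1r.
  exact: finite_measure_integrable_cst.
rewrite [leRHS](_ : _ = 1 * (K * l ^+ 2 * expR (- 2)) +
    (l ^+ 2 * C ^+ 2 * expR 2) * m2); last by ring.
apply: (far_weight_integral_le C n 2) => //.
- apply: measurable_funB => //; apply: measurable_funB; last exact: measurable_funM.
  by apply: measurableT_comp => //; exact: measurable_funM.
- by rewrite mulr_ge0 ?expR_ge0// mulr_ge0 ?sqr_ge0.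
move=> x; have -> : expR (l * t x) - l * t x - 1 = expR (l * t x) - 1 - l * t x by ring.
rewrite expR_taylor1_ge0 mul1r/=.
have p1 : 0 <= l ^+ 2 * C ^+ 2 * expR 2 * weight x ^+ 2.
  by do 2!rewrite mulr_ge0 ?sqr_ge0 ?expR_ge0//; rewrite mulr_ge0 ?sqr_ge0.
have ltC : l * t x <= C * l * weight x.
  rewrite (_ : C * l * weight x = l * (C * weight x)); last by ring.
  by apply: ler_wpM2l => //; exact: ltW.
have p2 : 0 <= expR (C * l * weight x) * \1_(far C n 2) x by rewrite mulr_ge0 ?expR_ge0.
have [xl|xl] := leP `|x| (level n); last first.
  by rewrite /t truncate_out// mulr0 expR0 subrr subrr addr_ge0.
have [x2|x2] := leP 2 (C * l * weight x).
  rewrite ler_wpDr// indicE mem_set ?mulr1; last by split.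
  have : expR (l * t x) <= expR (C * l * weight x) by rewrite ler_expR.
  by have := lt0 x; lra.
rewrite ler_wpDl//; apply: le_trans (expR_taylor1_le _) _.
rewrite ger0_norm// [leRHS](_ : _ = (C * l * weight x) ^+ 2 * expR 2); last by ring.
apply: ler_pM; rewrite ?sqr_ge0 ?expR_ge0//.
  by rewrite lerXn2r// nnegrE// (le_trans (lt0 x)).
by rewrite ler_expR (le_trans ltC)// ltW.
Unshelve. all: by end_near. Qed.

(** Outside the bulk [weight x / level n] exceeds 1, so that the first moment
    is at most the second one divided by [level n = a n ^+ 2 / slope n]. *)
Lemma truncated_drift : exists rho, \forall n \near \oo,
  slope n * \int[nu]_x (g x * \1_(~` bulk n) x) <= rho * slope n ^+ 2.
Proof.
pose m2 := \int[nu]_x (weight x ^+ 2).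
have m20 : 0 <= m2 by apply: Rintegral_ge0 => x _; exact: sqr_ge0.
have /cvgryPge aN := a_oo.
exists (C * m2).
near=> n.
have n0 : (0 < n)%N by near: n; exact: nbhs_infty_gt.
have l0 : 0 < slope n by exact: slope_gt0.
have L0 : 0 < level n by exact: level_gt0.
have a1 : 1 <= a n by near: n; exact: aN.
have mB : measurable (~` bulk n) by apply: measurableC; exact: measurable_bulk.
have int_w : nu.-integrable setT (fun x => (C / level n * weight x ^+ 2)%:E).
  exact: (integrableZl measurableT (C / level n) integrable_weight2).
have gle x : g x * \1_(~` bulk n) x <= C / level n * weight x ^+ 2.
  have w1 := weight_ge1 x.
  have p : 0 <= C / level n * weight x ^+ 2.
    by rewrite mulr_ge0 ?sqr_ge0// divr_ge0 ?ltW.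
  rewrite indicE; have [xB|_] := boolP (x \in _); last by rewrite mulr0.
  move: xB; rewrite inE /bulk/= => /negP; rewrite -ltNge => xl.
  rewrite mulr1 (le_trans (ler_norm _))// (le_trans (gC x))//.
  rewrite [leRHS](_ : _ = C * weight x * (weight x / level n)); last by ring.
  rewrite ler_peMr ?mulr_ge0 ?(ltW C0)//; first by lra.
  by rewrite ler_pdivlMr// mul1r (le_trans (ltW xl))// /weight lerDr.
have : \int[nu]_x (g x * \1_(~` bulk n) x) <= C / level n * m2.
  rewrite -(RintegralZl _ measurableT integrable_weight2).
  apply: le_Rintegral => //.
  apply: le_integrable int_w => //.
    apply/measurable_EFinP; apply: measurable_funM => //; exact: measurable_indic.
  move=> x _; rewrite /= lee_fin ger0_norm ?mulr_ge0// (le_trans (gle x))//.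
  exact: ler_norm.
rewrite -(ler_pM2l l0) => /le_trans; apply.
rewrite [leLHS](_ : _ = C * m2 * slope n ^+ 2 * (a n ^+ 2)^-1); last first.
  by rewrite -(slope_level n n0); field; rewrite !gt_eqF.
have p : 0 <= C * m2 * slope n ^+ 2.
  exact: mulr_ge0 (mulr_ge0 (ltW C0) m20) (sqr_ge0 _).
apply: ler_piMr p _.
have a21 : 1 <= a n ^+ 2 by exact: exprn_ege1.
by rewrite invf_le1// (lt_le_trans _ a21).
Unshelve. all: by end_near. Qed.

End growth.
End moderate_tails.

(** * From exponential moments to large deviations *)

Section log_probabilities.
Context {R : realType}.
Implicit Types (u : nat -> \bar R) (p : \bar R) (v c : R).

Lemma limn_esup_le u c : (\forall n \near \oo, (u n <= c%:E)%E) ->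
  (limn_esup u <= c%:E)%E.
Proof.
move=> [N _ uN]; rewrite /limn_esup limf_esupE; apply: ge_ereal_inf.
exists (ereal_sup (u @` [set n | (N <= n)%N])).
  by exists [set n | (N <= n)%N] => //; exists N.
by apply: ge_ereal_sup => _ [n /= Nn <-]; exact: uN.
Qed.

Lemma limn_esup_Ny u : limn_esup u = -oo%E ->
  forall c, \forall n \near \oo, (u n <= c%:E)%E.
Proof.
rewrite /limn_esup limf_esupE => uNy c.
have : (ereal_inf [set ereal_sup (u @` V) | V in \oo] < c%:E)%E by rewrite uNy ltNyr.
move=> /ereal_inf_lt[_ [V VF <-] Vc].
apply: filterS VF => n Vn; rewrite (le_trans _ (ltW Vc))//.
by apply: ereal_sup_ubound; exists n.
Qed.

Lemma log_le v p c : 0 < v -> (0 <= p)%E ->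
  ((v^-1)%:E * lne p <= c%:E)%E = (p <= (expR (v * c))%:E)%E.
Proof.
move=> v0 p0.
have pin : p \in `[0%E, +oo%E] by rewrite in_itv/= p0 leey.
have ein : (expR (v * c))%:E \in `[0%E, +oo%E].
  by rewrite in_itv/= lee_fin expR_ge0 leey.
rewrite -(lee_lne pin ein) lne_EFin ?expR_gt0// expRK.
by rewrite lee_pdivrMl// -EFinM.
Qed.

Lemma log_ge v p c : 0 < v -> (0 <= p)%E ->
  (c%:E <= (v^-1)%:E * lne p)%E = ((expR (v * c))%:E <= p)%E.
Proof.
move=> v0 p0.
have pin : p \in `[0%E, +oo%E] by rewrite in_itv/= p0 leey.
have ein : (expR (v * c))%:E \in `[0%E, +oo%E].
  by rewrite in_itv/= lee_fin expR_ge0 leey.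
rewrite -(lee_lne ein pin) lne_EFin ?expR_gt0// expRK.
by rewrite lee_pdivlMl// -EFinM.
Qed.

End log_probabilities.

Lemma compact_quadratic_sublevel {R : realType} (s L : R) : 0 < s ->
  compact [set y : R^o | ((y ^+ 2 / (2 * s))%:E <= L%:E)%E].
Proof.
move=> s0; have s20 : 0 < 2 * s by rewrite mulr_gt0.
have [L0|L0] := leP 0 L; last first.
  rewrite (_ : mkset _ = set0); first exact: compact0.
  apply/seteqP; split => // y /=; rewrite lee_fin => yL.
  have : 0 <= y ^+ 2 / (2 * s) by rewrite divr_ge0 ?sqr_ge0// ltW.
  by rewrite leNgt (le_lt_trans yL L0).
rewrite (_ : mkset _ = `[- Num.sqrt (L * (2 * s)), Num.sqrt (L * (2 * s))]%classic).
  exact: segment_compact.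
apply/seteqP; split => y /=; rewrite lee_fin in_itv/= ler_pdivrMr// => yL.
  by rewrite -ler_norml -sqrtr_sqr ler_wsqrtr.
have : `|y| <= Num.sqrt (L * (2 * s)) by rewrite ler_norml.
rewrite -(@ler_pXn2r _ 2) ?nnegrE ?sqrtr_ge0// real_normK ?num_real//.
by rewrite sqr_sqrtr// mulr_ge0// ltW.
Qed.

Lemma expR_markov {d} {T : measurableType d} {R : realType} (P : probability T R)
    (A : set T) (f : T -> R) (x : R) : measurable A -> measurable_fun setT f ->
  (forall w, 0 <= f w) -> (forall w, A w -> expR x <= f w) ->
  (P A <= (expR (- x))%:E * \int[P]_w (f w)%:E)%E.
Proof.
move=> mA mf f0 fA.
rewrite -ge0_integralZl_EFin ?expR_ge0//;
  [|by move=> w _; rewrite lee_fin|exact/measurable_EFinP].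
rewrite -[A]setIT -integral_indic//.
apply: ge0_le_integral => //.
- by apply/measurable_EFinP; exact: measurable_indic.
- by apply: emeasurable_funM => //; exact/measurable_EFinP.
move=> w _; rewrite -EFinM lee_fin indicE.
have [wA|_] := boolP (w \in A); last by rewrite mulr_ge0 ?expR_ge0.
by rewrite expRN mulrC ler_pdivlMr ?expR_gt0// mul1r; apply: fA; rewrite -inE.
Qed.

Section gaussian_LDP.
Context {d} {T : measurableType d} {R : realType} (P : probability T R).
Variables (W V : nat -> T -> R) (v : nat -> R) (s : R).
Hypotheses (mW : forall n, measurable_fun setT (W n))
  (mV : forall n, measurable_fun setT (V n))
  (v_gt0 : forall n, (0 < n)%N -> 0 < v n) (v_oo : v n @[n --> \oo] --> +oo)
  (s0 : 0 < s).
Hypothesis exp_moments : forall th eta : R, 0 < eta -> \forall n \near \oo,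
  ((expR (v n * (th ^+ 2 * s / 2 - eta)))%:E <=
     \int[P]_w (expR (v n * th * V n w))%:E <=
   (expR (v n * (th ^+ 2 * s / 2 + eta)))%:E)%E.
Hypothesis close : forall del K : R, 0 < del -> \forall n \near \oo,
  (P [set w | (del <= `|W n w - V n w|)%R] <= (expR (- (K * v n)))%:E)%E.

Lemma near_expR_ge (c ka : R) : 0 < ka -> \forall n \near \oo, c <= expR (v n * ka).
Proof.
move=> ka0; near=> n.
have vn : c / ka <= v n by near: n; move/cvgryPge : v_oo; exact.
apply: le_trans (expR_ge1Dx _).
by move: vn; rewrite ler_pdivrMr// => /le_trans; apply; rewrite lerDr.
Unshelve. all: by end_near. Qed.

Lemma measurable_superlevel (f : T -> R) (r : R) : measurable_fun setT f ->
  measurable [set w | r <= f w].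
Proof.
by move=> mf; rewrite -[X in measurable X]setTI; exact: measurable_fun_le.
Qed.

Lemma measurable_ball_preimage (f : T -> R) (x r : R) : measurable_fun setT f ->
  measurable [set w | `|f w - x| < r].
Proof.
move=> mf; rewrite (_ : mkset _ = ~` [set w | r <= `|f w - x|]).
  apply: measurableC; apply: measurable_superlevel.
  by apply: measurableT_comp => //; exact: measurable_funB.
by apply/seteqP; split => w /=; rewrite ltNge => /negP.
Qed.

Lemma measurable_expV (n : nat) th : measurable_fun setT (fun w => (expR (v n * th * V n w))%:E).
Proof. by apply/measurable_EFinP; apply: measurableT_comp => //; exact: measurable_funM. Qed.

Lemma chernoff_exp n (th r x : R) : (0 < n)%N -> 0 <= th ->
  (P [set w | (x <= r * V n w)%R] <= (expR (- (v n * th * x)))%:E *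
     \int[P]_w (expR (v n * (th * r) * V n w))%:E)%E.
Proof.
move=> n0 th0; have vth : 0 <= v n * th by rewrite mulr_ge0// ltW// v_gt0.
apply: expR_markov => //.
- by apply: measurable_superlevel; exact: measurable_funM.
- exact/measurable_EFinP/measurable_expV.
- move=> w /= xV; rewrite ler_expR.
  by rewrite [leRHS](_ : _ = v n * th * (r * V n w)) ?ler_wpM2l//; ring.
Qed.

(** Chernoff's bound for [V] beyond [q], at the optimal exponent [q / s]; here
    [q] is a little less than [r], to leave room for the difference of [W] and
    [V]. *)
Lemma tail_upper (r eps : R) : 0 <= r -> 0 < eps -> \forall n \near \oo,
  (P [set w | (r <= `|W n w|)%R] <=
   (expR (- (v n * (r ^+ 2 / (2 * s) - eps))))%:E)%E.
Proof.
move=> r0 eps0; have s20 : 0 < 2 * s by rewrite mulr_gt0.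
have mA n : measurable [set w | r <= `|W n w|].
  by apply: measurable_superlevel; exact: measurableT_comp.
have [->|rN0] := eqVneq r 0.
  near=> n; apply: (@le_trans _ _ 1%E); first by apply: probability_le1; apply: measurable_superlevel; exact: measurableT_comp.
  rewrite lee_fin -[leLHS]expR0 ler_expR expr0n/= mul0r sub0r mulrN opprK.
  rewrite mulr_ge0 ?(ltW eps0)// ltW// v_gt0//.
  by near: n; exact: nbhs_infty_gt.
have {rN0}r_gt0 : 0 < r by rewrite lt0r rN0.
pose c := r ^+ 2 / (2 * s).
(* [del] is small enough for [(r - del)^2 / (2 s)] to exceed [c - eps / 3] *)
pose del := Num.min r (eps * s / (3 * r)).
have del0 : 0 < del by rewrite lt_min r_gt0 divr_gt0// mulr_gt0.
have delr : del <= r by rewrite ge_min lexx.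
have dele : 3 * r * del <= eps * s.
  have : del <= eps * s / (3 * r) by rewrite ge_min lexx orbT.
  by rewrite ler_pdivlMr ?mulr_gt0// mulrC.
pose q := r - del; have q0 : 0 <= q by rewrite subr_ge0.
have qc : c - eps / 3 <= q ^+ 2 / (2 * s).
  rewrite ler_pdivlMr// /c mulrBl divfK ?gt_eqF// /q.
  by have := sqr_ge0 del; nra.
have e3 : 0 < eps / 3 by lra.
have q1 n (sg : R) : (0 < n)%N -> sg ^+ 2 = 1 ->
  (\int[P]_w (expR (v n * (q / s * sg) * V n w))%:E <=
    (expR (v n * ((q / s * sg) ^+ 2 * s / 2 + eps / 3)))%:E)%E ->
  (P [set w | (q <= sg * V n w)%R] <= (expR (- (v n * (c - 2 * (eps / 3)))))%:E)%E.
  move=> n0 sg2 HM; have vn := v_gt0 n n0.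
  have qs0 : 0 <= q / s by rewrite divr_ge0// ltW.
  apply: le_trans (chernoff_exp n (q / s) sg q n0 qs0) _.
  apply: le_trans (lee_wpmul2l _ HM) _; first by rewrite lee_fin expR_ge0.
  rewrite -EFinM lee_fin -expRD ler_expR exprMn sg2.
  have -> : - (v n * (q / s) * q) + v n * ((q / s) ^+ 2 * 1 * s / 2 + eps / 3) =
      v n * (eps / 3 - q ^+ 2 / (2 * s)) by field; rewrite gt_eqF.
  by rewrite -[leRHS]mulrN ler_pM2l//; lra.
near=> n.
have n0 : (0 < n)%N by near: n; exact: nbhs_infty_gt.
have H1 : (P [set w | (del <= `|W n w - V n w|)%R] <= (expR (- (c * v n)))%:E)%E.
  by near: n; exact: close.
have H2 : (P [set w | (q <= 1 * V n w)%R] <= (expR (- (v n * (c - 2 * (eps / 3)))))%:E)%E.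
  apply: q1 => //; first by rewrite expr1n.
  have /andP[] // : ((expR (v n * ((q / s * 1) ^+ 2 * s / 2 - eps / 3)))%:E <=
     \int[P]_w (expR (v n * (q / s * 1) * V n w))%:E <=
     (expR (v n * ((q / s * 1) ^+ 2 * s / 2 + eps / 3)))%:E)%E.
  by near: n; exact: exp_moments.
have H3 : (P [set w | (q <= -1 * V n w)%R] <= (expR (- (v n * (c - 2 * (eps / 3)))))%:E)%E.
  apply: q1 => //; first by rewrite sqrrN expr1n.
  have /andP[] // : ((expR (v n * ((q / s * -1) ^+ 2 * s / 2 - eps / 3)))%:E <=
     \int[P]_w (expR (v n * (q / s * -1) * V n w))%:E <=
     (expR (v n * ((q / s * -1) ^+ 2 * s / 2 + eps / 3)))%:E)%E.
  by near: n; exact: exp_moments.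
have vn := v_gt0 n n0.
have three : 3 <= expR (v n * (eps / 3)) by near: n; exact: near_expR_ge.
set A1 := [set w | _] in H1; set A2 := [set w | _] in H2; set A3 := [set w | _] in H3.
have mA1 : measurable A1.
  by apply: measurable_superlevel; apply: measurableT_comp => //; exact: measurable_funB.
have mA2 : measurable A2 by apply: measurable_superlevel; exact: measurable_funM.
have mA3 : measurable A3 by apply: measurable_superlevel; exact: measurable_funM.
apply: (@le_trans _ _ (P (A1 `|` (A2 `|` A3)))).
  rewrite le_measure ?inE//; first by do 2![apply: measurableU => //].
  move=> w /= rW; have [|wd] := leP del `|W n w - V n w|; first by left.
  right; rewrite /A2 /A3 /= mul1r mulN1r.
  have : q <= `|V n w|.
    rewrite /q; have := ler_normB (W n w - V n w) (- V n w).
    by rewrite opprK subrK normrN; lra.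
  by rewrite lerNr ler_normr => /orP[|]; [left|rewrite lerNr; right].
apply: le_trans (measureU2 _ mA1 (measurableU _ _ mA2 mA3)) _.
apply: (@le_trans _ _ (3 * expR (- (v n * (c - 2 * (eps / 3)))))%:E); last first.
  rewrite lee_fin -/c [leRHS](_ : _ = expR (v n * (eps / 3)) *
    expR (- (v n * (c - 2 * (eps / 3))))); last by rewrite -expRD; congr expR; lra.
  by rewrite ler_wpM2r ?expR_ge0.
set m := expR _.
rewrite (_ : 3 * m = m + (m + m)); last by ring.
rewrite !EFinD; apply: leeD.
  apply: le_trans H1 _; rewrite lee_fin ler_expR lerN2 [leRHS]mulrC ler_pM2l// ;lra.
by apply: le_trans (measureU2 _ mA2 mA3) _; exact: leeD.
Unshelve. all: by end_near. Qed.

(** Tilting without changing the measure: under the weight [expR (v th V)] with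
    [th = x / s] the mass of [V] concentrates near [x], because the two outer
    parts, estimated by the moments at [th + eta] and [th - eta], have a smaller
    exponential rate. *)
Lemma ball_lowerV (x rho eps : R) : 0 < rho -> 0 < eps -> \forall n \near \oo,
  ((expR (- (v n * (x ^+ 2 / (2 * s) + eps))))%:E <=
   P [set w | (`|V n w - x| < rho)%R])%E.
Proof.
move=> rho0 eps0; have s20 : 0 < 2 * s by rewrite mulr_gt0.
pose c := x ^+ 2 / (2 * s); pose th := x / s.
pose del := Num.min rho (eps / (4 * (1 + `|th|))).
have th1 : 0 < 4 * (1 + `|th|) by rewrite mulr_gt0// ltr_pwDl.
have del0 : 0 < del by rewrite lt_min rho0 divr_gt0.
have delr : del <= rho by rewrite ge_min lexx.
have dele : `|th| * del <= eps / 4.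
  have : del <= eps / (4 * (1 + `|th|)) by rewrite ge_min lexx orbT.
  by rewrite ler_pdivlMr// => ?; lra.
pose eta := del / s; pose ka := del ^+ 2 / (2 * s).
have eta0 : 0 < eta by rewrite divr_gt0.
have ka0 : 0 < ka by rewrite divr_gt0// exprn_gt0.
pose ze := Num.min ka eps / 4.
have ze0 : 0 < ze by rewrite divr_gt0// lt_min ka0.
have zek : 4 * ze <= ka.
  by rewrite /ze mulrCA divff ?mulr1 ?ge_min ?lexx.
have zee : 4 * ze <= eps.
  by rewrite /ze mulrCA divff ?mulr1 ?ge_min ?lexx ?orbT.
have cE : th ^+ 2 * s / 2 = c by rewrite /th /c; field; rewrite gt_eqF.
have ccE : th * x = 2 * c by rewrite /th /c; field; rewrite gt_eqF.
have plusE : - (eta * (x + del)) + (th + eta) ^+ 2 * s / 2 = c - ka.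
  by rewrite /eta /th /c /ka; field; rewrite gt_eqF.
have minusE : eta * (x - del) + (th - eta) ^+ 2 * s / 2 = c - ka.
  by rewrite /eta /th /c /ka; field; rewrite gt_eqF.
have ka2 : 0 < ka / 2 by lra.
have eps2 : 0 < eps / 2 by lra.
have Mup (u : R) : \forall n \near \oo,
     (\int[P]_w (expR (v n * u * V n w))%:E <=
      (expR (v n * (u ^+ 2 * s / 2 + ze)))%:E)%E.
  by apply: filterS (exp_moments u _ ze0) => n /andP[].
near=> n.
have n0 : (0 < n)%N by near: n; exact: nbhs_infty_gt.
have vn := v_gt0 n n0.
have four : 4 <= expR (v n * (ka / 2)) by near: n; exact: near_expR_ge.
have two : 2 <= expR (v n * (eps / 2)) by near: n; exact: near_expR_ge.
have M0 : ((expR (v n * (c - ze)))%:E <= \int[P]_w (expR (v n * th * V n w))%:E)%E.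
  rewrite -cE; have /andP[] // : ((expR (v n * (th ^+ 2 * s / 2 - ze)))%:E <=
     \int[P]_w (expR (v n * th * V n w))%:E <=
     (expR (v n * (th ^+ 2 * s / 2 + ze)))%:E)%E.
  by near: n; exact: exp_moments.
have Mp : (\int[P]_w (expR (v n * (th + eta) * V n w))%:E <=
     (expR (v n * ((th + eta) ^+ 2 * s / 2 + ze)))%:E)%E.
  by near: n; exact: Mup.
have Mm : (\int[P]_w (expR (v n * (th - eta) * V n w))%:E <=
     (expR (v n * ((th - eta) ^+ 2 * s / 2 + ze)))%:E)%E.
  by near: n; exact: Mup.
pose A := [set w | `|V n w - x| < del].
have mA : measurable A by exact: measurable_ball_preimage.
have pointwise w : expR (v n * th * V n w) <=
    expR (v n * (2 * c + `|th| * del)) * \1_A w +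
    (expR (- (v n * (eta * (x + del)))) * expR (v n * (th + eta) * V n w) +
     expR (v n * (eta * (x - del))) * expR (v n * (th - eta) * V n w)).
  rewrite -!expRD.
  have e1 := expR_ge0 (- (v n * (eta * (x + del))) + v n * (th + eta) * V n w).
  have e2 := expR_ge0 (v n * (eta * (x - del)) + v n * (th - eta) * V n w).
  have e3 : 0 <= expR (v n * (2 * c + `|th| * del)) * \1_A w by rewrite mulr_ge0 ?expR_ge0.
  have [Aw|nAw] := ltP `|V n w - x| del.
    rewrite indicE mem_set// mulr1 in e3 *.
    rewrite ler_wpDr ?addr_ge0// ler_expR -mulrA ler_pM2l// -ccE -lerBlDl -mulrBr.
    rewrite (le_trans (ler_norm _))// normrM ler_wpM2l// ltW//.
  rewrite ler_wpDl//.
  have [xV|Vx] := leP x (V n w).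
    have xV' : x + del <= V n w by move: nAw; rewrite ger0_norm ?subr_ge0//; lra.
    rewrite ler_wpDr// ler_expR.
    have -> : - (v n * (eta * (x + del))) + v n * (th + eta) * V n w =
      v n * th * V n w + v n * eta * (V n w - (x + del)) by ring.
    by rewrite lerDl mulr_ge0 ?subr_ge0// mulr_ge0// ltW.
  have Vx' : V n w <= x - del by move: nAw; rewrite ltr0_norm ?subr_lt0//; lra.
  rewrite ler_wpDl// ler_expR.
  have -> : v n * (eta * (x - del)) + v n * (th - eta) * V n w =
    v n * th * V n w + v n * eta * (x - del - V n w) by ring.
  by rewrite lerDl mulr_ge0 ?subr_ge0// mulr_ge0// ltW.
have mI : measurable_fun setT (fun w => (expR (v n * (2 * c + `|th| * del)) * \1_A w)%:E).
  by apply/measurable_EFinP; apply: measurable_funM => //; exact: measurable_indic.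
have mE (k u : R) : measurable_fun setT (fun w => (k * expR (v n * u * V n w))%:E).
  by apply/measurable_EFinP; apply: measurable_funM => //; apply/measurable_EFinP; exact: measurable_expV.
have intle : ((expR (v n * (c - ze)))%:E <= (expR (v n * (2 * c + `|th| * del)))%:E * P A +
   ((expR (- (v n * (eta * (x + del)))))%:E * (expR (v n * ((th + eta) ^+ 2 * s / 2 + ze)))%:E +
    (expR (v n * (eta * (x - del))))%:E * (expR (v n * ((th - eta) ^+ 2 * s / 2 + ze)))%:E))%E.
  apply: le_trans M0 _.
  apply: (@le_trans _ _ (\int[P]_w ((expR (v n * (2 * c + `|th| * del)) * \1_A w)%:E +
    ((expR (- (v n * (eta * (x + del)))) * expR (v n * (th + eta) * V n w))%:E +
     (expR (v n * (eta * (x - del))) * expR (v n * (th - eta) * V n w))%:E)))%E).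
    apply: ge0_le_integral => //; first exact: measurable_expV.
      by apply: emeasurable_funD => //; exact: emeasurable_funD.
    by move=> w _; rewrite -!EFinD lee_fin.
  rewrite ge0_integralD//; last 2 first.
  - by move=> w _; rewrite -EFinD lee_fin addr_ge0// mulr_ge0 ?expR_ge0.
  - exact: emeasurable_funD.
  apply: leeD.
    under eq_integral do rewrite EFinM.
    rewrite ge0_integralZl_EFin ?expR_ge0//; last first.
      by apply/measurable_EFinP; exact: measurable_indic.
    by rewrite integral_indic// setIT.
  rewrite ge0_integralD//.
  apply: leeD; under eq_integral do rewrite EFinM;
    rewrite ge0_integralZl_EFin ?expR_ge0//; (try exact: measurable_expV);
    by rewrite lee_wpmul2l// lee_fin expR_ge0.
have {}intle : expR (v n * (c - ze)) <= expR (v n * (2 * c + `|th| * del)) * fine (P A) +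
    2 * expR (v n * (c - ka + ze)).
  rewrite -lee_fin EFinD EFinM fineK ?fin_num_measure//.
  apply: le_trans intle _; rewrite leeD2l// -!EFinM -EFinD lee_fin -!expRD.
  have -> : - (v n * (eta * (x + del))) + v n * ((th + eta) ^+ 2 * s / 2 + ze) =
      v n * (c - ka + ze) by rewrite -plusE; ring.
  have -> : v n * (eta * (x - del)) + v n * ((th - eta) ^+ 2 * s / 2 + ze) =
      v n * (c - ka + ze) by rewrite -minusE; ring.
  by lra.
have outer : 2 * expR (v n * (c - ka + ze)) <= expR (v n * (c - ze)) / 2.
  have -> : expR (v n * (c - ze)) = expR (v n * (ka - 2 * ze)) * expR (v n * (c - ka + ze)).
    by rewrite -expRD -mulrDr; congr (expR (_ * _)); lra.
  have : 4 <= expR (v n * (ka - 2 * ze)).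
    by apply: le_trans four _; rewrite ler_expR ler_pM2l//; lra.
  have := expR_gt0 (v n * (c - ka + ze)); nra.
apply: (@le_trans _ _ (P A)); last first.
  rewrite le_measure ?inE//; first exact: measurable_ball_preimage.
  by move=> w; rewrite /A/= => /lt_le_trans; apply.
have -> : P A = (fine (P A))%:E by rewrite fineK// fin_num_measure.
rewrite lee_fin -/c -(ler_pM2l (expR_gt0 (v n * (2 * c + `|th| * del)))).
apply: (@le_trans _ _ (expR (v n * (c - ze)) / 2)); last by lra.
rewrite ler_pdivlMr// -expRD mulrC.
apply: le_trans (ler_wpM2r (expR_ge0 _) two) _.
rewrite -expRD ler_expR.
rewrite -mulrN -!mulrDr ler_pM2l//; lra.
Unshelve. all: by end_near. Qed.

Lemma ball_lower (x rho eps : R) : 0 < rho -> 0 < eps -> \forall n \near \oo,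
  ((expR (- (v n * (x ^+ 2 / (2 * s) + eps))))%:E <=
   P [set w | (`|W n w - x| < rho)%R])%E.
Proof.
move=> rho0 eps0.
have rho2 : 0 < rho / 2 by lra.
have eps2 : 0 < eps / 2 by lra.
pose c := x ^+ 2 / (2 * s).
near=> n.
have n0 : (0 < n)%N by near: n; exact: nbhs_infty_gt.
have vn := v_gt0 n n0.
have H1 : (P [set w | (rho / 2 <= `|W n w - V n w|)%R] <= (expR (- ((c + eps) * v n)))%:E)%E.
  by near: n; exact: close.
have H2 : ((expR (- (v n * (c + eps / 2))))%:E <= P [set w | (`|V n w - x| < rho / 2)%R])%E.
  by near: n; exact: ball_lowerV.
have two : 2 <= expR (v n * (eps / 2)) by near: n; exact: near_expR_ge.
set A1 := [set w | _] in H1; set A2 := [set w | _] in H2; set A := [set w | _].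
have mA1 : measurable A1.
  by apply: measurable_superlevel; apply: measurableT_comp => //; exact: measurable_funB.
have mA2 : measurable A2 by exact: measurable_ball_preimage.
have mA : measurable A by exact: measurable_ball_preimage.
have sub : (P A2 <= P A1 + P A)%E.
  apply: le_trans (measureU2 _ mA1 mA); rewrite le_measure ?inE//.
    exact: measurableU.
  move=> w; rewrite /A1 /A2 /A /= => wV.
  have [|wd] := leP (rho / 2) `|W n w - V n w|; first by left.
  right; have := ler_normD (W n w - V n w) (V n w - x).
  by rewrite addrA subrK; lra.
have {H1 H2}sub := le_trans (le_trans H2 sub) (leeD2r _ H1).
have -> : P A = (fine (P A))%:E by rewrite fineK// fin_num_measure.
move: sub; have -> : P A = (fine (P A))%:E by rewrite fineK// fin_num_measure.
rewrite -EFinD !lee_fin -/c.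
have -> : - (v n * (c + eps / 2)) = v n * (eps / 2) + - (v n * (c + eps)) by lra.
rewrite expRD [_ * v n]mulrC => sub.
have := expR_gt0 (- (v n * (c + eps))); nra.
Unshelve. all: by end_near. Qed.

(** The Gaussian case of the Gärtner-Ellis theorem for [V], carried over to [W]
    because the two are exponentially equivalent. *)
Theorem gaussian_LDP : LDP P (W : nat -> T -> R^o) v
  (fun x : R^o => (x ^+ 2 / (2 * s))%:E).
Proof.
have s20 : 0 < 2 * s by rewrite mulr_gt0.
have mWA n (A : set R) : measurable A -> measurable (W n @^-1` A).
  by move=> mA; rewrite -[X in measurable X]setTI; exact: mW.
split.
- by move=> n U n0 oU; apply: mWA; exact: open_measurable.
- by split.
- split; first by move=> y; rewrite lee_fin divr_ge0 ?sqr_ge0// ltW.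
  by move=> L; exact: compact_quadratic_sublevel.
- move=> U oU; rewrite /limn_einf leeN2; apply: le_ereal_inf_tmp => _ [x Ux <-].
  apply/lee_addgt0Pr => eps eps0; rewrite -EFinD; apply: limn_esup_le.
  have [rho rho0 xU] : exists2 rho : R, 0 < rho & ball x rho `<=` U.
    by move: oU; rewrite openE => /(_ _ Ux) /nbhs_ballP[rho /= rho0 ?]; exists rho.
  near=> n.
  have n0 : (0 < n)%N by near: n; exact: nbhs_infty_gt.
  rewrite leeNl -EFinN log_ge ?v_gt0// mulrN.
  apply: (@le_trans _ _ (P [set w | (`|W n w - x| < rho)%R])).
    by near: n; exact: ball_lower.
  rewrite le_measure ?inE//.
  + exact: measurable_ball_preimage.
  + by apply: mWA; exact: open_measurable.
  + by move=> w /= wx; apply: xU; rewrite /ball/= distrC.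
- move=> K cK.
  have mK : measurable K by exact: closed_measurable.
  set y := ereal_inf _.
  have y0 : (0 <= y)%E.
    by apply: le_ereal_inf_tmp => _ [x _ <-]; rewrite lee_fin divr_ge0 ?sqr_ge0// ltW.
  have H (c : R) : 0 <= c -> (c%:E <= y)%E -> forall eps : R, 0 < eps ->
      (limn_esup (fun n => ((v n)^-1)%:E * lne (P (W n @^-1` K))) <= (- c + eps)%:E)%E.
    move=> c0 cy eps eps0; apply: limn_esup_le.
    pose r := Num.sqrt (2 * s * c).
    have r2 : r ^+ 2 / (2 * s) = c.
      by rewrite sqr_sqrtr ?mulr_ge0 ?(ltW s0)// mulrC mulKf// gt_eqF.
    near=> n.
    have n0 : (0 < n)%N by near: n; exact: nbhs_infty_gt.
    rewrite log_le ?v_gt0//.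
    apply: (@le_trans _ _ (P [set w | (r <= `|W n w|)%R])).
      rewrite le_measure ?inE//; first exact: mWA.
        by apply: measurable_superlevel; exact: measurableT_comp.
      move=> w /= Kw; rewrite -sqrtr_sqr ler_wsqrtr//.
      have : (y <= ((W n w) ^+ 2 / (2 * s))%:E)%E by apply: ereal_inf_lbound; exists (W n w).
      by move=> /(le_trans cy); rewrite lee_fin ler_pdivlMr// mulrC.
    have -> : - c + eps = - (r ^+ 2 / (2 * s) - eps) by rewrite r2; lra.
    rewrite mulrN; near: n; apply: tail_upper => //; exact: sqrtr_ge0.
  case: y y0 H => [y| |]//; rewrite ?lee_fin => y0 H.
    by apply/lee_addgt0Pr => eps eps0; exact: (H y y0 (lexx _)).
  (* with an infinite infimum, every level [c] may be used in [H] *)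
  move: H; case: (limn_esup _) => [r| |] H; last by [].
    have c0 : (0 : R) <= `|r| + 2 by rewrite addr_ge0.
    have := H _ c0 (leey _) 1 ltr01; rewrite lee_fin => {H y0} rle.
    by exfalso; have := ler_norm (- r); rewrite normrN; lra.
  by have := H 0 (lexx _) (leey _) 1 ltr01.
Unshelve. all: by end_near. Qed.

End gaussian_LDP.

(** * Distribution functions as random step functions *)

Section step_functions.
Context {R : realType}.
Local Notation leb := (@lebesgue_measure R).

Definition step (u x : R) : R := (u <= x)%R%:R.

Lemma measurable_step {d} {T : measurableType d} (f g : T -> R) :
  measurable_fun setT f -> measurable_fun setT g ->
  measurable_fun setT (fun w => step (f w) (g w)).
Proof.
move=> mf mg; rewrite (_ : (fun w => _) = \1_[set w | f w <= g w]).
  apply: measurable_indic; rewrite -[X in measurable X]setTI.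
  exact: measurable_fun_le.
apply/funext => w; rewrite /step indicE; congr ((nat_of_bool _)%:R).
by apply/idP/idP; rewrite inE.
Qed.

Lemma step_ge0 u x : 0 <= step u x. Proof. by rewrite /step. Qed.

Lemma step_le1 u x : step u x <= 1.
Proof. by rewrite /step lern1; case: (u <= x). Qed.

Lemma step_itv (u v : R) : u <= v ->
  (fun x => step u x - step v x) = \1_(`[u, v[%classic).
Proof.
move=> uv; apply/funext => x; rewrite /step indicE mem_setE in_itv/=.
have [ux|xu] := leP u x; have [vx|xv] := leP v x => //=; rewrite ?subrr ?subr0//.
by have := le_trans uv vx; rewrite leNgt xu.
Qed.

Lemma integral_abs_stepB (u v : R) :
  (\int[leb]_x (`|step u x - step v x|)%:E = (`|u - v|)%:E)%E.
Proof.
wlog uv : u v / u <= v => [H|].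
  have [/H//|/ltW vu] := leP u v.
  rewrite distrC -(H _ _ vu); apply: eq_integral => x _.
  by rewrite distrC.
under eq_integral => x _.
  rewrite (_ : step u x - step v x = \1_(`[u, v[%classic) x); last by rewrite -(step_itv _ _ uv).
  rewrite ger0_norm//; over.
rewrite integral_indic//= setIT lebesgue_measure_itv/=.
rewrite distrC ger0_norm ?subr_ge0// lte_fin.
have [//|vu] := ltP u v; have -> : v = u by apply/eqP; rewrite eq_le uv vu.
by rewrite subrr.
Qed.

Lemma integrable_stepB (u v : R) : leb.-integrable setT (fun x => (step u x - step v x)%:E).
Proof.
apply/integrableP; split.
  apply/measurable_EFinP; apply: measurable_funB; exact: measurable_step.
under eq_integral do rewrite abse_EFin.
by rewrite integral_abs_stepB ltry.
Qed.

Lemma Rintegral_stepB (u v : R) : \int[leb]_x (step u x - step v x) = v - u.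
Proof.
wlog uv : u v / u <= v => [H|].
  have [/H//|/ltW vu] := leP u v.
  rewrite -[RHS]opprB -(H _ _ vu) -mulN1r -RintegralZl//; last exact: integrable_stepB.
  by apply: eq_Rintegral => x _; rewrite mulN1r opprB.
have := integral_abs_stepB u v.
under eq_integral => x _.
  rewrite (_ : step u x - step v x = \1_(`[u, v[%classic) x); last by rewrite -(step_itv _ _ uv).
  rewrite ger0_norm// -(step_itv _ _ uv); over.
by rewrite /Rintegral => ->; rewrite /= distrC ger0_norm ?subr_ge0.
Qed.

End step_functions.

Section centred_steps.
Context {R : realType} (nu : probability R R).
Local Notation leb := (@lebesgue_measure R).

(** The distribution function as a function of the law; for the law of [X] it
    is convertible to [distribution_function X]. *)
Definition cdfun (x : R) : R := fine (nu `]-oo, x]%classic).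

Hypothesis mom2 : nu.-integrable setT (fun x : R => (x ^+ 2)%:E).

Lemma cdfunE (x : R) : (\int[nu]_u (step u x)%:E = (cdfun x)%:E)%E.
Proof.
rewrite /cdfun fineK ?fin_num_measure//.
rewrite -[X in nu X]setIT -integral_indic//.
by apply: eq_integral => u _; rewrite /step indicE mem_setE in_itv.
Qed.

Lemma measurable_cdfun : measurable_fun setT cdfun.
Proof.
apply: nondecreasing_measurable => //= x y xy.
rewrite /cdfun fine_le ?fin_num_measure// le_measure ?inE//.
by move=> z /=; rewrite !in_itv/= => /le_trans; apply.
Qed.

Lemma cdfun_ge0 x : 0 <= cdfun x. Proof. exact: fine_ge0. Qed.

Lemma cdfun_le1 x : cdfun x <= 1.
Proof. by rewrite -lee_fin /cdfun fineK ?fin_num_measure// probability_le1. Qed.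

Definition cstep (u x : R) : R := step u x - cdfun x.

Lemma cstep_le1 u x : `|cstep u x| <= 1.
Proof.
have := cdfun_ge0 x; have := cdfun_le1 x; have := step_ge0 u x; have := step_le1 u x.
by rewrite /cstep ler_norml => ? ? ? ?; apply/andP; split; lra.
Qed.

Lemma measurable_cstep {d} {T : measurableType d} (f g : T -> R) :
  measurable_fun setT f -> measurable_fun setT g ->
  measurable_fun setT (fun w => cstep (f w) (g w)).
Proof.
move=> mf mg; apply: measurable_funB; first exact: measurable_step.
exact: (measurableT_comp measurable_cdfun mg).
Qed.

Lemma integrable_step_nu x : nu.-integrable setT (fun u => (step u x)%:E).
Proof.
apply: (@integrable_bounded _ _ _ nu (step^~ x) 1); first exact: measurable_step.
by move=> u; rewrite ger0_norm ?step_ge0// step_le1.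
Qed.

Lemma integral_cstep0 x : \int[nu]_u cstep u x = 0.
Proof.
rewrite RintegralB//; last 2 first.
- exact: integrable_step_nu.
- exact: finite_measure_integrable_cst.
rewrite Rintegral_cst//= probability_setT mulr1.
by rewrite /Rintegral cdfunE/= subrr.
Qed.

Definition abs_moment : R := \int[nu]_u `|u|.

Lemma integrable_abs : nu.-integrable setT (fun u : R => (`|u|)%:E).
Proof.
apply: le_integrable (integrable_weight nu mom2) => //.
  by apply/measurable_EFinP.
move=> u _; rewrite /= lee_fin normr_id (le_trans _ (ler_norm _))//.
by rewrite /weight lerDr.
Qed.

(** [cstep u] is the mean over [v] of [step u - step v], the integral of whose
    absolute value is [`|u - v|]. *)
Lemma integral_abs_cstep_le (u : R) :
  (\int[leb]_x (`|cstep u x|)%:E <= (`|u| + abs_moment)%:E)%E.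
Proof.
pose F (z : R * measurableTypeR R) : \bar R := (`|step u z.2 - step z.1 z.2|)%:E.
have mF : measurable_fun setT F.
  apply/measurable_EFinP; apply: measurableT_comp => //; apply: measurable_funB.
    exact: measurable_step.
  exact: measurable_step.
have F0 z : (0 <= F z)%E by rewrite lee_fin.
apply: (@le_trans _ _ (\int[leb]_x \int[nu]_v (`|step u x - step v x|)%:E)%E).
  apply: ge0_le_integral => //.
  - by apply/measurable_EFinP; apply: measurableT_comp => //; exact: measurable_cstep.
  - exact: (measurable_fun_fubini_tonelli_G (m1 := nu) F mF F0).
  - move=> x _.
    have iS : nu.-integrable setT (fun v => (step u x - step v x)%:E).
      apply: (@integrableB _ _ _ nu setT measurableT (fun=> (step u x)%:E) (fun v => (step v x)%:E)) => //.
        exact: finite_measure_integrable_cst.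
      exact: integrable_step_nu.
    have -> : cstep u x = \int[nu]_v (step u x - step v x).
      rewrite RintegralB//; last 2 first.
      - exact: finite_measure_integrable_cst.
      - exact: integrable_step_nu.
      by rewrite Rintegral_cst//= probability_setT mulr1 /Rintegral cdfunE.
    rewrite EFin_normr_Rintegral//; apply: le_abse_integral => //.
    by case/integrableP: iS.
rewrite -(fubini_tonelli (m1 := nu) F mF F0) /F /=.
under eq_integral => v _ do rewrite integral_abs_stepB.
have iabs := integrable_abs.
have iadd : nu.-integrable setT (fun v : R => (`|u| + `|v|)%:E).
  apply: (@integrableD _ _ _ nu setT measurableT (fun=> (`|u|)%:E) (fun v : R => (`|v|)%:E)) => //.
  exact: finite_measure_integrable_cst.
apply: (@le_trans _ _ (\int[nu]_v (`|u| + `|v|)%:E)%E).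
  apply: ge0_le_integral => //.
  - by apply/measurable_EFinP; apply: measurableT_comp => //; exact: measurable_funB.
  - by apply/measurable_EFinP; exact: measurable_funD.
  - by move=> v _; rewrite lee_fin ler_normB.
rewrite -[leLHS]fineK ?integrable_fin_num// lee_fin -/(Rintegral _ _ _) RintegralD//.
  by rewrite Rintegral_cst//= probability_setT mulr1.
exact: finite_measure_integrable_cst.
Qed.

End centred_steps.

(** * Linear functionals of the centred step functions *)

Section cauchy_schwarz.
Context {d} {T : measurableType d} {R : realType} (mu : {measure set T -> \bar R}).

Lemma Rintegral_cauchy_schwarz (f g : T -> R) :
  mu.-integrable setT (fun x => (f x ^+ 2)%:E) ->
  mu.-integrable setT (fun x => (f x * g x)%:E) ->
  mu.-integrable setT (fun x => (g x ^+ 2)%:E) ->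
  (\int[mu]_x (f x * g x)) ^+ 2 <= \int[mu]_x (f x ^+ 2) * \int[mu]_x (g x ^+ 2).
Proof.
move=> iff ifg igg.
set A := \int[mu]_x (f x ^+ 2); set B := \int[mu]_x _; set C := \int[mu]_x (g x ^+ 2).
have A0 : 0 <= A by apply: Rintegral_ge0 => x _; exact: sqr_ge0.
have quad t : 0 <= t ^+ 2 * A + (2 * t * B + C).
  have -> : t ^+ 2 * A + (2 * t * B + C) = \int[mu]_x ((t * f x + g x) ^+ 2).
    rewrite /A /B /C -RintegralZl// -RintegralZl//.
    have i1 : mu.-integrable setT (fun x => (t ^+ 2 * f x ^+ 2)%:E).
      exact: (integrableZl measurableT (t ^+ 2) iff).
    have i2 : mu.-integrable setT (fun x => (2 * t * (f x * g x))%:E).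
      exact: (integrableZl measurableT (2 * t) ifg).
    have i3 : mu.-integrable setT (fun x => (2 * t * (f x * g x) + g x ^+ 2)%:E).
      exact: (integrableD measurableT i2 igg).
    rewrite -RintegralD// -RintegralD//.
    by apply: eq_Rintegral => x _; ring.
  by apply: Rintegral_ge0 => x _; exact: sqr_ge0.
have [A1|] := ltP 0 A.
  have := quad (- B / A).
  rewrite (_ : _ + _ = (A * C - B ^+ 2) / A); last by field; rewrite gt_eqF.
  by rewrite pmulr_lge0 ?invr_gt0// subr_ge0.
move=> A1; have {A1 A0}A0 : A = 0 by apply/eqP; rewrite eq_le A1.
have [->|B0] := eqVneq B 0; first by rewrite A0 expr0n mul0r.
have := quad (- (C + 1) / (2 * B)); rewrite A0 mulr0 add0r.
rewrite (_ : _ + _ = - 1); last by field.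
by rewrite ler0N1.
Qed.

End cauchy_schwarz.

Section linear_functionals.
Context {R : realType} (nu : probability R R).
Local Notation leb := (@lebesgue_measure R).
Hypothesis mom2 : nu.-integrable setT (fun x : R => (x ^+ 2)%:E).
Local Notation cstep := (cstep nu).
Local Notation m1 := (abs_moment nu).

Lemma measurable_cstepr (u : R) : measurable_fun setT (cstep u).
Proof. exact: measurable_cstep. Qed.

Lemma integrable_cstep (u : R) : leb.-integrable setT (EFin \o cstep u).
Proof.
apply/integrableP; split; first by apply/measurable_EFinP; exact: measurable_cstepr.
apply: le_lt_trans (integral_abs_cstep_le nu mom2 u) _; exact: ltry.
Qed.

Section weighted.
Variables (h : R -> R) (c : R).
Hypotheses (mh : measurable_fun setT h) (hc : forall x, `|h x| <= c).

Let c0 : 0 <= c. Proof. exact: le_trans (hc 0). Qed.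

Lemma integrable_weighted_cstep (u : R) :
  leb.-integrable setT (fun x => (h x * cstep u x)%:E).
Proof.
have ic : leb.-integrable setT (fun x => (c * cstep u x)%:E).
  exact: (integrableZl measurableT c (integrable_cstep u)).
apply: le_integrable ic => //.
  by apply/measurable_EFinP; apply: measurable_funM => //; exact: measurable_cstepr.
by move=> x _; rewrite /= lee_fin !normrM (ger0_norm c0) ler_wpM2r.
Qed.

(** For [h x = J (cdfun nu x)], the influence function of the L-statistic with
    score [J] is [- lin]. *)
Definition lin (u : R) : R := \int[leb]_x (h x * cstep u x).

Lemma abs_lin_integral (u : R) :
  (\int[leb]_x (`|h x * cstep u x|)%:E <= (c * (`|u| + m1))%:E)%E.
Proof.
rewrite EFinM; apply: (@le_trans _ _ (c%:E * \int[leb]_x (`|cstep u x|)%:E)%E).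
  rewrite -ge0_integralZl_EFin//; last first.
    apply/measurable_EFinP; apply: measurableT_comp => //; exact: measurable_cstepr.
  apply: ge0_le_integral => //.
  - apply/measurable_EFinP; apply: measurableT_comp => //; apply: measurable_funM => //.
    exact: measurable_cstepr.
  - apply: emeasurable_funM => //; apply/measurable_EFinP; apply: measurableT_comp => //.
    exact: measurable_cstepr.
  - by move=> x _; rewrite -EFinM lee_fin normrM ler_wpM2r.
by rewrite lee_wpmul2l ?lee_fin// integral_abs_cstep_le.
Qed.

Lemma lin_le (u : R) : `|lin u| <= c * (`|u| + m1).
Proof.
have iu := integrable_weighted_cstep u.
rewrite -lee_fin; apply: le_trans (abs_lin_integral u).
rewrite EFin_normr_Rintegral//; apply: le_abse_integral => //.
by case/integrableP: iu.
Qed.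

Let f (z : R * measurableTypeR R) : \bar R := (h z.2 * cstep z.1 z.2)%:E.

Let mf : measurable_fun setT f.
Proof.
apply/measurable_EFinP; apply: measurable_funM; first exact: (measurableT_comp mh).
exact: measurable_cstep.
Qed.

Lemma integrable_abs_affine : nu.-integrable setT (fun u : R => (c * (`|u| + m1))%:E).
Proof.
apply: (integrableZl measurableT c (f := fun u : R => (`|u| + m1)%:E)).
apply: (@integrableD _ _ _ nu setT measurableT (fun u : R => (`|u|)%:E) (fun=> m1%:E)) => //.
  exact: integrable_abs.
exact: finite_measure_integrable_cst.
Qed.

Let intf : (nu \x leb)%E.-integrable setT f.
Proof.
apply/integrable12ltyP => //.
have iaff := integrable_abs_affine.
apply: (@le_lt_trans _ _ (\int[nu]_u (c * (`|u| + m1))%:E)%E).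
  apply: ge0_le_integral => //.
  - by move=> u _; exact: integral_ge0.
  - apply: (measurable_fun_fubini_tonelli_F (m2 := leb) (fun z => `|f z|%E)) => //.
    exact: measurableT_comp.
  - by case/integrableP: iaff.
  - by move=> u _; rewrite /f/=; exact: abs_lin_integral.
rewrite -ge0_fin_numE; first exact: integrable_fin_num.
apply: integral_ge0 => u _; rewrite lee_fin mulr_ge0// addr_ge0//.
exact: Rintegral_ge0.
Qed.

Lemma measurable_lin : measurable_fun setT lin.
Proof.
apply/measurable_EFinP.
rewrite (_ : _ \o _ = fubini_F leb f); first exact: (measurable_fubini_F intf).
apply/funext => u /=; rewrite /fubini_F /f/= /lin /Rintegral fineK//.
apply: integrable_fin_num => //; exact: integrable_weighted_cstep.
Qed.

Lemma integrable_lin : nu.-integrable setT (EFin \o lin).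
Proof.
apply: le_integrable integrable_abs_affine => //.
  by apply/measurable_EFinP; exact: measurable_lin.
move=> u _; rewrite /= lee_fin (le_trans (lin_le u))// ler_norm//.
Qed.

Lemma integral_lin0 : \int[nu]_u lin u = 0.
Proof.
have linE u : (lin u)%:E = (\int[leb]_x f (u, x))%E.
  rewrite /f/= /lin /Rintegral fineK//.
  apply: integrable_fin_num => //; exact: integrable_weighted_cstep.
rewrite /Rintegral; under eq_integral do rewrite linE.
rewrite (Fubini intf) /f/=.
rewrite (eq_integral (fun=> 0%E)) ?integral0// => x _.
have ic : nu.-integrable setT (fun u => (cstep u x)%:E).
  apply: (@integrable_bounded _ _ _ nu (cstep^~ x) 1); first exact: measurable_cstep.
  by move=> u; exact: cstep_le1.
under eq_integral do rewrite EFinM.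
rewrite integralZl// -[X in (_ * X)%E]fineK ?integrable_fin_num//.
by rewrite -/(Rintegral _ _ _) integral_cstep0 mule0.
Qed.

End weighted.

Section kernel.
Variable B : set R.
Hypothesis mB : measurable B.

Definition bsum (s : seq R) (x : R) : R := \sum_(u <- s) \1_B u * cstep u x.

(** The inner product of [cstep u] and [cstep v] in L2. *)
Definition covk (u v : R) : R := lin (cstep u) v.

Definition kern (u v : R) : R := \1_B u * \1_B v * covk u v.

Let cstepr_le1 u x : `|cstep u x| <= 1. Proof. exact: cstep_le1. Qed.

Lemma covkC u v : covk u v = covk v u.
Proof. by apply: eq_Rintegral => x _; rewrite mulrC. Qed.

Lemma bsum_cons u s x : bsum (u :: s) x = \1_B u * cstep u x + bsum s x.
Proof. by rewrite /bsum big_cons. Qed.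

Lemma measurable_bsum s : measurable_fun setT (bsum s).
Proof.
by apply: measurable_sum => u; apply: measurable_funM => //; exact: measurable_cstepr.
Qed.

Lemma bsum_le s x : `|bsum s x| <= (size s)%:R.
Proof.
elim: s => [|u s IHs]; first by rewrite /bsum big_nil normr0.
rewrite bsum_cons /= -natr1 addrC (le_trans (ler_normD _ _))// lerD// normrM.
rewrite -[leRHS]mulr1 ler_pM//.
by rewrite indicE; case: (_ \in _); rewrite ?normr1 ?normr0.
Qed.

Lemma Rintegral_mul_bsum (h : R -> R) (c : R) s :
  measurable_fun setT h -> (forall x, `|h x| <= c) ->
  leb.-integrable setT (fun x => (h x * bsum s x)%:E) /\
  \int[leb]_x (h x * bsum s x) = \sum_(u <- s) \1_B u * lin h u.
Proof.
move=> mh hc; elim: s => [|u s [IHi IHs]].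
  have E : (fun x => h x * bsum [::] x) = cst 0.
    by apply/funext => x; rewrite /bsum big_nil mulr0.
  split; last by rewrite big_nil E /Rintegral integral0.
  by apply: (eq_integrable measurableT (cst 0%E)) => [x _|]; [rewrite /bsum big_nil mulr0|exact: integrable0].
have iu := integrable_weighted_cstep h c mh hc u.
have ibu : leb.-integrable setT (fun x => (\1_B u * (h x * cstep u x))%:E).
  exact: (integrableZl measurableT (\1_B u) iu).
have E x : h x * bsum (u :: s) x = \1_B u * (h x * cstep u x) + h x * bsum s x.
  by rewrite bsum_cons; ring.
split.
  under eq_fun do rewrite E.
  exact: (integrableD measurableT ibu IHi).
under eq_Rintegral do rewrite E.
by rewrite RintegralD// IHs RintegralZl// big_cons.
Qed.

Lemma lin_bsum s v : lin (bsum s) v = \sum_(u <- s) \1_B u * covk u v.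
Proof.
have [_ H] := Rintegral_mul_bsum (cstep v) 1 s (measurable_cstepr v) (cstepr_le1 v).
rewrite /lin (eq_bigr (fun u => \1_B u * lin (cstep v) u)); last first.
  by move=> u _; rewrite -/(covk v u) covkC.
by rewrite -H; apply: eq_Rintegral => x _; rewrite mulrC.
Qed.

Lemma sum_kern s v : \sum_(u <- s) kern u v = \1_B v * lin (bsum s) v.
Proof.
rewrite lin_bsum mulr_sumr; apply: eq_bigr => u _; rewrite /kern; ring.
Qed.

Lemma gram_kern s : gram kern s = \int[leb]_x (bsum s x ^+ 2).
Proof.
have [_ H] := Rintegral_mul_bsum _ _ s (measurable_bsum s) (bsum_le s).
under eq_Rintegral do rewrite expr2.
rewrite H /gram exchange_big/=; apply: eq_bigr => v _.
exact: sum_kern.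
Qed.

Lemma integrable_bsum2 s : leb.-integrable setT (fun x => (bsum s x ^+ 2)%:E).
Proof.
by have [] := Rintegral_mul_bsum _ _ s (measurable_bsum s) (bsum_le s).
Qed.

Lemma gram_kern_ge0 s : 0 <= gram kern s.
Proof. by rewrite gram_kern; apply: Rintegral_ge0 => x _; exact: sqr_ge0. Qed.

Lemma integrable_cstep2 u : leb.-integrable setT (fun x => (cstep u x ^+ 2)%:E).
Proof. exact: (integrable_weighted_cstep (cstep u) 1 (measurable_cstepr u) (cstepr_le1 u) u). Qed.

Lemma covk_diag u : covk u u = \int[leb]_x (cstep u x ^+ 2).
Proof. by apply: eq_Rintegral => x _; rewrite expr2. Qed.

Lemma lin_bsum_le s u : lin (bsum s) u ^+ 2 <= gram kern s * covk u u.
Proof.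
rewrite gram_kern covk_diag; apply: Rintegral_cauchy_schwarz.
- exact: integrable_bsum2.
- exact: integrable_weighted_cstep (measurable_bsum s) (bsum_le s) u.
- exact: integrable_cstep2.
Qed.

Lemma kern_cauchy_schwarz s u : (\sum_(x <- s) kern x u) ^+ 2 <= gram kern s * kern u u.
Proof.
rewrite sum_kern exprMn /kern -expr2 [leRHS]mulrCA ler_wpM2l ?sqr_ge0//.
exact: lin_bsum_le.
Qed.

Lemma kernC u v : kern u v = kern v u.
Proof. by rewrite /kern covkC [\1_B u * _]mulrC. Qed.

Definition cnorm u : R := Num.sqrt (covk u u).

Lemma sqrt_kern u : Num.sqrt (kern u u) = cnorm u * \1_B u.
Proof.
rewrite /kern -expr2 sqrtrM ?sqr_ge0// sqrtr_sqr mulrC ger0_norm//.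
Qed.

(** Since [cstep u] is bounded by 1, its squared L2 norm is at most its L1
    norm. *)
Lemma cnorm_le u : cnorm u <= (1 + m1) * weight u.
Proof.
have m10 : 0 <= m1 by apply: Rintegral_ge0 => x _; exact: normr_ge0.
have K : covk u u <= `|u| + m1.
  apply: le_trans (ler_norm _) _; rewrite -[leRHS]mul1r.
  exact: lin_le (measurable_cstepr u) (cstepr_le1 u) u.
set C := (1 + m1) * weight u.
have C1 : 1 <= C.
  by rewrite -[leLHS]mulr1 ler_pM//; [rewrite lerDl|exact: weight_ge1].
have KC : covk u u <= C.
  apply: le_trans K _; rewrite /C /weight mulrDl mul1r !mulrDr mulr1.
  by have := mulr_ge0 m10 (normr_ge0 u); lra.
rewrite /cnorm -[leRHS]ger0_norm ?(le_trans ler01)// -sqrtr_sqr ler_wsqrtr//.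
by apply: le_trans KC _; rewrite expr2 ler_peMr// (le_trans ler01).
Qed.

Lemma measurable_covk : measurable_fun setT (fun z : R * R => covk z.1 z.2).
Proof.
pose q (z : R * R) : R := \int[leb]_x ((cstep z.1 x + cstep z.2 x) ^+ 2).
have iq u v : leb.-integrable setT (fun x => (cstep u x * cstep v x)%:E).
  exact: integrable_weighted_cstep (measurable_cstepr u) (cstepr_le1 u) v.
have mq : measurable_fun setT q.
  pose f (z : (R * R) * measurableTypeR R) : \bar R :=
    ((cstep z.1.1 z.2 + cstep z.1.2 z.2) ^+ 2)%:E.
  have mf : measurable_fun setT f.
    apply/measurable_EFinP; apply: measurable_funX; apply: measurable_funD.
      apply: measurable_cstep => //.
      exact: (measurableT_comp measurable_fst measurable_fst).
    apply: measurable_cstep => //.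
    exact: (measurableT_comp measurable_snd measurable_fst).
  have f0 z : (0 <= f z)%E by rewrite lee_fin sqr_ge0.
  exact: (measurableT_comp (fine_measurable measurableT) (measurable_fun_fubini_tonelli_F (m2 := leb) f mf f0)).
have mdiag : measurable_fun setT (fun u => q (u, u)).
  exact: (measurableT_comp mq (measurable_fun_pair (@measurable_id _ _ _) (@measurable_id _ _ _))).
have qE u v : q (u, v) = covk u u + 2 * covk u v + covk v v.
  have i1 : leb.-integrable setT (fun x => (2 * (cstep u x * cstep v x))%:E).
    exact: (integrableZl measurableT 2 (iq u v)).
  have i2 : leb.-integrable setT (fun x => (cstep u x * cstep u x + 2 * (cstep u x * cstep v x))%:E).
    exact: (integrableD measurableT (iq u u) i1).
  rewrite /covk /lin -(RintegralZl 2 measurableT (iq u v)).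
  rewrite -(RintegralD measurableT (iq u u) i1) -(RintegralD measurableT i2 (iq v v)).
  by apply: eq_Rintegral => x _ /=; ring.
rewrite (_ : (fun z => _) = (fun z : R * R => (q z - q (z.1, z.1) / 4 - q (z.2, z.2) / 4) / 2)).
  apply: measurable_funM => //; apply: measurable_funB; first apply: measurable_funB => //.
  - by apply: measurable_funM => //; exact: (measurableT_comp mdiag measurable_fst).
  - by apply: measurable_funM => //; exact: (measurableT_comp mdiag measurable_snd).
by apply/funext => -[u v] /=; rewrite !qE; lra.
Qed.

Lemma measurable_indic_B : measurable_fun setT (\1_B : R -> R).
Proof. exact: measurable_indic. Qed.

Lemma measurable_kern : measurable_fun setT (fun z : R * R => kern z.1 z.2).
Proof.
have mI := measurable_indic_B.
apply: measurable_funM; last exact: measurable_covk.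
apply: measurable_funM; first exact: (measurableT_comp mI measurable_fst).
exact: (measurableT_comp mI measurable_snd).
Qed.

Lemma measurable_cnorm : measurable_fun setT cnorm.
Proof.
apply: (measurableT_comp measurable_sqrtr).
by apply: (measurableT_comp2 covk idfun idfun measurable_covk); exact: measurable_id.
Qed.

Lemma integrable_cnorm : nu.-integrable setT (EFin \o cnorm).
Proof.
have m10 : 0 <= m1 by apply: Rintegral_ge0 => x _; exact: normr_ge0.
have iw : nu.-integrable setT (fun u => ((1 + m1) * weight u)%:E).
  exact: (integrableZl measurableT (1 + m1) (integrable_weight nu mom2)).
apply: le_integrable iw => //; first by apply/measurable_EFinP; exact: measurable_cnorm.
move=> u _; rewrite /= lee_fin ger0_norm ?sqrtr_ge0//.
by rewrite (le_trans (cnorm_le u))// ler_norm.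
Qed.

Lemma integrable_sum_kern s : nu.-integrable setT (fun v => (\sum_(u <- s) kern u v)%:E).
Proof.
have iS := integrable_lin _ _ (measurable_bsum s) (bsum_le s).
apply: le_integrable iS => //.
  apply/measurable_EFinP; under eq_fun do rewrite sum_kern.
  apply: measurable_funM; first exact: measurable_indic_B.
  exact: measurable_lin (measurable_bsum s) (bsum_le s).
move=> v _; rewrite /= lee_fin sum_kern normrM ler_piMl//.
by rewrite indicE; case: (_ \in _); rewrite ?normr1 ?normr0.
Qed.

(** The kernel is centred, so restricting it to [B] costs only what is cut off. *)
Lemma kern_drift s : `|\int[nu]_v (\sum_(u <- s) kern u v)| <=
  \int[nu]_v (cnorm v * \1_(~` B) v) * Num.sqrt (gram kern s).
Proof.
have iS := integrable_lin _ _ (measurable_bsum s) (bsum_le s).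
have mS := measurable_lin _ _ (measurable_bsum s) (bsum_le s).
have mIc : measurable_fun setT (\1_(~` B) : R -> R).
  by apply: measurable_indic; exact: measurableC.
have iC : nu.-integrable setT (fun v => (\1_(~` B) v * lin (bsum s) v)%:E).
  apply: le_integrable iS => //.
    by apply/measurable_EFinP; exact: measurable_funM.
  move=> v _; rewrite /= lee_fin normrM ler_piMl//.
  by rewrite indicE; case: (_ \in _); rewrite ?normr1 ?normr0.
have icn : nu.-integrable setT (fun v => (cnorm v * \1_(~` B) v)%:E).
  apply: le_integrable integrable_cnorm => //.
    apply/measurable_EFinP; apply: measurable_funM => //; exact: measurable_cnorm.
  move=> v _; rewrite /= lee_fin normrM ler_piMr//.
  by rewrite indicE; case: (_ \in _); rewrite ?normr1 ?normr0.
have -> : \int[nu]_v (\sum_(u <- s) kern u v) =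
    - \int[nu]_v (\1_(~` B) v * lin (bsum s) v).
  have := RintegralB measurableT iS iC.
  rewrite (integral_lin0 _ _ (measurable_bsum s) (bsum_le s)) sub0r => <-.
  apply: eq_Rintegral => v _; rewrite sum_kern !indicE in_setC.
  by case: (_ \in _) => /=; ring.
rewrite normrN; apply: le_trans (le_normr_Rintegral measurableT iC) _.
rewrite -RintegralZr//; apply: le_Rintegral => //.
- exact: (integrable_norm iC).
- exact: (integrableZr measurableT (Num.sqrt (gram kern s)) icn).
move=> v _; rewrite normrM ger0_norm// mulrC mulrAC ler_wpM2r//.
rewrite -sqrtr_sqr [leRHS]mulrC -sqrtrM ?gram_kern_ge0// ler_wsqrtr//.
exact: lin_bsum_le.
Qed.

End kernel.
End linear_functionals.

(** * The variance of a linear functional *)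

Section product_of_integrals.
Context {d1 d2} {T1 : measurableType d1} {T2 : measurableType d2} {R : realType}.
Context (m1 : {sigma_finite_measure set T1 -> \bar R})
  (m2 : {sigma_finite_measure set T2 -> \bar R}) (p : T1 -> R) (q : T2 -> R).
Hypotheses (ip : m1.-integrable setT (EFin \o p)) (iq : m2.-integrable setT (EFin \o q)).

Let f (z : T1 * T2) : \bar R := (p z.1 * q z.2)%:E.

Let mp : measurable_fun setT p.
Proof. by case/integrableP : ip => /measurable_EFinP. Qed.

Let mq : measurable_fun setT q.
Proof. by case/integrableP : iq => /measurable_EFinP. Qed.

Lemma measurable_tensor : measurable_fun setT f.
Proof.
apply/measurable_EFinP; apply: measurable_funM.
  exact: (measurableT_comp mp measurable_fst).
exact: (measurableT_comp mq measurable_snd).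
Qed.

Lemma integral_abs_tensor : (\int[m1 \x m2]_z `|f z| =
  (\int[m1]_x `|p x| * \int[m2]_y `|q y|)%:E)%E.
Proof.
have iap := integrable_norm ip; have iaq := integrable_norm iq.
rewrite (fubini_tonelli1 (fun z => `|f z|%E)) //=; last first.
  exact: (measurableT_comp (@abse_measurable _ _) measurable_tensor).
rewrite /fubini_F /f /= EFinM.
have maq : measurable_fun setT (fun y => (`|q y|)%:E).
  by apply/measurable_EFinP; exact: measurableT_comp.
have mabsp : measurable_fun setT (fun x => (`|p x|)%:E).
  by apply/measurable_EFinP; exact: measurableT_comp.
have qE : (\int[m2]_y (`|q y|)%:E = (\int[m2]_y `|q y|)%:E)%E.
  by rewrite /Rintegral fineK// integrable_fin_num.
have pE : (\int[m1]_x (`|p x|)%:E = (\int[m1]_x `|p x|)%:E)%E.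
  by rewrite /Rintegral fineK// integrable_fin_num.
under eq_integral => x _.
  under eq_integral do rewrite normrM EFinM.
  rewrite ge0_integralZl_EFin// qE; over.
rewrite ge0_integralZr ?pE//.
by rewrite lee_fin; apply: Rintegral_ge0 => y _; exact: normr_ge0.
Qed.

Lemma integrable_tensor : (m1 \x m2)%E.-integrable setT f.
Proof.
apply/integrableP; split; first exact: measurable_tensor.
by rewrite integral_abs_tensor ltry.
Qed.

Lemma integral_tensor : (\int[m1 \x m2]_z f z = (\int[m1]_x p x * \int[m2]_y q y)%:E)%E.
Proof.
rewrite -integral12_prod_meas1; last exact: integrable_tensor.
rewrite /fubini_F /f /= EFinM.
under eq_integral => x _.
  under eq_integral do rewrite EFinM.
  rewrite integralZl// -[X in (_ * X)%E]fineK ?integrable_fin_num// -/(Rintegral _ _ _).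
  over.
rewrite integralZr//= -[X in (X * _)%E]fineK ?integrable_fin_num//.
Qed.

End product_of_integrals.

Section plane_measure.
Context {R : realType}.
Local Notation L := (measurableTypeR R).
Local Notation leb := (@lebesgue_measure R).

(** An alias of Lebesgue measure on the plane that carries the sigma-finiteness
    needed by iterated integrals. *)
Definition plane : set (L * L) -> \bar R := (leb \x leb)%E.

HB.instance Definition _ := Measure.copy plane (leb \x leb)%E.

Let plane_sigma_finite : sigma_finite setT plane.
Proof.
have /sigma_finiteP[F [TF ndF Foo]] := sigma_finiteT leb.
exists (fun n => F n `*` F n).
  rewrite -setXTT TF predeqE => -[x y]; split.
    move=> [/= [n _ Fnx] [k _ Fky]]; exists (maxn n k) => //; split.
    - by move: x Fnx; exact/subsetPset/ndF/leq_maxl.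
    - by move: y Fky; exact/subsetPset/ndF/leq_maxr.
  by move=> [n _ []/= ? ?]; split; exists n.
move=> k; have [mF Fk] := Foo k; split; first exact: measurableX.
by rewrite /plane product_measure1E// lte_mul_pinfty// ge0_fin_numE.
Qed.

HB.instance Definition _ :=
  Measure_isSigmaFinite.Build _ _ _ plane plane_sigma_finite.

End plane_measure.

Section second_moment.
Context {R : realType} (nu : probability R R).
Local Notation leb := (@lebesgue_measure R).
Hypothesis mom2 : nu.-integrable setT (fun x : R => (x ^+ 2)%:E).
Local Notation cstep := (cstep nu).
Local Notation F := (cdfun nu).
Variables (h : R -> R) (c : R).
Hypotheses (mh : measurable_fun setT h) (hc : forall x, `|h x| <= c).
Local Notation lin := (lin nu h).

Lemma integral_cstep2 x y : \int[nu]_u (cstep u x * cstep u y) = F (Num.min x y) - F x * F y.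
Proof.
have ist z := integrable_step_nu nu z.
have iF z : nu.-integrable setT (fun u => (F z * step u x)%:E).
  exact: (integrableZl measurableT (F z) (ist x)).
have iF' z : nu.-integrable setT (fun u => (F z * step u y)%:E).
  exact: (integrableZl measurableT (F z) (ist y)).
have Fst z : \int[nu]_u step u z = F z by rewrite /Rintegral cdfunE.
have ic z : nu.-integrable setT (fun u => (cst z u)%:E).
  exact: finite_measure_integrable_cst.
have i1 : nu.-integrable setT (fun u => (step u (Num.min x y) - F y * step u x)%:E).
  exact: (integrableB measurableT (ist (Num.min x y)) (iF y)).
have i2 : nu.-integrable setT (fun u => (step u (Num.min x y) - F y * step u x - F x * step u y)%:E).
  exact: (integrableB measurableT i1 (iF' x)).
transitivity (\int[nu]_u (step u (Num.min x y) - F y * step u x - F x * step u y + cst (F x * F y) u)).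
  apply: eq_Rintegral => u _; rewrite /cstep /=.
  have -> : step u (Num.min x y) = step u x * step u y.
    by rewrite /step le_min; case: (u <= x); case: (u <= y); rewrite ?mulr1 ?mulr0 ?mul0r.
  ring.
rewrite (RintegralD measurableT i2 (ic _)) (RintegralB measurableT i1 (iF' x)).
rewrite (RintegralB measurableT (ist _) (iF y)) (RintegralZl _ measurableT (ist x)).
rewrite (RintegralZl _ measurableT (ist y)) !Fst Rintegral_cst//= probability_setT mulr1.
ring.
Qed.

Let L := measurableTypeR R.
Let p (u x : R) : R := h x * cstep u x.
Let f (z : R * (L * L)) : \bar R := (p z.1 z.2.1 * p z.1 z.2.2)%:E.

Let ip u : leb.-integrable setT (EFin \o p u).
Proof. exact: integrable_weighted_cstep mom2 _ _ mh hc u. Qed.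

Let mf : measurable_fun setT f.
Proof.
have m1 := @measurable_fst _ _ R (L * L)%type.
have m2 := @measurable_snd _ _ R (L * L)%type.
have m21 : measurable_fun setT (fun z : R * (L * L) => z.2.1 : R).
  exact: (measurableT_comp measurable_fst m2).
have m22 : measurable_fun setT (fun z : R * (L * L) => z.2.2 : R).
  exact: (measurableT_comp measurable_snd m2).
apply/measurable_EFinP; apply: measurable_funM; apply: measurable_funM.
- exact: (measurableT_comp mh m21).
- exact: measurable_cstep.
- exact: (measurableT_comp mh m22).
- exact: measurable_cstep.
Qed.

Let K0 : 0 <= c. Proof. exact: le_trans (hc 0). Qed.

Let abs_f_le u : (\int[plane]_z `|f (u, z)| <=
  ((c * (1 + abs_moment nu)) ^+ 2 * weight u ^+ 2)%:E)%E.
Proof.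
rewrite /f/= (integral_abs_tensor leb leb (p u) (p u) (ip u) (ip u)) lee_fin -expr2 -exprMn.
have m10 : 0 <= abs_moment nu by apply: Rintegral_ge0 => x _; exact: normr_ge0.
have A0 : 0 <= \int[leb]_x `|p u x| by apply: Rintegral_ge0 => x _; exact: normr_ge0.
have w0 : 0 <= c * (1 + abs_moment nu) * weight u.
  by rewrite mulr_ge0 ?(le_trans ler01 (weight_ge1 u))// mulr_ge0// addr_ge0.
rewrite lerXn2r ?nnegrE//.
apply: (@le_trans _ _ (c * (`|u| + abs_moment nu))).
  apply: fine_le_real; first by rewrite mulr_ge0// addr_ge0.
  exact: (abs_lin_integral nu mom2 _ _ mh hc u).
rewrite -mulrA ler_wpM2l// /weight mulrDl mul1r mulrDr mulr1.
by have := mulr_ge0 m10 (normr_ge0 u); lra.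
Qed.

Let intf : (nu \x plane)%E.-integrable setT f.
Proof.
apply/integrable12ltyP => //.
have iw : nu.-integrable setT (fun u => ((c * (1 + abs_moment nu)) ^+ 2 * weight u ^+ 2)%:E).
  exact: (integrableZl measurableT _ (integrable_weight2 nu mom2)).
apply: (@le_lt_trans _ _ (\int[nu]_u ((c * (1 + abs_moment nu)) ^+ 2 * weight u ^+ 2)%:E)%E).
  apply: ge0_le_integral => //.
  - by move=> u _; exact: integral_ge0.
  - apply: (measurable_fun_fubini_tonelli_F (m2 := plane) (fun z => `|f z|%E)) => //.
    exact: measurableT_comp.
  - by case/integrableP: iw.
rewrite -ge0_fin_numE; first exact: integrable_fin_num.
by apply: integral_ge0 => u _; rewrite lee_fin mulr_ge0 ?sqr_ge0.
Qed.

(** The square of [lin u] is a double integral over the plane, and averaging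
    over [u] first leaves the covariance of two step functions. *)
Lemma integral_lin2 : \int[nu]_u (lin u ^+ 2) =
  \int[(leb \x leb)%E]_z (h z.1 * h z.2 * (F (Num.min z.1 z.2) - F z.1 * F z.2)).
Proof.
rewrite /Rintegral; congr fine.
transitivity (\int[nu]_u \int[plane]_z f (u, z))%E.
  apply: eq_integral => u _.
  by rewrite /f/= (integral_tensor leb leb (p u) (p u) (ip u) (ip u)) -expr2.
rewrite (Fubini intf); apply: eq_integral => -[x y] _; rewrite /f /=.
have icc : nu.-integrable setT (fun u => (cstep u x * cstep u y)%:E).
  apply: (@integrable_bounded _ _ _ nu (fun u => cstep u x * cstep u y) 1).
    by apply: measurable_funM; exact: measurable_cstep.
  by move=> u; rewrite normrM -[leRHS]mulr1 ler_pM// cstep_le1.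
have iall : nu.-integrable setT (fun u => (p u x * p u y)%:E).
  rewrite (_ : (fun u => _) = (fun u => (h x * h y * (cstep u x * cstep u y))%:E)).
    exact: (integrableZl measurableT (h x * h y) icc).
  by apply/funext => u; congr EFin; rewrite /p; ring.
rewrite -[LHS]fineK ?integrable_fin_num// -/(Rintegral _ _ _); congr EFin.
rewrite -integral_cstep2 -(RintegralZl _ measurableT icc).
by apply: eq_Rintegral => u _; rewrite /p; ring.
Qed.

End second_moment.

(** * Integrating a score against quantile functions *)

Section levels.
Context {R : realType}.
Local Notation leb := (@lebesgue_measure R).

Lemma step_itvr (g1 g2 : R) : g1 <= g2 ->
  (fun s => step s g2 - step s g1) = \1_(`]g1, g2]%classic).
Proof.
move=> g12; apply/funext => s; rewrite /step indicE mem_setE in_itv/=.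
have [s2|s2] := leP s g2; have [s1|s1] := leP s g1 => //=; rewrite ?subrr ?subr0//.
by have := le_trans s1 g12; rewrite leNgt s2.
Qed.

Lemma integral_abs_stepBr (g1 g2 : R) :
  (\int[leb]_s (`|step s g2 - step s g1|)%:E = (`|g2 - g1|)%:E)%E.
Proof.
wlog g12 : g1 g2 / g1 <= g2 => [H|].
  have [/H//|/ltW g21] := leP g1 g2.
  rewrite distrC -(H _ _ g21); apply: eq_integral => x _.
  by rewrite distrC.
under eq_integral => s _.
  rewrite (_ : step s g2 - step s g1 = \1_(`]g1, g2]%classic) s); last by rewrite -(step_itvr _ _ g12).
  rewrite ger0_norm//; over.
rewrite integral_indic//= setIT lebesgue_measure_itv/=.
rewrite ger0_norm ?subr_ge0// lte_fin.
have [//|g21] := ltP g1 g2; have -> : g2 = g1 by apply/eqP; rewrite eq_le g12 g21.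
by rewrite subrr.
Qed.

Lemma integrable_stepBr (g1 g2 : R) : leb.-integrable setT (fun s => (step s g2 - step s g1)%:E).
Proof.
apply/integrableP; split.
  apply/measurable_EFinP; apply: measurable_funB; exact: measurable_step.
under eq_integral do rewrite abse_EFin.
by rewrite integral_abs_stepBr ltry.
Qed.

Lemma Rintegral_stepBr (g1 g2 : R) : \int[leb]_s (step s g2 - step s g1) = g2 - g1.
Proof.
wlog g12 : g1 g2 / g1 <= g2 => [H|].
  have [/H//|/ltW g21] := leP g1 g2.
  rewrite -[RHS]opprB -(H _ _ g21) -mulN1r -RintegralZl//; last exact: integrable_stepBr.
  by apply: eq_Rintegral => x _; rewrite mulN1r opprB.
have := integral_abs_stepBr g1 g2.
under eq_integral => x _.
  rewrite (_ : step x g2 - step x g1 = \1_(`]g1, g2]%classic) x); last by rewrite -(step_itvr _ _ g12).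
  rewrite ger0_norm// -(step_itvr _ _ g12); over.
by rewrite /Rintegral => ->; rewrite /= ger0_norm ?subr_ge0.
Qed.

Section score.
Variables (J : R -> R) (K C : R).
Hypotheses (mJ : measurable_fun setT J) (JC : forall u, `|J u| <= C)
  (lipJ : forall u v, `|J u - J v| <= K * `|u - v|) (K0 : 0 <= K).

Local Notation U := (`]0%R, 1%R[%classic : set R).

(** The integral of [J] from [g1] to [g2], written so that it can be exchanged
    with an integral over the line. *)
Definition score_increment (g1 g2 : R) : R :=
  \int[leb]_(s in U) (J s * (step s g2 - step s g1)).

Lemma integrable_score_step (g1 g2 : R) :
  leb.-integrable setT (fun s => (J s * (step s g2 - step s g1))%:E).
Proof.
have ic : leb.-integrable setT (fun s => (C * (step s g2 - step s g1))%:E).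
  exact: (integrableZl measurableT C (integrable_stepBr g1 g2)).
apply: le_integrable ic => //.
  apply/measurable_EFinP; apply: measurable_funM => //.
  by apply: measurable_funB; exact: measurable_step.
move=> s _; rewrite /= lee_fin !normrM ler_wpM2r//.
by rewrite (le_trans (JC s))// ler_norm.
Qed.

Lemma score_incrementE (g1 g2 : R) : 0 <= g1 <= 1 -> 0 <= g2 <= 1 ->
  score_increment g1 g2 = \int[leb]_s (J s * (step s g2 - step s g1)).
Proof.
move=> /andP[g10 g11] /andP[g20 g21].
have iT := integrable_score_step g1 g2.
rewrite /score_increment Rintegral_itv_bndo_bndc; last first.
  by apply: integrableS iT => //; exact: subsetT.
rewrite Rintegral_mkcond; apply: eq_Rintegral => s _.
rewrite patchE; case: ifPn => // sU.
rewrite /step; have [s0|s0] := leP s 0.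
  by rewrite (le_trans s0 g10) (le_trans s0 g20) subrr mulr0.
have s1 : 1 < s by move: sU; rewrite mem_setE in_itv/= s0/= -ltNge.
have -> : (s <= g2) = false by apply/negbTE; rewrite -ltNge (le_lt_trans g21).
have -> : (s <= g1) = false by apply/negbTE; rewrite -ltNge (le_lt_trans g11).
by rewrite subrr mulr0.
Qed.

Lemma score_increment_taylor (g1 g2 : R) : 0 <= g1 <= 1 -> 0 <= g2 <= 1 ->
  `|score_increment g1 g2 - J g2 * (g2 - g1)| <= K * (g2 - g1) ^+ 2.
Proof.
move=> g101 g201; rewrite score_incrementE//.
have iT := integrable_score_step g1 g2.
have iD := integrable_stepBr g1 g2.
have ig : leb.-integrable setT (fun s => (J g2 * (step s g2 - step s g1))%:E).
  exact: (integrableZl measurableT (J g2) iD).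
have idf : leb.-integrable setT (fun s => ((J s - J g2) * (step s g2 - step s g1))%:E).
  have := integrableB measurableT iT ig; congr (integrable _ _ _).
  by apply/funext => s /=; rewrite -EFinB mulrBl.
have -> : \int[leb]_s (J s * (step s g2 - step s g1)) - J g2 * (g2 - g1) =
    \int[leb]_s ((J s - J g2) * (step s g2 - step s g1)).
  rewrite -[g2 - g1]Rintegral_stepBr -(RintegralZl _ measurableT iD).
  rewrite -(RintegralB measurableT iT ig); apply: eq_Rintegral => s _; ring.
apply: le_trans (le_normr_Rintegral measurableT idf) _.
apply: fine_le_real; first by rewrite mulr_ge0// sqr_ge0.
apply: (@le_trans _ _ (\int[leb]_s ((K * `|g2 - g1|)%:E * (`|step s g2 - step s g1|)%:E))%E).
  apply: ge0_le_integral => //.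
  - by apply/measurable_EFinP; apply: measurableT_comp => //; case/integrableP: idf => /measurable_EFinP.
  - apply: emeasurable_funM => //; apply/measurable_EFinP; apply: measurableT_comp => //.
    by apply: measurable_funB; exact: measurable_step.
  - move=> s _; rewrite -EFinM lee_fin normrM.
    have [->|sN] := eqVneq (step s g2 - step s g1) 0; first by rewrite normr0 !mulr0.
    rewrite ler_wpM2r// (le_trans (lipJ _ _))// ler_wpM2l//.
    (* a nonzero increment means that [s] lies between [g1] and [g2] *)
    move: sN; rewrite /step; have [s2|s2] := leP s g2; have [s1|s1] := leP s g1;
      rewrite ?subrr ?eqxx//= => _.
      by rewrite ler0_norm ?subr_le0// ger0_norm; lra.
    by rewrite gtr0_norm ?subr_gt0// ler0_norm; lra.
rewrite ge0_integralZl_EFin//; last 2 first.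
- apply/measurable_EFinP; apply: measurableT_comp => //.
  by apply: measurable_funB; exact: measurable_step.
- by rewrite mulr_ge0.
rewrite integral_abs_stepBr -EFinM lee_fin -mulrA -expr2.
by rewrite real_normK ?num_real.
Qed.

Section two_quantiles.
Variables (q1 q2 G1 G2 : R -> R).
Hypotheses (mq1 : measurable_fun setT q1) (mq2 : measurable_fun setT q2)
  (iq1 : leb.-integrable U (EFin \o q1)) (iq2 : leb.-integrable U (EFin \o q2))
  (q1P : forall s x : R, 0 < s < 1 -> (q1 s <= x) = (s <= G1 x))
  (q2P : forall s x : R, 0 < s < 1 -> (q2 s <= x) = (s <= G2 x)).

Let L := measurableTypeR R.
Let f (z : L * L) : \bar R :=
  (\1_U z.1 * (J z.1 * (step (q2 z.1) z.2 - step (q1 z.1) z.2)))%:E.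

Let mf : measurable_fun setT f.
Proof.
have mz1 : measurable_fun setT (fun z : L * L => z.1 : R) := measurable_fst.
have mz2 : measurable_fun setT (fun z : L * L => z.2 : R) := measurable_snd.
apply/measurable_EFinP; apply: measurable_funM.
  have mI : measurable_fun setT (\1_U : R -> R) by exact: measurable_indic.
  exact: (measurableT_comp mI mz1).
apply: measurable_funM; first exact: (measurableT_comp mJ mz1).
by apply: measurable_funB; apply: measurable_step => //;
  [exact: (measurableT_comp mq2 mz1)|exact: (measurableT_comp mq1 mz1)].
Qed.

Let iqT (q : R -> R) : leb.-integrable U (EFin \o q) ->
  leb.-integrable setT (fun s => (\1_U s * q s)%:E).
Proof.
move=> iq; have mU : measurable (U : set L) by exact: measurable_itv.
have := (integrable_mkcond (mu := leb) (EFin \o q) mU).1 iq.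
congr (integrable _ _ _); apply/funext => s.
by rewrite epatch_indic /= -EFinM mulrC.
Qed.

Let inner s : (\int[leb]_x f (s, x) = (\1_U s * (J s * (q1 s - q2 s)))%:E)%E.
Proof.
have i1 := integrable_stepB (q2 s) (q1 s).
have i2 : leb.-integrable setT (fun x => (\1_U s * J s * (step (q2 s) x - step (q1 s) x))%:E).
  exact: (integrableZl measurableT (\1_U s * J s) i1).
rewrite /f/=; under eq_integral do rewrite mulrA.
rewrite -[LHS]fineK ?integrable_fin_num// -/(Rintegral _ _ _).
by rewrite (RintegralZl _ measurableT i1) Rintegral_stepB mulrA.
Qed.

Let absinner s : (\int[leb]_x `|f (s, x)| = (\1_U s * (`|J s| * `|q1 s - q2 s|))%:E)%E.
Proof.
have mabs : measurable_fun setT (fun x : L => (`|step (q2 s) x - step (q1 s) x|)%:E).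
  apply/measurable_EFinP; apply: measurableT_comp => //.
  by apply: measurable_funB; exact: measurable_step.
have k0 : 0 <= `|\1_U s| * `|J s| :> R by rewrite mulr_ge0.
rewrite /f/=; under eq_integral do rewrite !normrM mulrA EFinM.
rewrite ge0_integralZl_EFin//.
rewrite integral_abs_stepB -EFinM distrC mulrA ger0_norm//.
Qed.

Let intf : (leb \x leb)%E.-integrable setT f.
Proof.
apply/integrable12ltyP => //.
have i1 := integrable_norm (iqT q1 iq1); have i2 := integrable_norm (iqT q2 iq2).
have C0 : 0 <= C := le_trans (normr_ge0 _) (JC 0).
have iB : leb.-integrable setT (fun s => (C * (`|\1_U s * q1 s| + `|\1_U s * q2 s|))%:E).
  have iB0 : leb.-integrable setT (fun s => (`|\1_U s * q1 s| + `|\1_U s * q2 s|)%:E).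
    exact: (integrableD measurableT i1 i2).
  exact: (integrableZl measurableT C iB0).
apply: (@le_lt_trans _ _ (\int[leb]_s (C * (`|\1_U s * q1 s| + `|\1_U s * q2 s|))%:E)%E).
  apply: ge0_le_integral => //.
  - by move=> s _; exact: integral_ge0.
  - apply: (measurable_fun_fubini_tonelli_F (m2 := leb) (fun z => `|f z|%E)) => //.
    exact: (measurableT_comp (@abse_measurable _ _) mf).
  - by case/integrableP: iB.
  - move=> s _; rewrite absinner lee_fin mulrCA; apply: ler_pM => //.
    have -> : \1_U s * `|q1 s - q2 s| = `|\1_U s * q1 s - \1_U s * q2 s|.
      by rewrite -mulrBr normrM [`|\1_U s|]ger0_norm.
    exact: ler_normB.
rewrite -ge0_fin_numE; first exact: integrable_fin_num.
by apply: integral_ge0 => s _; rewrite lee_fin mulr_ge0// addr_ge0.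
Qed.

Let outer x : (\int[leb]_s f (s, x) = (score_increment (G1 x) (G2 x))%:E)%E.
Proof.
have iT := integrable_score_step (G1 x) (G2 x).
have iU : leb.-integrable U (fun s => (J s * (step s (G2 x) - step s (G1 x)))%:E).
  by apply: integrableS iT => //; exact: subsetT.
rewrite /score_increment /Rintegral fineK ?integrable_fin_num//.
rewrite [RHS]integral_mkcond epatch_indic; apply: eq_integral => s _.
rewrite /f /= -EFinM mulrC indicE.
have [sU|_] := boolP (s \in _); last by rewrite !mulr0.
move: sU; rewrite mem_setE in_itv/= => sU.
by rewrite /step !q1P// !q2P.
Qed.

Lemma integrable_score_increment :
  leb.-integrable setT (fun x => (score_increment (G1 x) (G2 x))%:E).
Proof.
have mfx x : measurable_fun setT (fun s : L => f (s, x)) by exact: measurable_fun_pair1 mf.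
apply/integrableP; split.
  rewrite (_ : (fun x => _) = fubini_G leb f); first exact: (measurable_fubini_G intf).
  by apply/funext => x; rewrite /fubini_G outer.
apply: le_lt_trans ((integrable21ltyP leb leb mf).1 intf).
apply: ge0_le_integral => //.
- apply: (measurableT_comp (@abse_measurable _ _)).
  rewrite (_ : (fun x => _) = fubini_G leb f); first exact: (measurable_fubini_G intf).
  by apply/funext => x; rewrite /fubini_G outer.
- apply: (measurable_fun_fubini_tonelli_G (m1 := leb) (fun z => `|f z|%E)) => //.
  exact: (measurableT_comp (@abse_measurable _ _) mf).
- by move=> x _; rewrite -outer; exact: le_abse_integral.
Qed.

(** Integrating a difference of quantile functions against [J] amounts to
    integrating the increments of the primitive of [J] between the two
    distribution functions: both are the integral of [J] over the region
    enclosed by their graphs. *)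
Lemma quantile_exchange :
  \int[leb]_(s in U) (J s * (q1 s - q2 s)) =
  \int[leb]_x score_increment (G1 x) (G2 x).
Proof.
rewrite /Rintegral; congr fine.
transitivity (\int[leb]_s \int[leb]_x f (s, x))%E.
  rewrite integral_mkcond epatch_indic; apply: eq_integral => s _.
  by rewrite inner /= -EFinM mulrC.
by rewrite (Fubini intf); apply: eq_integral => x _; rewrite outer.
Qed.

End two_quantiles.
End score.
End levels.

(** * Order statistics *)

Section order_statistics.
Context {R : realType}.
Local Notation leb := (@lebesgue_measure R).
Local Notation U := (`]0%R, 1%R[%classic : set R).

Definition ostat (s : seq R) (i : nat) : R := nth 0 (sort <=%R s) i.

Lemma ostat_le (s : seq R) i (x : R) : (i < size s)%N ->
  (ostat s i <= x) = (i < count (<= x) s)%N.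
Proof.
move=> si; rewrite /ostat.
have ss : sorted <=%R (sort <=%R s) by exact: sort_le_sorted.
have cE : count (<= x) (sort <=%R s) = count (<= x) s.
  by apply/permP; rewrite perm_sort.
apply/idP/idP => [|h]; last by apply: nth_count_le => //; rewrite cE.
apply: contraTT; rewrite -leqNgt -ltNge -cE => h.
by apply: nth_count_gt => //; rewrite h size_sort.
Qed.

Definition ecdf (s : seq R) (x : R) : R := (\sum_(u <- s) step u x) / (size s)%:R.

Lemma count_step (s : seq R) (x : R) : (count (<= x) s)%:R = \sum_(u <- s) step u x.
Proof.
elim: s => [|u s IHs]; first by rewrite big_nil.
by rewrite big_cons /= natrD IHs.
Qed.

Lemma ecdf_itv (s : seq R) (x : R) : (0 < size s)%N -> 0 <= ecdf s x <= 1.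
Proof.
move=> s0; rewrite /ecdf -count_step; apply/andP; split.
  by rewrite divr_ge0.
by rewrite ler_pdivrMr ?ltr0n// mul1r ler_nat count_size.
Qed.

(** The empirical quantile function on ]0, 1], written as a finite sum so that
    measurability, integrability and its integral against a score are those of
    indicators of intervals. *)
Definition equantile (s : seq R) (sg : R) : R :=
  \sum_(i < size s) ostat s i *
    (step sg (i.+1%:R / (size s)%:R) - step sg (i%:R / (size s)%:R)).

Lemma equantile_ostat (s : seq R) (sg : R) (i : nat) : (i < size s)%N ->
  i%:R < sg * (size s)%:R <= i.+1%:R -> equantile s sg = ostat s i.
Proof.
move=> si /andP[i1 i2]; have n0 : 0 < (size s)%:R :> R by rewrite ltr0n (leq_trans _ si).
have stepE (k : nat) : step sg (k%:R / (size s)%:R) = (i < k)%N%:R.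
  rewrite /step; congr ((nat_of_bool _)%:R); rewrite ler_pdivlMr//.
  apply/idP/idP => [h|ik]; first by rewrite -(ltr_nat R) (lt_le_trans i1).
  by rewrite (le_trans i2)// ler_nat.
rewrite /equantile (bigD1 (Ordinal si))//= !stepE ltnn ltnSn subr0 mulr1.
rewrite big1 ?addr0// => j /negPf ji; rewrite !stepE ltnS leq_eqVlt.
have -> : (i == j :> nat) = false by rewrite eq_sym; apply/negbTE; rewrite -(inj_eq val_inj) in ji; rewrite ji.
by rewrite orFb subrr mulr0.
Qed.

Lemma equantileP (s : seq R) (sg x : R) : (0 < size s)%N -> 0 < sg < 1 ->
  (equantile s sg <= x) = (sg <= ecdf s x).
Proof.
move=> s0 /andP[sg0 sg1].
have n0 : 0 < (size s)%:R :> R by rewrite ltr0n.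
have exk : exists k, sg * (size s)%:R <= k%:R.
  by exists (size s); rewrite ler_piMl// ltW.
case: (ex_minnP exk) => -[|i] ki kmin.
  by move: ki; rewrite leNgt mulr_gt0.
have i1 : i%:R < sg * (size s)%:R.
  by rewrite ltNge; apply/negP => /kmin; rewrite ltnn.
have si : (i < size s)%N.
  by apply: kmin; rewrite ler_piMl// ltW.
rewrite (equantile_ostat _ _ _ si) ?i1// ostat_le// /ecdf -count_step ler_pdivlMr//.
apply/idP/idP => [h|h]; first by rewrite (le_trans ki)// ler_nat.
by rewrite -(ltr_nat R) (lt_le_trans i1).
Qed.

Lemma measurable_equantile s : measurable_fun setT (equantile s).
Proof.
apply: measurable_sum => i; apply: measurable_funM => //.
by apply: measurable_funB; exact: measurable_step.
Qed.

Lemma integrable_equantile s : leb.-integrable U (EFin \o equantile s).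
Proof.
rewrite (_ : _ \o _ = (fun sg => \sum_(i < size s) (ostat s i *
    (step sg (i.+1%:R / (size s)%:R) - step sg (i%:R / (size s)%:R)))%:E)%E); last first.
  by apply/funext => sg; rewrite /= sumEFin.
apply: integrable_sum => // i _.
have iT := integrableZl measurableT (ostat s i)
  (integrable_stepBr (i%:R / (size s)%:R) (i.+1%:R / (size s)%:R)).
by apply: integrableS iT => //; exact: subsetT.
Qed.

Section score.
Variables (J : R -> R) (C : R).
Hypotheses (mJ : measurable_fun setT J) (JC : forall u, `|J u| <= C).

Lemma score_increment_itv (g1 g2 : R) : 0 <= g1 -> g1 <= g2 -> g2 <= 1 ->
  score_increment J g1 g2 = \int[leb]_(s in `[g1, g2]) J s.
Proof.
move=> g10 g12 g21.
have iT := integrable_score_step J C mJ JC g1 g2.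
rewrite (score_incrementE J C)//; last 2 first.
- by rewrite g10 (le_trans g12).
- by rewrite (le_trans g10).
have -> : \int[leb]_s (J s * (step s g2 - step s g1)) = \int[leb]_(s in `]g1, g2]) J s.
  rewrite [RHS]Rintegral_mkcond patch_indic; apply: eq_Rintegral => s _.
  by rewrite /= -(step_itvr _ _ g12).
rewrite Rintegral_itv_obnd_cbnd//.
have mI : measurable (`]g1, g2]%classic : set (measurableTypeR R)) by exact: measurable_itv.
apply/(integrable_mkcond (mu := leb) (EFin \o J) mI).
rewrite epatch_indic; move: iT; congr (integrable _ _ _).
by apply/funext => s; rewrite /= -EFinM -(step_itvr _ _ g12).
Qed.

Lemma integral_equantile s : \int[leb]_(sg in U) (J sg * equantile s sg) =
  \sum_(i < size s) ostat s i *
    \int[leb]_(u in `[i%:R / (size s)%:R, i.+1%:R / (size s)%:R]) J u.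
Proof.
pose f (i : 'I_(size s)) sg := J sg * (step sg (i.+1%:R / (size s)%:R) - step sg (i%:R / (size s)%:R)).
have iU i : leb.-integrable U (EFin \o f i).
  have iT := integrable_score_step J C mJ JC (i%:R / (size s)%:R) (i.+1%:R / (size s)%:R).
  by apply: integrableS iT => //; exact: subsetT.
have iUo (i : 'I_(size s)) : leb.-integrable U (fun sg => (ostat s i * f i sg)%:E).
  have mU : measurable (U : set (measurableTypeR R)) by exact: measurable_itv.
  exact: (integrableZl mU (ostat s i) (iU i)).
transitivity (\sum_(i < size s) ostat s i * \int[leb]_(sg in U) f i sg).
  transitivity (\int[leb]_(sg in U) \sum_(i < size s) ostat s i * f i sg).
    apply: eq_Rintegral => sg _; rewrite /equantile mulr_sumr.
    by apply: eq_bigr => i _; rewrite /f mulrCA.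
  rewrite /Rintegral; under eq_integral do rewrite -sumEFin.
  rewrite integral_sum//.
  rewrite (eq_bigr (fun i : 'I_(size s) => (ostat s i * \int[leb]_(sg in U) f i sg)%:E)) ?sumEFin// => i _.
  rewrite -[LHS]fineK ?integrable_fin_num// -/(Rintegral _ _ _).
  by rewrite (RintegralZl _ _ (iU i)).
apply: eq_bigr => i _; congr (_ * _); rewrite -/(score_increment _ _ _).
have n0 : 0 < (size s)%:R :> R by rewrite ltr0n (leq_trans _ (ltn_ord i)).
rewrite score_increment_itv//.
- by rewrite ler_pM2r ?invr_gt0// ler_nat.
- by rewrite ler_pdivrMr// mul1r ler_nat.
Qed.

End score.
End order_statistics.

Section measurability_of_order_statistics.
Context {d} {T : measurableType d} {R : realType} {P : probability T R}.
Variable Xs : nat -> {RV P >-> R}.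

Lemma order_statE n i w :
  order_stat (fun i => Xs i : T -> R) n i w = ostat (sample Xs n w) i.
Proof. by rewrite /order_stat /ostat sampleE. Qed.

(** The event that an order statistic is at most [x] only depends on the number
    of observations that are at most [x]. *)
Lemma measurable_order_stat n i : (i < n)%N ->
  measurable_fun setT (fun w => order_stat (fun i => Xs i : T -> R) n i w).
Proof.
move=> ni; apply: (measurability (@RGenOInfty.G R)).
  exact: RGenOInfty.measurableE.
move=> _ [_ [x ->] <-]; rewrite setTI.
rewrite (_ : _ @^-1` _ = [set w | \sum_(u <- sample Xs n w) step u x <= i%:R]).
  rewrite -[X in measurable X]setTI; apply: measurable_fun_le => //.
  apply: (measurableT_comp (measurable_sum_tuple n (step^~ x) _)).
    exact: measurable_step.
  exact: measurable_sample.
apply/seteqP; split => w /=; rewrite in_itv/= andbT order_statE -count_step ler_nat;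
  by rewrite ltNge ostat_le ?size_tuple// -leqNgt.
Qed.

Lemma measurable_L_stat J n :
  measurable_fun setT (L_stat J (fun i => Xs i : T -> R) n).
Proof.
apply: measurable_sum => i; apply: measurable_funM => //.
exact: measurable_order_stat.
Qed.

End measurability_of_order_statistics.

(** * The quantile function of a law *)

Section quantile_law.
Context {d} {T : measurableType d} {R : realType} {P : probability T R}.
Variable X : {RV P >-> R}.
Local Notation leb := (@lebesgue_measure R).
Local Notation nu := (distribution P X).
Local Notation F := (distribution_function X).
Local Notation U := (`]0%R, 1%R[%classic : set R).

Lemma distribution_function_nd (x y : R) : x <= y -> F x <= F y.
Proof.
move=> xy; rewrite /distribution_function fine_le ?fin_num_measure//.
exact: cdf_nondecreasing.
Qed.

Lemma distribution_function_itv (x : R) : 0 <= F x <= 1.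
Proof. by rewrite (cdfun_ge0 nu) (cdfun_le1 nu). Qed.

Lemma distribution_function_right_continuous (x : R) : F y @[y --> x^'+] --> F x.
Proof. by apply: fine_cvg; rewrite fineK ?fin_num_measure//; exact: cdf_right_continuous. Qed.

Lemma quantileP (s x : R) : 0 < s < 1 -> (quantile F s <= x) = (s <= F x).
Proof.
move=> /andP[s0 s1]; pose S := [set x | s <= F x].
have [y0 Sy0] : S !=set0.
  have Fy : F y @[y --> +oo] --> (1 : R) by apply: fine_cvg; exact: cvg_cdfy1.
  have : \forall y \near +oo, s < F y by exact: (cvgr_gt _ Fy).
  by move=> /filter_ex[y /ltW sy]; exists y.
have lbS : has_lbound S.
  have FNy : F y @[y --> -oo] --> (0 : R) by apply: fine_cvg; exact: cvg_cdfNy0.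
  have : \forall y \near -oo, F y < s by exact: (cvgr_lt _ FNy).
  move=> [M [_ HM]]; exists M => y Sy; rewrite leNgt; apply/negP => /HM.
  by move: Sy; rewrite /S/= leNgt => /negP.
apply/idP/idP => [qx|sx]; last by apply: ge_inf.
apply: le_trans (distribution_function_nd _ _ qx); rewrite leNgt; apply/negP => Fq.
have near1 : \forall y \near (quantile F s)^'+, F y < s.
  exact: (cvgr_lt _ (distribution_function_right_continuous (quantile F s))).
have near2 : \forall y \near (quantile F s)^'+, quantile F s < y by exact: nbhs_right_gt.
have [y [Fys qy]] := @filter_ex _ _ (at_right_proper_filter _) _ (filterI near1 near2).
have [z' Sz' zy'] : exists2 z', S z' & z' < y.
  have e0 : 0 < y - quantile F s by rewrite subr_gt0.
  have [z' Sz' zy'] := inf_adherent e0 (conj (ex_intro _ y0 Sy0) lbS).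
  by exists z' => //; move: zy'; rewrite /quantile -/S addrC subrK.
have := distribution_function_nd _ _ (ltW zy'); rewrite leNgt => /negP; apply.
exact: lt_le_trans Fys Sz'.
Qed.

(** The cut-off discards the arguments at which [quantile F] is the infimum of
    an empty set or of a set without lower bound. *)
Definition uquantile (s : R) : R := \1_U s * quantile F s.

Lemma uquantileE (s : R) : 0 < s < 1 -> uquantile s = quantile F s.
Proof. by move=> s01; rewrite /uquantile indicE mem_set ?mul1r//= in_itv. Qed.

Lemma uquantileP (s x : R) : 0 < s < 1 -> (uquantile s <= x) = (s <= F x).
Proof. by move=> s01; rewrite uquantileE// quantileP. Qed.

Lemma uquantile_preimage (x : R) : U `&` uquantile @^-1` `]x, +oo[ = `]F x, 1[%classic.
Proof.
have /andP[F0 F1] := distribution_function_itv x.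
apply/seteqP; split => s /=; rewrite !in_itv/= andbT.
  move=> [/andP[s0 s1]]; rewrite ltNge uquantileP ?s0// -ltNge => ->.
  by rewrite s1.
move=> /andP[Fs s1]; have s0 := le_lt_trans F0 Fs; split; first by rewrite s0.
by rewrite ltNge uquantileP ?s0// -ltNge.
Qed.

Lemma measurable_uquantile : measurable_fun setT uquantile.
Proof.
apply: (measurability (@RGenOInfty.G R)); first exact: RGenOInfty.measurableE.
move=> _ [_ [x ->] <-]; rewrite setTI.
rewrite (_ : _ @^-1` _ = `]F x, 1[%classic `|` (~` U `&` [set s | x < 0])).
  apply: measurableU => //; apply: measurableI; first exact: measurableC.
  have [x0|x0] := ltP x 0.
    by rewrite (_ : mkset _ = setT)//; apply/seteqP.
  by rewrite (_ : mkset _ = set0)//; apply/seteqP; split => //= s; rewrite ltNge x0.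
rewrite -uquantile_preimage; apply/seteqP; split => s /=.
  move=> sx; have [sU|sU] := pselect (U s); [by left|right; split => //].
  by move: sx; rewrite in_itv/= andbT /uquantile indicE memNset// mul0r.
move=> [[]//|[sU x0]].
by rewrite in_itv/= andbT /uquantile indicE memNset// mul0r.
Qed.

Lemma uniform_integral (f : R -> \bar R) : measurable_fun setT f ->
  (forall x, 0 <= f x)%E ->
  (\int[uniform_prob (@ltr01 R)]_s f s = \int[leb]_(s in U) f s)%E.
Proof.
move=> mf f0; rewrite integral_uniform// subr0 invr1 mul1e.
by apply: integral_itv_bndoo; exact: measurable_funTS.
Qed.

(** Half-lines determine a law, and by [uquantileP] their preimages in ]0, 1[
    are intervals of the right length. *)
Lemma quantile_law (A : set R) : measurable A ->
  nu A = uniform_prob (@ltr01 R) (uquantile @^-1` A).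
Proof.
move=> mA; pose m0 : {measure set _ -> \bar R} := pushforward (uniform_prob (@ltr01 R)) uquantile.
pose m := m0 measurable_uquantile.
change (nu A = m A).
apply: (measure_unique (@RGenOInfty.G R) (fun n => `]- n%:R, +oo[%classic)) => //.
- exact: RGenOInfty.measurableE.
- move=> _ _ [x ->] [y ->]; exists (Num.max x y).
  by apply/seteqP; split => z /=; rewrite !in_itv/= !andbT gt_max => /andP.
- by move=> n; exists (- n%:R).
- apply/seteqP; split => // x _; exists (Num.bound `|x|) => //=.
  rewrite in_itv/= andbT ltrNl; apply: le_lt_trans (archi_boundP (normr_ge0 x)).
  by rewrite -normrN ler_norm.
- move=> _ [x ->]; have /andP[F0 F1] := distribution_function_itv x.
  transitivity (1 - F x)%:E.
    rewrite (_ : `]x, +oo[%classic = ~` `]-oo, x]%classic); last by rewrite setCitvl.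
    have mI : measurable (`]-oo, x]%classic : set R) by [].
    apply: etrans (probability_setC nu mI) _.
    by rewrite EFinB /distribution_function fineK ?fin_num_measure.
  apply: esym.
  have mB : measurable (uquantile @^-1` `]x, +oo[).
    by rewrite -[X in measurable X]setTI; exact: measurable_uquantile.
  rewrite /m /m0 /= /pushforward -[X in uniform_prob _ X]setIT -integral_indic//.
  rewrite uniform_integral//; last by apply/measurable_EFinP; exact: measurable_indic.
  rewrite integral_indic// setIC uquantile_preimage.
  apply: (etrans (lebesgue_measure_itv `]F x, 1[)); rewrite /= lte_fin.
  have [//|F1'] := ltP (F x) 1.
  have -> : F x = 1 by apply/eqP; rewrite eq_le F1 F1'.
  by rewrite subrr.
- by move=> n; apply: le_lt_trans (probability_le1 _ _) (ltry _).
Qed.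

Lemma integral_uquantile (f : R -> \bar R) : measurable_fun setT f ->
  (\int[nu]_x f x = \int[leb]_(s in U) f (uquantile s))%E.
Proof.
have ge0 (g : R -> \bar R) : measurable_fun setT g -> (forall x, 0 <= g x)%E ->
    (\int[nu]_x g x = \int[leb]_(s in U) g (uquantile s))%E.
  move=> mg g0.
  have mgu : measurable_fun setT (g \o uquantile).
    exact: (measurableT_comp mg measurable_uquantile).
  rewrite -(uniform_integral (g \o uquantile) mgu (fun s => g0 _)).
  pose m0 : {measure set _ -> \bar R} := pushforward (uniform_prob (@ltr01 R)) uquantile.
  rewrite (eq_measure_integral (m0 measurable_uquantile)); last first.
    by move=> A mA _; rewrite [LHS]quantile_law.
  by rewrite ge0_integral_pushforward// ?preimage_setT//; exact: measurable_uquantile.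
move=> mf; rewrite [LHS]integralE [RHS]integralE.
congr (_ - _)%E.
  rewrite ge0//; last exact: measurable_funepos.
  by apply: eq_integral => s _; rewrite !funeposE.
rewrite ge0//; last exact: measurable_funeneg.
by apply: eq_integral => s _; rewrite !funenegE.
Qed.

Lemma integrable_uquantile : nu.-integrable setT (fun x : R => (`|x|)%:E) ->
  leb.-integrable U (EFin \o uquantile).
Proof.
move=> iabs; apply/integrableP; split.
  by apply: measurable_funTS; apply/measurable_EFinP; exact: measurable_uquantile.
have := integral_uquantile (fun x : R => (`|x|)%:E).
rewrite /= => <-; last exact/measurable_EFinP.
by have /integrableP[_] := iabs; under eq_integral do rewrite /= normr_id.
Qed.

Lemma quantile_mean_uquantile (J : R -> R) :
  measurable_fun (`[0%R, 1%R] : set R) J ->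
  quantile_mean J F = \int[leb]_(s in U) (J s * uquantile s).
Proof.
move=> mJ; rewrite /quantile_mean /Rintegral; congr fine.
have mU : measurable (U : set (measurableTypeR R)) by exact: measurable_itv.
have eqU : {in U, forall s, (quantile F s * J s)%:E = (J s * uquantile s)%:E}.
  move=> s; rewrite mem_setE in_itv/= => s01; rewrite uquantileE// mulrC//.
have mf : measurable_fun U (fun s => (quantile F s * J s)%:E).
  apply: (eq_measurable_fun (fun s => (J s * uquantile s)%:E)).
    by move=> s sU; rewrite eqU.
  apply/measurable_EFinP; apply: measurable_funM.
    by apply: measurable_funS mJ => //; exact: subset_itv_oo_cc.
  by apply: measurable_funTS; exact: measurable_uquantile.
rewrite integral_itv_bndoo//.
by apply: eq_integral => s sU; exact: eqU.
Qed.

(** Were [F] larger than [s] at the quantile, it would by continuity still be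
    larger slightly to the left of it. *)
Lemma distribution_function_quantile (s : R) : continuous F -> 0 < s < 1 -> F (quantile F s) = s.
Proof.
move=> cF s01; apply/eqP; rewrite eq_le -quantileP// lexx andbT.
rewrite leNgt; apply/negP => sF.
have near1 : \forall y \near quantile F s, s < F y by exact: (cvgr_gt _ (cF (quantile F s))).
have near2 : \forall y \near (quantile F s)^'-, s < F y by exact: cvg_within near1.
have near3 : \forall y \near (quantile F s)^'-, y < quantile F s by exact: nbhs_left_lt.
have [y [sFy yq]] := @filter_ex _ _ (at_left_proper_filter _) _ (filterI near2 near3).
have : quantile F s <= y by rewrite quantileP// ltW.
by rewrite leNgt yq.
Qed.

(** Substitute [x = quantile F s]; continuity is what turns [F x] into [s]. *)
Lemma mJF_quantile_mean (J : R -> R) : continuous F ->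
  measurable_fun setT J -> mJF J X = \int[leb]_(s in U) (J s * uquantile s).
Proof.
move=> cF mJ; rewrite /mJF /Rintegral; congr fine.
rewrite (integral_uquantile (fun x => (x * J (F x))%:E)).
  apply: eq_integral => s; rewrite mem_setE in_itv/= => s01.
  by rewrite uquantileE// distribution_function_quantile// mulrC.
apply/measurable_EFinP; apply: measurable_funM => //.
exact: (measurableT_comp mJ (measurable_cdfun nu)).
Qed.

End quantile_law.

(** * Linearization of an L-statistic *)

Section linearization.
Context {R : realType} (nu : probability R R).
Local Notation leb := (@lebesgue_measure R).
Local Notation U := (`]0%R, 1%R[%classic : set R).
Hypothesis mom2 : nu.-integrable setT (fun x : R => (x ^+ 2)%:E).
Variables (J : R -> R) (K C : R).
Hypotheses (mJ : measurable_fun setT J) (JC : forall u : R, `|J u| <= C)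
  (lipJ : forall u v : R, `|J u - J v| <= K * `|u - v|) (K0 : 0 <= K).
Variable q : R -> R.
Hypotheses (mq : measurable_fun setT q) (iq : leb.-integrable U (EFin \o q))
  (qP : forall s x : R, 0 < s < 1 -> (q s <= x) = (s <= cdfun nu x)).
Local Notation F := (cdfun nu).
Local Notation h := (fun x : R => J (F x)).

Lemma cdfun_itv (x : R) : 0 <= F x <= 1.
Proof. by rewrite (cdfun_ge0 nu) (cdfun_le1 nu). Qed.

Lemma measurable_score_cdfun : measurable_fun setT h.
Proof. exact: (measurableT_comp mJ (measurable_cdfun nu)). Qed.

Lemma bsum_ecdf (s : seq R) (x : R) : (0 < size s)%N ->
  ecdf s x - F x = bsum nu setT s x / (size s)%:R.
Proof.
move=> s0; have n0 : ((size s)%:R : R) != 0 by rewrite pnatr_eq0 -lt0n.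
rewrite /bsum /ecdf.
rewrite [in RHS](eq_bigr (fun u => step u x - F x)); last by move=> u _; rewrite indicE in_setT mul1r.
rewrite big_split/= sumrN.
rewrite (_ : \sum_(i <- s) F x = F x * (size s)%:R); last first.
  by rewrite big_const_seq count_predT iter_addr_0 mulr_natr.
by rewrite mulrBl mulfK.
Qed.

(** Replacing [J] by its value at [F x] in each increment leaves the empirical
    mean of the influence function; the error is quadratic in the deviation of
    the empirical distribution function, hence a Gram sum. *)
Lemma linearization (s : seq R) : (0 < size s)%N ->
  `|\int[leb]_(t in U) (J t * (equantile s t - q t))
    + (\sum_(u <- s) lin nu h u) / (size s)%:R| <=
  K / (size s)%:R ^+ 2 * gram (kern nu setT) s.
Proof.
move=> s0; set N := (size s)%:R : R.
have n0 : N != 0 by rewrite pnatr_eq0 -lt0n.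
have eqP' (t x : R) : 0 < t < 1 -> (equantile s t <= x) = (t <= ecdf s x).
  exact: equantileP.
have meq := measurable_equantile s; have ieq := integrable_equantile s.
rewrite (quantile_exchange J C mJ JC _ _ _ _ meq mq ieq iq eqP' qP).
have iSI := integrable_score_increment J C mJ JC _ _ _ _ meq mq ieq iq eqP' qP.
have hC x : `|h x| <= C by exact: JC.
have [iL EL] := Rintegral_mul_bsum nu mom2 setT h C s measurable_score_cdfun hC.
have iL' : leb.-integrable setT (fun x => (N^-1 * (h x * bsum nu setT s x))%:E).
  exact: (integrableZl measurableT N^-1 iL).
have i2 := integrable_bsum2 nu mom2 setT s.
have -> : (\sum_(u <- s) lin nu h u) / N =
    \int[leb]_x (N^-1 * (h x * bsum nu setT s x)).
  rewrite RintegralZl// EL mulrC; congr (_ * _).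
  by apply: eq_bigr => u _; rewrite indicE in_setT mul1r.
rewrite -RintegralD//.
rewrite gram_kern// -RintegralZl//.
rewrite -lee_fin EFin_normr_Rintegral//; last exact: (integrableD measurableT iSI iL').
have i2' : leb.-integrable setT (fun x => (K / N ^+ 2 * bsum nu setT s x ^+ 2)%:E).
  exact: (integrableZl measurableT (K / N ^+ 2) i2).
rewrite [leRHS]fineK ?integrable_fin_num//.
apply: (le_trans (le_abse_integral _ measurableT _)).
  by case/integrableP: (integrableD measurableT iSI iL').
apply: ge0_le_integral => //.
- apply: (measurableT_comp (@abse_measurable _ _)).
  by case/integrableP: (integrableD measurableT iSI iL').
- by case/integrableP: i2'.
move=> x _; rewrite lee_fin.
have -> : N^-1 * (h x * bsum nu setT s x) = - (J (F x) * (F x - ecdf s x)).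
  by rewrite -mulrN opprB bsum_ecdf// /N; ring.
apply: le_trans (score_increment_taylor J K C mJ JC lipJ K0 _ _ (ecdf_itv s x s0) (cdfun_itv x)) _.
rewrite -mulrA ler_wpM2l// -sqrrN opprB bsum_ecdf// -/N exprMn exprVn mulrC //.
Qed.

End linearization.

(** * The quadratic remainder *)

Section moderate_deviations.
Context {d} {T : measurableType d} {R : realType} {P : probability T R}.
Variables (Xs : nat -> {RV P >-> R}) (nu : probability R R) (a : nat -> R).
Hypotheses (indep : mutually_independent Xs)
  (law : forall i (A : set R), measurable A -> P (Xs i @^-1` A) = nu A).
Hypotheses (a_gt0 : forall n, (0 < n)%N -> 0 < a n)
  (a_oo : a n @[n --> \oo] --> +oo)
  (slope_ni : forall m n, (0 < m)%N -> (m <= n)%N -> slope a n <= slope a m)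
  (slope0 : slope a n @[n --> \oo] --> (0 : R))
  (light_tail : forall K, \forall n \near \oo,
     n%:R * tail nu (level a n) <= expR (- (K * a n ^+ 2)))
  (mom2 : nu.-integrable setT (fun x : R => (x ^+ 2)%:E)).

Lemma cnorm_bound (x : R) : `|cnorm nu x| <= (1 + abs_moment nu) * weight x.
Proof. by rewrite ger0_norm ?sqrtr_ge0// cnorm_le. Qed.

(** In the bulk the norm [cnorm] has exponential moments at the exponent
    [slope a n], whose square is the speed divided by [n]. *)
Lemma cosh_gram_bound : exists rho : R, \forall n \near \oo,
  (\int[P]_w (cosh (slope a n * Num.sqrt (gram (kern nu (bulk a n)) (sample Xs n w))))%:E
     <= (expR (rho * a n ^+ 2))%:E)%E.
Proof.
have m10 : 0 <= abs_moment nu by apply: Rintegral_ge0 => x _; exact: normr_ge0.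
have C0 : 0 < 1 + abs_moment nu by lra.
have mc := measurable_cnorm nu mom2.
have c0 (x : R) : 0 <= cnorm nu x by exact: sqrtr_ge0.
have [r1 near1] := truncated_exp_moment nu a a_gt0 slope_ni slope0 light_tail mom2
  (cnorm nu) _ mc C0 cnorm_bound c0.
have [r2 near2] := truncated_drift nu a a_gt0 a_oo mom2 (cnorm nu) _ mc C0 cnorm_bound c0.
exists (r1 + r2); near=> n.
have n0 : (0 < n)%N by near: n; exists 1%N.
have l0 : 0 < slope a n by exact: slope_gt0.
have mB : measurable (bulk a n) by exact: measurable_bulk.
set B := bulk a n.
have trE (u : R) : Num.sqrt (kern nu B u u) = truncate a (cnorm nu) n u.
  by rewrite sqrt_kern.
set D := \int[nu]_v (cnorm nu v * \1_(~` B) v).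
have D0 : 0 <= D by apply: Rintegral_ge0 => v _; rewrite mulr_ge0.
have H1 : \int[nu]_x (expR (slope a n * truncate a (cnorm nu) n x) -
    slope a n * truncate a (cnorm nu) n x) <= 1 + r1 * slope a n ^+ 2 by near: n.
have H2 : slope a n * D <= r2 * slope a n ^+ 2 by rewrite /D /B; near: n; exact: near2.
have int_exp : nu.-integrable setT
    (fun u : R => (expR (slope a n * Num.sqrt (kern nu B u u)))%:E).
  under eq_fun do rewrite trE.
  exact: (integrable_expR_truncate nu a a_gt0 (cnorm nu) _ mc C0 cnorm_bound n n0).
have mean_exp : \int[nu]_u (expR (slope a n * Num.sqrt (kern nu B u u)) -
    slope a n * Num.sqrt (kern nu B u u)) <= 1 + r1 * slope a n ^+ 2.
  by under eq_Rintegral do rewrite trE.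
have := pinelis Xs nu indep law (kern nu B) (slope a n) D _
  (measurable_kern nu mom2 B mB) (kernC nu B) (gram_kern_ge0 nu mom2 B)
  (kern_cauchy_schwarz nu mom2 B) (ltW l0) D0 int_exp
  (integrable_sum_kern nu mom2 B mB) (kern_drift nu mom2 B mB) mean_exp n.
move=> /le_trans; apply; rewrite lee_fin.
set y := (r1 + r2) * slope a n ^+ 2.
have My : 1 + r1 * slope a n ^+ 2 + slope a n * D <= 1 + y by rewrite /y; lra.
have M0 : 0 <= 1 + r1 * slope a n ^+ 2 + slope a n * D.
  apply: addr_ge0; last by rewrite mulr_ge0// ltW.
  apply: le_trans H1; apply: Rintegral_ge0 => x _.
  by have := expR_ge1Dx (slope a n * truncate a (cnorm nu) n x); lra.
have -> : (r1 + r2) * a n ^+ 2 = n%:R * y by rewrite -(slope_sqr a)// /y; ring.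
rewrite expRM_natl.
apply: lerXn2r; rewrite ?nnegrE ?expR_ge0//.
by apply: le_trans My _; exact: expR_ge1Dx.
Unshelve. all: by end_near. Qed.

(** Chernoff's bound: on the event, [slope a n] times the norm is at least of
    the order of [a n ^+ 2 / sqrt (slope a n)], which exceeds every multiple of
    [a n ^+ 2] since [slope a n] vanishes. *)
Lemma gram_tail (c del K : R) : 0 < c -> 0 < del -> \forall n \near \oo,
  (P [set w | (del <= Num.sqrt n%:R / a n * (c / n%:R ^+ 2 *
       gram (kern nu (bulk a n)) (sample Xs n w)))%R]
     <= (expR (- (K * a n ^+ 2)))%:E)%E.
Proof.
move=> c0 del0; have [rho near_cosh] := cosh_gram_bound.
(* the target rate, the growth of the [cosh] moment, and a constant factor *)
pose D : R := `|K| + `|rho| + 2.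
have D0 : 0 < D by rewrite ltr_wpDl ?addr_ge0.
near=> n.
have n0 : (0 < n)%N by near: n; exists 1%N.
have l0 : 0 < slope a n by exact: slope_gt0.
have an1 : 1 <= a n by near: n; move/cvgryPge : a_oo; exact.
have small : slope a n <= del / (c * D ^+ 2).
  near: n; have e0 : 0 < del / (c * D ^+ 2) by rewrite divr_gt0 ?mulr_gt0 ?exprn_gt0.
  by apply: (cvgr_le _ slope0).
set B := bulk a n; set G := fun w => gram (kern nu B) (sample Xs n w).
have mB : measurable B by exact: measurable_bulk.
have mG : measurable_fun setT G.
  apply: (measurableT_comp (measurable_gram n _ (measurable_kern nu mom2 B mB))).
  exact: measurable_sample.
set Y := fun w => 2 * cosh (slope a n * Num.sqrt (G w)).
have mY : measurable_fun setT Y.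
  apply: measurable_funM => //; apply: (measurableT_comp measurable_cosh).
  by apply: measurable_funM => //; exact: (measurableT_comp measurable_sqrtr).
set A := [set w | _].
have mA : measurable A.
  rewrite -[X in measurable X]setTI; apply: measurable_fun_le => //.
  by apply: measurable_funM => //; exact: measurable_funM.
have a2 : 1 <= a n ^+ 2 by rewrite expr_ge1// (le_trans ler01 an1).
apply: (@le_trans _ _ (expR (1 + rho * a n ^+ 2 - D * a n ^+ 2))%:E).
  apply: le_trans (expR_markov P A Y (D * a n ^+ 2) mA mY _ _) _.
  - by move=> w; rewrite mulr_ge0// ltW// cosh_gt0.
  - move=> w; rewrite /A/= -/B -/(G w) => delG.
    apply: le_trans (expR_le_cosh _); rewrite ler_expR.
    have G0 : 0 <= G w by exact: gram_kern_ge0.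
    have E : Num.sqrt n%:R / a n * (c / n%:R ^+ 2 * G w) =
        c / a n ^+ 4 * slope a n * (slope a n ^+ 2 * G w).
      rewrite /slope -[X in c / X ^+ 2](@sqr_sqrtr R n%:R)//; have /lt0r_neq0 sn := @sqrtn_gt0 R _ n0.
      have /lt0r_neq0 an := a_gt0 _ n0.
      by field; rewrite sn an.
    rewrite E in delG.
    have sG : (D * a n ^+ 2) ^+ 2 <= slope a n ^+ 2 * G w.
      have Q0 : 0 < (D * a n ^+ 2) ^+ 2 by rewrite exprn_gt0// mulr_gt0// exprn_gt0// a_gt0.
      have X0 : 0 <= slope a n ^+ 2 * G w by rewrite mulr_ge0 ?sqr_ge0.
      have : del <= del / (D * a n ^+ 2) ^+ 2 * (slope a n ^+ 2 * G w).
        apply: (le_trans delG); rewrite ler_wpM2r//.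
        have /lt0r_neq0 an := a_gt0 _ n0.
        have -> : del / (D * a n ^+ 2) ^+ 2 = c / a n ^+ 4 * (del / (c * D ^+ 2)).
          by field; rewrite an !lt0r_neq0.
        by rewrite ler_wpM2l// divr_ge0 ?exprn_ge0 ?ltW// a_gt0.
      by rewrite mulrAC -mulrA ler_pMr// ler_pdivlMr// mul1r.
    have -> : slope a n * Num.sqrt (G w) = Num.sqrt (slope a n ^+ 2 * G w).
      by rewrite sqrtrM ?sqr_ge0// sqrtr_sqr gtr0_norm.
    by apply: le_trans (ler_wsqrtr sG); rewrite sqrtr_sqr ler_norm.
  - rewrite addrC expRD EFinM lee_wpmul2l ?lee_fin ?expR_ge0//.
    rewrite /Y; under eq_integral do rewrite EFinM.
    rewrite ge0_integralZl_EFin//; last first.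
      apply/measurable_EFinP; apply: (measurableT_comp measurable_cosh).
      by apply: measurable_funM => //; exact: (measurableT_comp measurable_sqrtr).
      by move=> w _; rewrite lee_fin ltW// cosh_gt0.
    rewrite expRD EFinM; apply: lee_pmul => //.
    + by apply: integral_ge0 => w _; rewrite lee_fin ltW// cosh_gt0.
    + by rewrite lee_fin; have := expR_ge1Dx (1 : R); lra.
    + rewrite /G /B; near: n; exact: near_cosh.
rewrite lee_fin ler_expR.
have := ler_wpM2r (le_trans ler01 a2) (ler_norm K).
have := ler_wpM2r (le_trans ler01 a2) (ler_norm rho).
rewrite /D; lra.
Unshelve. all: by end_near. Qed.

(** * The linear part *)

Section truncated_sum.
Variables (Z : R -> R) (C s : R).
Hypotheses (mZ : measurable_fun setT Z) (C0 : 0 < C)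
  (ZC : forall x, `|Z x| <= C * weight x)
  (Z0 : \int[nu]_x Z x = 0) (Z2 : \int[nu]_x (Z x ^+ 2) = s).

Definition truncated_sum n (w : T) : R :=
  (\sum_(u <- sample Xs n w) truncate a Z n u) / level a n.

Lemma measurable_truncated_sum n : measurable_fun setT (truncated_sum n).
Proof.
apply: measurable_funM => //.
apply: (measurableT_comp (measurable_sum_tuple n (truncate a Z n) _)).
  exact: measurable_truncate.
exact: measurable_sample.
Qed.

(** By independence the moment is [(1 + slope a n ^+ 2 * y) ^+ n], where [y]
    tends to [th ^+ 2 * s / 2] by [truncated_mgf]; since [n * slope a n ^+ 2] is
    the speed, its logarithm divided by the speed tends to the same limit. *)
Lemma truncated_sum_exp_moments (th eta : R) : 0 < eta -> \forall n \near \oo,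
  ((expR (a n ^+ 2 * (th ^+ 2 * s / 2 - eta)))%:E <=
   \int[P]_w (expR (a n ^+ 2 * th * truncated_sum n w))%:E <=
   (expR (a n ^+ 2 * (th ^+ 2 * s / 2 + eta)))%:E)%E.
Proof.
move=> eta0.
pose g x := th * Z x; pose D := (`|th| + 1) * C.
have mg : measurable_fun setT g by exact: measurable_funM.
have D0 : 0 < D by rewrite mulr_gt0// ltr_wpDl.
have gD x : `|g x| <= D * weight x.
  rewrite /g normrM /D -mulrA ler_pM// ?ZC// lerDl//.
have iZ := integrable_growth nu mom2 Z C mZ ZC.
have iZ2 := integrable_growth2 nu mom2 Z C mZ ZC.
have g0 : \int[nu]_x g x = 0 by rewrite /g (RintegralZl _ measurableT iZ) Z0 mulr0.
have g2 : \int[nu]_x (g x ^+ 2) = th ^+ 2 * s.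
  under eq_Rintegral do rewrite /g exprMn.
  by rewrite (RintegralZl _ measurableT iZ2) Z2.
set t := th ^+ 2 * s / 2.
have t0 : 0 <= t.
  by rewrite /t -g2 divr_ge0// Rintegral_ge0// => x _; exact: sqr_ge0.
have eta2 : 0 < eta / 2 by rewrite divr_gt0.
have near_mgf := truncated_mgf nu a a_gt0 a_oo slope_ni slope0 light_tail mom2
  g D mg D0 gD _ g0 g2 (eta / 2) eta2.
pose Y := t + eta.
have Y0 : 0 < Y by rewrite ltr_wpDl.
near=> n.
have n0 : (0 < n)%N by near: n; exists 1%N.
have l0 : 0 < slope a n by exact: slope_gt0.
have l1 : slope a n <= 1 by near: n; exact: (cvgr_le _ slope0 _ ltr01).
have lY : slope a n <= (2 * Y)^-1.
  near: n; apply: (cvgr_le _ slope0); by rewrite invr_gt0 mulr_gt0.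
have leta : slope a n <= eta / (4 * Y ^+ 2).
  by near: n; apply: (cvgr_le _ slope0); rewrite divr_gt0// mulr_gt0// exprn_gt0.
have an0 := a_gt0 _ n0.
set f := fun x => slope a n * truncate a g n x.
set M := \int[nu]_x expR (f x).
have HM : `|(M - 1) / slope a n ^+ 2 - t| <= eta / 2 by rewrite /M/f/t; near: n; exact: near_mgf.
have iE : nu.-integrable setT (fun x => (expR (f x))%:E).
  exact: (integrable_expR_truncate nu a a_gt0 g D mg D0 gD n n0).
have ME : (\int[nu]_x (expR (f x))%:E = M%:E)%E by rewrite /M /Rintegral fineK// integrable_fin_num.
have mf : measurable_fun setT f.
  by apply: measurable_funM => //; exact: measurable_truncate.
have -> : (\int[P]_w (expR (a n ^+ 2 * th * truncated_sum n w))%:E = (M ^+ n)%:E)%E.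
  rewrite -(mgf_sum Xs nu indep law n f M mf ME); apply: eq_integral => w _.
  congr (expR _)%:E.
  rewrite /f -mulr_sumr /truncated_sum /truncate /g.
  under [in RHS]eq_bigr do rewrite -mulrA.
  rewrite -[in RHS]mulr_sumr -(slope_level a n n0).
  have /lt0r_neq0 := level_gt0 a a_gt0 _ n0 => ln0.
  by field.
set y := (M - 1) / slope a n ^+ 2 in HM.
have E : M = 1 + slope a n ^+ 2 * y.
  by rewrite /y; field; exact: lt0r_neq0.
move: HM; rewrite ler_distl => /andP[y1 y2].
have l2l : slope a n ^+ 2 <= slope a n by rewrite expr2 ler_piMr// ltW.
have l20 : 0 <= slope a n ^+ 2 by exact: sqr_ge0.
have yY : `|y| <= Y by rewrite ler_norml /Y; apply/andP; split; lra.
set x := slope a n ^+ 2 * y.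
have xle : `|x| <= 2^-1.
  rewrite /x normrM ger0_norm//.
  apply: le_trans (ler_pM _ _ (le_trans l2l lY) yY) _ => //.
  by rewrite invfM -mulrA mulVf ?mulr1// lt0r_neq0.
have x2 : - 2^-1 <= x by move: xle; rewrite ler_norml => /andP[].
have M0 : 0 <= M by rewrite E -/x; lra.
have aE := slope_sqr a n n0.
rewrite !lee_fin; apply/andP; split.
  apply: (@le_trans _ _ (expR (x - 2 * x ^+ 2) ^+ n)); last first.
    by apply: lerXn2r; rewrite ?nnegrE ?expR_ge0// E -/x expR_le1D.
  rewrite -expRM_natl ler_expR -aE -mulrA ler_wpM2l//.
  have -> : x - 2 * x ^+ 2 = slope a n ^+ 2 * (y - 2 * (slope a n ^+ 2 * y ^+ 2)).
    by rewrite /x; ring.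
  rewrite ler_wpM2l//.
  have : slope a n ^+ 2 * y ^+ 2 <= eta / 4.
    have -> : eta / 4 = eta / (4 * Y ^+ 2) * Y ^+ 2 by field; rewrite lt0r_neq0.
    rewrite ler_pM ?sqr_ge0// ?(le_trans l2l)//.
    by rewrite -[y ^+ 2]real_normK ?num_real// lerXn2r// nnegrE// ltW.
  lra.
apply: (@le_trans _ _ (expR x ^+ n)).
  by apply: lerXn2r; rewrite ?nnegrE ?expR_ge0// E -/x expR_ge1Dx.
rewrite -expRM_natl ler_expR -aE -mulrA ler_wpM2l// /x ler_wpM2l//; lra.
Unshelve. all: by end_near. Qed.

End truncated_sum.

(** The union bound costs a factor [n], which [light_tail] takes into account. *)
Lemma sample_in_bulk (K : R) : \forall n \near \oo,
  (P (\big[setU/set0]_(i < n) (Xs i @^-1` [set x | (level a n <= `|x|)%R]))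
     <= (expR (- (K * a n ^+ 2)))%:E)%E.
Proof.
near=> n.
have mL : measurable [set x : R | level a n <= `|x|] by exact: measurable_tail_set.
have mXL i : measurable (Xs i @^-1` [set x | level a n <= `|x|]).
  by rewrite -[X in measurable X]setTI; exact: measurable_funP.
have := Boole_inequality P (A := fun i : nat => Xs i @^-1` [set x | level a n <= `|x|])
  (n := n) (fun i _ => mXL i).
move=> /le_trans; apply.
rewrite (eq_bigr (fun=> (tail nu (level a n))%:E)); last first.
  by move=> i _; apply: (etrans (law i _ mL)); rewrite /tail fineK// fin_num_measure.
rewrite sumEFin sumr_const card_ord -mulr_natl lee_fin.
by near: n.
Unshelve. all: by end_near. Qed.

Lemma gram_bulk n (s : seq R) : {in s, forall x, `|x| <= level a n} ->
  gram (kern nu setT) s = gram (kern nu (bulk a n)) s.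
Proof.
move=> sB; apply: eq_big_seq => x xs; apply: eq_big_seq => y ys.
by rewrite /kern !indicE !in_setT !mem_set//; apply: sB.
Qed.

(** * Large deviations of L-statistics *)

Section L_statistics.
Local Notation leb := (@lebesgue_measure R).
Local Notation U := (`]0%R, 1%R[%classic : set R).
Variables (J : R -> R) (K C : R).
Hypotheses (mJ : measurable_fun setT J) (JC : forall u : R, `|J u| <= C)
  (lipJ : forall u v : R, `|J u - J v| <= K * `|u - v|) (K0 : 0 <= K).
Variable q : R -> R.
Hypotheses (mq : measurable_fun setT q) (iq : leb.-integrable U (EFin \o q))
  (qP : forall s x : R, 0 < s < 1 -> (q s <= x) = (s <= cdfun nu x)).
Local Notation h := (fun x : R => J (cdfun nu x)).
Local Notation L n w := (L_stat J (fun i => Xs i : T -> R) n w).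
Let mu : R := \int[leb]_(t in U) (J t * q t).
Let Z u : R := - lin nu h u.
Let Cz : R := (C + 1) * (1 + abs_moment nu).

Let mh : measurable_fun setT h.
Proof. exact: measurable_score_cdfun. Qed.

Let hC x : `|h x| <= C. Proof. exact: JC. Qed.

Let mZ : measurable_fun setT Z.
Proof. by apply: measurableT_comp => //; exact: measurable_lin mom2 h C mh hC. Qed.

Let m10 : 0 <= abs_moment nu.
Proof. by apply: Rintegral_ge0 => x _; exact: normr_ge0. Qed.

Let C0 : 0 <= C. Proof. exact: le_trans (JC 0). Qed.

Let Cz0 : 0 < Cz.
Proof. by rewrite /Cz mulr_gt0//; have := m10; have := C0; lra. Qed.

Let ZC x : `|Z x| <= Cz * weight x.
Proof.
rewrite /Z normrN; apply: le_trans (lin_le nu mom2 h C mh hC x) _.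
rewrite /Cz -mulrA ler_pM// ?addr_ge0 ?lerDl// /weight.
by have := mulr_ge0 m10 (normr_ge0 x); rewrite mulrDl mul1r mulrDr mulr1; lra.
Qed.

Let Z0 : \int[nu]_x Z x = 0.
Proof.
have iL := integrable_lin nu mom2 h C mh hC.
rewrite /Z; under eq_Rintegral do rewrite -mulN1r.
by rewrite (RintegralZl _ measurableT iL) (integral_lin0 nu mom2 h C mh hC) mulr0.
Qed.

Let integrable_score_mul (p : R -> R) : measurable_fun setT p ->
  leb.-integrable U (EFin \o p) -> leb.-integrable U (fun t => (J t * p t)%:E).
Proof.
move=> mp ip; have mU : measurable (U : set (measurableTypeR R)) by exact: measurable_itv.
have iC : leb.-integrable U (fun t => (C * p t)%:E) by exact: (integrableZl mU C ip).
apply: le_integrable iC => //.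
  by apply/measurable_EFinP; apply: measurable_funTS; exact: measurable_funM.
by move=> t _; rewrite /= lee_fin !normrM (ger0_norm C0) ler_wpM2r.
Qed.

Lemma L_stat_linearization n w : (0 < n)%N ->
  `|L n w - mu - (\sum_(u <- sample Xs n w) Z u) / n%:R| <=
  K / n%:R ^+ 2 * gram (kern nu setT) (sample Xs n w).
Proof.
move=> n0; have s0 : (0 < size (sample Xs n w))%N by rewrite size_tuple.
have := linearization nu mom2 J K C mJ JC lipJ K0 q mq iq qP _ s0.
rewrite size_tuple; congr (`|_| <= _).
have mU : measurable (U : set (measurableTypeR R)) by exact: measurable_itv.
have i1 := integrable_score_mul _ (measurable_equantile (sample Xs n w))
  (integrable_equantile (sample Xs n w)).
have i2 := integrable_score_mul _ mq iq.
have -> : L n w = \int[leb]_(t in U) (J t * equantile (sample Xs n w) t).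
  rewrite (integral_equantile J C mJ JC) size_tuple /L_stat.
  by apply: eq_bigr => i _; rewrite order_statE.
rewrite /mu -RintegralB//; congr (_ + _).
  by apply: eq_Rintegral => t _; rewrite mulrBr.
by rewrite /Z sumrN mulNr opprK.
Qed.

(** If all observations lie in the bulk, truncation changes neither the linear
    part nor the Gram sum of the remainder, which [gram_tail] bounds. *)
Lemma L_stat_near_truncated_sum (del B : R) : 0 < del -> \forall n \near \oo,
  (P [set w | (del <= `|Num.sqrt n%:R / a n * (L n w - mu)
     - truncated_sum Z n w|)%R] <= (expR (- (B * a n ^+ 2)))%:E)%E.
Proof.
move=> del0.
(* [gram_tail] takes a positive constant, while [K] may vanish *)
have K10 : 0 < K + 1 by rewrite ltr_wpDl.
have near_gram := gram_tail (K + 1) del (B + 1) K10 del0.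
have near_bulk := sample_in_bulk (B + 1).
near=> n.
have n0 : (0 < n)%N by near: n; exists 1%N.
have an1 : 1 <= a n by near: n; move/cvgryPge : a_oo; exact.
have an0 := a_gt0 _ n0; have sn0 := @sqrtn_gt0 R n n0.
set G := fun w => gram (kern nu (bulk a n)) (sample Xs n w).
set A := [set w | (del <= Num.sqrt n%:R / a n * ((K + 1) / n%:R ^+ 2 * G w))%R].
set O := \big[setU/set0]_(i < n) (Xs i @^-1` [set x | (level a n <= `|x|)%R]).
have PA : (P A <= (expR (- ((B + 1) * a n ^+ 2)))%:E)%E.
  by rewrite /A /G; near: n; exact: near_gram.
have PO : (P O <= (expR (- ((B + 1) * a n ^+ 2)))%:E)%E.
  by rewrite /O; near: n; exact: near_bulk.
have mB : measurable (bulk a n) by exact: measurable_bulk.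
have mG : measurable_fun setT G.
  apply: (measurableT_comp (measurable_gram n _ (measurable_kern nu mom2 _ mB))).
  exact: measurable_sample.
have mA : measurable A.
  rewrite -[X in measurable X]setTI; apply: measurable_fun_le => //.
  by apply: measurable_funM => //; exact: measurable_funM.
have mO : measurable O.
  apply: bigsetU_measurable => i _; rewrite -[X in measurable X]setTI.
  by apply: measurable_funP => //; exact: measurable_tail_set.
have mD : measurable [set w | (del <= `|Num.sqrt n%:R / a n * (L n w - mu)
     - truncated_sum Z n w|)%R].
  rewrite -[X in measurable X]setTI; apply: measurable_fun_le => //.
  apply: measurableT_comp => //; apply: measurable_funB; last exact: measurable_truncated_sum.
  by apply: measurable_funM => //; apply: measurable_funB => //; exact: measurable_L_stat.
apply: (@le_trans _ _ (P (A `|` O))).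
  rewrite le_measure ?inE//; first exact: measurableU.
  move=> w /= Hw; have [wO|wO] := pselect (O w); [by right|left].
  have inB : {in (sample Xs n w : seq R), forall x, `|x| <= level a n}.
    move=> x /tnthP[i ->]; rewrite leNgt; apply/negP => li; apply: wO.
    rewrite /O -(bigcup_mkord n (fun i : nat => Xs i @^-1` [set x | (level a n <= `|x|)%R])); exists i => //=; apply: ltW.
    by move: li; rewrite /sample tnth_mktuple.
  apply: (le_trans Hw).
  have -> : truncated_sum Z n w =
      Num.sqrt n%:R / a n * ((\sum_(u <- sample Xs n w) Z u) / n%:R).
    rewrite /truncated_sum (eq_big_seq Z); last first.
      by move=> u /inB uB; rewrite truncate_in.
    rewrite /level -[X in _ = _ * (_ / X)](@sqr_sqrtr R n%:R)//.
    by field; rewrite !lt0r_neq0.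
  have sa : 0 <= Num.sqrt n%:R / a n by rewrite divr_ge0// ltW.
  rewrite -mulrBr normrM (ger0_norm sa) ler_wpM2l//.
  apply: le_trans (L_stat_linearization n w n0) _; rewrite (gram_bulk n _ inB) -/(G w).
  rewrite ler_wpM2r//; first exact: gram_kern_ge0.
  by rewrite ler_wpM2r ?invr_ge0 ?sqr_ge0// lerDl.
have := measureU2 P mA mO; move=> /le_trans; apply.
apply: le_trans (leeD PA PO) _.
rewrite -EFinD lee_fin.
have -> : - ((B + 1) * a n ^+ 2) = - (B * a n ^+ 2) - a n ^+ 2 by ring.
rewrite expRD -mulrDr ler_piMr ?expR_ge0//.
have a1 : 1 <= a n ^+ 2 by rewrite expr_ge1// (le_trans ler01 an1).
have : expR (- a n ^+ 2) <= 2^-1; last lra.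
rewrite expRN lef_pV2 ?posrE ?expR_gt0//.
by apply: le_trans (expR_ge1Dx _); lra.
Unshelve. all: by end_near. Qed.

Theorem L_stat_LDP : 0 < \int[nu]_u (lin nu h u ^+ 2) ->
  LDP P (fun n w => Num.sqrt n%:R / a n * (L n w - mu) : R^o) (fun n => a n ^+ 2)
    (fun x : R^o => (x ^+ 2 / (2 * \int[nu]_u (lin nu h u ^+ 2)))%:E).
Proof.
move=> s0; apply: (gaussian_LDP P _ (truncated_sum Z)) => //.
- move=> n; apply: measurable_funM => //; apply: measurable_funB => //.
  exact: measurable_L_stat.
- by move=> n; exact: measurable_truncated_sum.
- by move=> n n0; rewrite exprn_gt0// a_gt0.
- apply/cvgryPge => A; near=> n.
  have an1 : 1 <= a n by near: n; move/cvgryPge : a_oo; exact.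
  have aA : A <= a n by near: n; move/cvgryPge : a_oo; exact.
  by apply: (le_trans aA); rewrite expr2 ler_peMr// (le_trans ler01).
- move=> th eta eta0; apply: (truncated_sum_exp_moments Z Cz _ mZ Cz0 ZC Z0) => //.
  by apply: eq_Rintegral => x _; rewrite /Z sqrrN.
- by move=> del B del0; exact: L_stat_near_truncated_sum.
Unshelve. all: by end_near. Qed.

End L_statistics.
End moderate_deviations.

(** * Scores on the unit interval *)

Section clamping.
Context {R : realType}.

Definition clamp (u : R) : R := Num.max 0 (Num.min 1 u).

Lemma clamp_id (u : R) : 0 <= u <= 1 -> clamp u = u.
Proof. by move=> /andP[u0 u1]; rewrite /clamp (min_idPr u1) (max_idPr u0). Qed.

Lemma clamp_itv (u : R) : 0 <= clamp u <= 1.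
Proof. by rewrite /clamp le_max lexx/= ge_max ler01 ge_min lexx. Qed.

Lemma clamp_contraction (u v : R) : `|clamp u - clamp v| <= `|u - v|.
Proof.
have uv := ler_norm (u - v); have vu := ler_norm (v - u).
rewrite distrC in vu; rewrite ler_norml /clamp.
have [u1|u1] := leP 1 u; have [v1|v1] := leP 1 v; rewrite ?(max_idPr ler01);
  do 2 ?[have [?|?] := leP 0 _]; apply/andP; split; lra.
Qed.

Lemma lipschitz_measurable (f : R -> R) (K : R) :
  (forall u v : R, `|f u - f v| <= K * `|u - v|) -> measurable_fun setT f.
Proof.
move=> fK; apply: continuous_measurable_fun => x.
apply/cvgrPdist_le => e e0.
have K0 : 0 < `|K| + 1 by rewrite ltr_wpDl.
near=> y.
apply: le_trans (fK x y) _.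
have xy : `|x - y| <= e / (`|K| + 1).
  by near: y; apply: (@cvgr_dist_le _ _ _ _ _ idfun x) => //; rewrite divr_gt0.
apply: le_trans (_ : (`|K| + 1) * `|x - y| <= _).
  by rewrite ler_wpM2r// (le_trans (ler_norm K))// lerDl.
by rewrite mulrC -ler_pdivlMr.
Unshelve. all: by end_near. Qed.

(** Only the values of the score on [0, 1] matter; composing with [clamp]
    extends them to a Lipschitz function on the line. *)
Lemma lipschitz_extension (J : R -> R) : [lipschitz J u | u in `[0, 1]] ->
  exists K, 0 <= K /\ forall u v : R, `|J (clamp u) - J (clamp v)| <= K * `|u - v|.
Proof.
move=> [M [_ HM]]; pose K := `|M| + 1; exists K.
have K0 : 0 <= K by rewrite addr_ge0.
split => // u v.
have MK : M < K by rewrite /K (le_lt_trans (ler_norm M))// ltrDl.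
have J_le := HM K MK (clamp u, clamp v).
apply: (le_trans (J_le _)); last by rewrite ler_wpM2l// clamp_contraction.
by split; rewrite /= in_itv/= clamp_itv.
Qed.

End clamping.

Section transfer.
Context {d} {T : measurableType d} {R : realType} {P : probability T R}.
Variables (X : {RV P >-> R}) (J : R -> R).
Local Notation F := (distribution_function X).
Let Jc u := J (clamp u).

Lemma L_stat_clamp (Y : nat -> T -> R) n w : L_stat J Y n w = L_stat Jc Y n w.
Proof.
apply: eq_bigr => i _; congr (_ * _).
have n0 : 0 < n%:R :> R by rewrite ltr0n (leq_trans _ (ltn_ord i)).
apply: eq_Rintegral => u; rewrite mem_setE in_itv/= => /andP[u1 u2].
rewrite /Jc clamp_id//; apply/andP; split.
  by apply: le_trans u1; rewrite divr_ge0.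
by apply: (le_trans u2); rewrite ler_pdivrMr// mul1r ler_nat.
Qed.

Lemma quantile_mean_clamp : quantile_mean J F = quantile_mean Jc F.
Proof.
by apply: eq_Rintegral => u; rewrite mem_setE in_itv/= => u01; rewrite /Jc clamp_id.
Qed.

Lemma mJF_clamp : mJF J X = mJF Jc X.
Proof. by apply: eq_Rintegral => x _; rewrite /Jc clamp_id// distribution_function_itv. Qed.

Lemma sigma2_clamp : sigma2 J F = sigma2 Jc F.
Proof. by apply: eq_Rintegral => z _; rewrite /Jc !clamp_id// distribution_function_itv. Qed.

Lemma integrable_sqr_distribution : ('E_P[fun w => (X w ^+ 2)%R] < +oo)%E ->
  (distribution P X).-integrable setT (fun x : R => (x ^+ 2)%:E).
Proof.
rewrite unlock => X2.
have mx2 : measurable_fun setT (fun x : R => (x ^+ 2)%:E).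
  by apply/measurable_EFinP; exact: measurable_funX.
apply/integrableP; split => //.
rewrite ge0_integral_distribution//=; last exact: (measurableT_comp (@abse_measurable _ _) mx2).
by under eq_integral do rewrite ger0_norm ?sqr_ge0//.
Qed.

Lemma light_tail_distribution (a : nat -> R) : (forall n, (0 < n)%N -> 0 < a n) ->
  limn_esup (fun n => ((a n ^+ 2)^-1)%:E *
    lne (n%:R%:E * P [set w | (Num.sqrt n%:R * a n <= `|X w|)%R]))%E = -oo%E ->
  forall K, \forall n \near \oo,
    n%:R * tail (distribution P X) (level a n) <= expR (- (K * a n ^+ 2)).
Proof.
move=> a0 /limn_esup_Ny supNy K; have near_log := supNy (- K).
near=> n.
have n0 : (0 < n)%N by near: n; exists 1%N.
have an2 : 0 < a n ^+ 2 by rewrite exprn_gt0// a0.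
have H : (((a n ^+ 2)^-1)%:E *
    lne (n%:R%:E * P [set w | (Num.sqrt n%:R * a n <= `|X w|)%R]) <= (- K)%:E)%E by near: n.
rewrite log_le// ?mule_ge0// in H.
rewrite -lee_fin EFinM /tail fineK ?fin_num_measure//; last exact: measurable_tail_set.
by move: H; rewrite mulrN [a n ^+ 2 * _]mulrC => H; exact: H.
Unshelve. all: by end_near. Qed.

End transfer.

Theorem theorem4p9 (R : realType) (d : measure_display) (T : measurableType d)
    (P : probability T R) (X : {RV P >-> R}) (Xs : nat -> {RV P >-> R})
    (J : R -> R) (a : nat -> R)
    (F := distribution_function X)
    (L := L_stat J (fun i => Xs i : T -> R))
    (rate := fun x : R^o => (x ^+ 2 / (2 * sigma2 J F))%:E : \bar R) :
  mutually_independent Xs ->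
  (forall i, identically_distributed (Xs i) X) ->
  ('E_P[fun w => (X w ^+ 2)%R] < +oo)%E ->
  0 < sigma2 J F ->
  (Lambda21 X < +oo)%E ->
  (forall n, (0 < n)%N -> 0 < a n) ->
  (forall m n, (0 < m)%N -> (m <= n)%N -> a m <= a n) ->
  a n @[n --> \oo] --> +oo ->
  (forall m n, (0 < m)%N -> (m <= n)%N ->
     a n / Num.sqrt n%:R <= a m / Num.sqrt m%:R) ->
  a n / Num.sqrt n%:R @[n --> \oo] --> (0 : R) ->
  limn_esup (fun n => ((a n ^+ 2)^-1)%:E *
    lne (n%:R%:E * P [set w | (Num.sqrt n%:R * a n <= `|X w|)%R]))%E = -oo%E ->
  [lipschitz J u | u in `[0, 1]] ->
  (continuous F ->
     LDP P (fun n w => Num.sqrt n%:R / a n * (L n w - mJF J X) : R^o)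
       (fun n => a n ^+ 2) rate) /\
  LDP P (fun n w => Num.sqrt n%:R / a n * (L n w - quantile_mean J F) : R^o)
    (fun n => a n ^+ 2) rate.
Proof.
move=> indep idd X2 s0 _ a_gt0 _ a_oo slope_ni slope0 supNy /lipschitz_extension[K [K0 lipJ]].
pose nu := distribution P X.
pose Jc u := J (clamp u).
have mom2 := integrable_sqr_distribution X X2.
have light_tail := light_tail_distribution X a a_gt0 supNy.
have law i (A : set R) : measurable A -> P (Xs i @^-1` A) = nu A by exact: idd.
have mJ : measurable_fun setT Jc by exact: lipschitz_measurable lipJ.
pose C := `|Jc 0| + K.
have JC u : `|Jc u| <= C.
  have /andP[u0 u1] := clamp_itv u.
  have -> : Jc u = Jc 0 + (Jc (clamp u) - Jc 0) by rewrite [RHS]addrC subrK /Jc [clamp (clamp u)]clamp_id// clamp_itv.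
  apply: le_trans (ler_normD _ _) _; rewrite lerD2l.
  by apply: (le_trans (lipJ _ _)); rewrite subr0 ger0_norm// ler_piMr.
have mq := measurable_uquantile X.
have iq := integrable_uquantile X (integrable_abs nu mom2).
have sE : sigma2 J F = \int[nu]_u (lin nu (fun x => Jc (cdfun nu x)) u ^+ 2).
  rewrite sigma2_clamp (integral_lin2 nu mom2 _ C)//.
  exact: measurable_score_cdfun.
have main := L_stat_LDP Xs nu a indep law a_gt0 a_oo slope_ni slope0 light_tail mom2
  Jc K C mJ JC lipJ K0 _ mq iq (uquantileP X).
rewrite -sE in main; have {}main := main s0.
have LE n w : L n w = L_stat Jc (fun i => Xs i : T -> R) n w by exact: L_stat_clamp.
split=> [cF|].
  rewrite mJF_clamp (mJF_quantile_mean X Jc cF mJ).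
  by under eq_fun do under eq_fun do rewrite LE.
rewrite quantile_mean_clamp (quantile_mean_uquantile X Jc); last exact: measurable_funTS.
by under eq_fun do under eq_fun do rewrite LE.
Qed.
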